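(* Let $f\in IV\cup III\cup II_a\cup II_b\cup II_c$. (1) Suppose $f$ has real coefficients and positive diagonal coefficients. Then $\mathrm{Aut}(H_f,\sigma_f)=\mathrm{Aut}(H_f,s_f)$. (2) Suppose $f\in II'_c$. Then again $\mathrm{Aut}(H_f,\sigma_f)=\mathrm{Aut}(H_f,s_f)$. (3) Suppose that $f\in IV$ with negative diagonal coefficient $\alpha$. Then $$\mathrm{Aut}(H_f,\mathfrak{s}_f)=\left\{\begin{pmatrix}a&-\bar b\\ b&\bar a\end{pmatrix}\ \Big|\ (a,b)\in\mathbb{C}^2\setminus\{0\}\right\}\Big/\langle\alpha I_2\rangle,$$ where matrices act linearly on $W$ and hence on $H_f=W/\langle\alpha I_2\rangle$.
   Context: $W=\mathbb{C}^2\setminus\{0\}$; $H_f=W/\langle f\rangle$. For an anti-holomorphic involution $s$ of $H_f$, $\mathrm{Aut}(H_f,s)$ is the group of biholomorphisms of $H_f$ commuting with $s$. Classes of contractions of $W$: - $IV$: $f(z,w)=(\alpha z,\alpha w)$, $0<|\alpha|<1$; - $III$: $f(z,w)=(\delta^r z,\delta w)$, $r\in\mathbb{N}$, $r\ge 2$, $0<|\delta|<1$; - $II_a$: $f(z,w)=(\delta^r z+w^r,\delta w)$, $r\in\mathbb{N}$, $r\ge2$, $0<|\delta|<1$; - $II_b$: $f(z,w)=(\alpha z+w,\alpha w)$, $0<|\alpha|<1$; - $II_c$: $f(z,w)=(\alpha z,\delta w)$, $0<|\alpha|<1$, $0<|\delta|<1$, $\alpha\ne\delta^r$ for all $r\in\mathbb{N}$;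 - $II'_c\subset II_c$: $f(z,w)=(\alpha z,\bar\alpha w)$, $0<|\alpha|<1$, $\alpha\notin\mathbb{R}$. The diagonal coefficients of $f$ are the coefficient of $z$ in the first component and the coefficient of $w$ in the second component. Let $c(z,w)=(\bar z,\bar w)$, $c'(z,w)=(\bar w,\bar z)$, $J(z,w)=(-\bar w,\bar z)$. The standard (even) Real structure $s_f$ on $H_f$ is induced by $c$ if $f$ has real coefficients and by $c'$ if $f\in II'_c$. If $f$ has real coefficients and positive diagonal coefficients, $\sigma_f$ is the Real structure on $H_f$ induced by $c\circ f^{1/2}$, where $f^{1/2}$ is the following square root of $f$: $(\alpha^{1/2}z,\alpha^{1/2}w)$ for $f\in IV$; $(\delta^{r/2}z,\delta^{1/2}w)$ for $f\in III$; $(\delta^{r/2}z+\frac12\delta^{-r/2}w^r,\delta^{1/2}w)$ for $f\in II_a$; $(\alpha^{1/2}z+\frac12\alpha^{-1/2}w,\alpha^{1/2}w)$ for $f\in II_b$; $(\alpha^{1/2}z,\delta^{1/2}w)$ for $f\in II_c$ (positive roots). If $f\in II'_c$, $f(z,w)=(\alpha z,\bar\alpha w)$, choose a square root $\alpha^{1/2}$ of $\alpha$; $\sigma_f$ is induced by $c'\circ f^{1/2}$ with $f^{1/2}(z,w)=(\alpha^{1/2}z,\overline{\alpha^{1/2}}w)$. If $f(z,w)=(\alpha z,\alpha w)$ with $\alpha\in(-1,0)$, choose a square root $\alpha^{1/2}$ of $\alpha$; $\mathfrak{s}_f$ is the Real structure induced by $J\circ f^{1/2}$ with $f^{1/2}(z,w)=(\alpha^{1/2}z,\alpha^{1/2}w)$.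 *)

(* Defs.v *)
From HB Require Import structures.
From mathcomp Require Import all_boot all_order all_algebra.
From mathcomp Require Import generic_quotient.
From mathcomp Require Import complex.
From mathcomp Require Import all_classical all_reals all_analysis.
From mathcomp Require Import ring.

Set Implicit Arguments.
Unset Strict Implicit.
Unset Printing Implicit Defensive.

Import Order.TTheory GRing.Theory Num.Theory.
Import numFieldNormedType.Exports.

Local Open Scope ring_scope.
Local Open Scope quotient_scope.
Local Open Scope classical_set_scope.

(* The ascription as a numClosedFieldType is what gives R[i] its norm, topology
   and normed module structures over itself. *)
Definition Cplx (R : realType) : numClosedFieldType := R[i]%C.

Notation C2 R := (Cplx R * Cplx R)%type.

Section HopfSurface.
Variable R : realType.
Local Notation C := (Cplx R).
Local Notation C2 := (C2 R).

Definition punctured := {x : C2 | x != 0}.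

Lemma pt_neq0 : ((1, 0) : C2) != 0.
Proof. by apply/eqP => -[] /eqP; rewrite oner_eq0. Qed.

Definition pt : punctured := exist _ (1, 0) pt_neq0.

(* For an injective f, this is the orbit relation of the group generated by f,
   see hopf_relE below. *)
Definition hopf_rel (f : C2 -> C2) : rel punctured :=
  fun x y => `[< exists m n : nat, iter m f (val x) = iter n f (val y) >].

Lemma hopf_rel_refl f : reflexive (hopf_rel f).
Proof. by move=> x; apply/asboolP; exists 0%N, 0%N. Qed.

Lemma hopf_rel_sym f : symmetric (hopf_rel f).
Proof.
by move=> x y; apply/asboolP/asboolP => -[m [n e]]; exists n, m; rewrite e.
Qed.

Lemma hopf_rel_trans f : transitive (hopf_rel f).
Proof.
move=> y x z /asboolP [m [n exy]] /asboolP [p [q eyz]]; apply/asboolP.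
exists (p + m)%N, (n + q)%N.
by rewrite !iterD exy -eyz -!iterD addnC.
Qed.

Canonical hopf_equiv f :=
  EquivRel (hopf_rel f) (@hopf_rel_refl f) (@hopf_rel_sym f)
    (@hopf_rel_trans f).

Definition Hopf (f : C2 -> C2) : Type := {eq_quot hopf_equiv f}.

(* The projection of C^2 minus 0 onto H_f, extended by a junk value at 0. *)
Definition hproj f (x : C2) : Hopf f := \pi_{eq_quot hopf_equiv f} (insubd pt x).

Definition hrepr f (p : Hopf f) : C2 :=
  val (repr (p : {eq_quot hopf_equiv f})).

(* The self-map of H_f induced by g; meaningful when g preserves C^2 minus 0 and
   descends to the quotient, see hopf_induced_hproj below. *)
Definition hopf_induced f (g : C2 -> C2) : Hopf f -> Hopf f :=
  fun p => hproj f (g (hrepr p)).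

Lemma hprojP f x y : x != 0 -> y != 0 ->
  hproj f x = hproj f y <-> exists m n : nat, iter m f x = iter n f y.
Proof.
move=> x0 y0; split.
  move/eqquotP => /asboolP [m [n]].
  by rewrite !val_insubd x0 y0 => e; exists m, n.
move=> [m [n e]]; apply/eqquotP/asboolP; exists m, n.
by rewrite !val_insubd x0 y0.
Qed.

Lemma hrepr_neq0 f (p : Hopf f) : hrepr p != 0.
Proof. exact: (valP (repr (p : {eq_quot hopf_equiv f}))). Qed.

Lemma hreprK f (p : Hopf f) : hproj f (hrepr p) = p.
Proof. by rewrite /hproj /hrepr valKd reprK. Qed.

Lemma hopf_induced_hproj f g x :
    (forall y, y != 0 -> g y != 0) -> (forall y, g (f y) = f (g y)) ->
  x != 0 -> hopf_induced g (hproj f x) = hproj f (g x).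
Proof.
move=> g0 gf x0; rewrite /hopf_induced.
apply/(hprojP f (g0 _ (hrepr_neq0 (hproj f x))) (g0 _ x0)).
have gfi n y : g (iter n f y) = iter n f (g y).
  by elim: n => //= n <-; rewrite gf.
have /(hprojP f (hrepr_neq0 (hproj f x)) x0) [m [n e]] := hreprK (hproj f x).
by exists m, n; rewrite -!gfi e.
Qed.

Lemma hopf_relE f x y : injective f -> x != 0 -> y != 0 ->
  hproj f x = hproj f y <->
  (exists n, y = iter n f x) \/ (exists n, x = iter n f y).
Proof.
move=> fI x0 y0.
have iI n : injective (iter n f) by elim: n => //= n IH u v /fI /IH.
split=> [/(hprojP f x0 y0) [m [n e]]|[[n e]|[n e]]].
- have [le_mn|/ltnW le_nm] := leqP m n; [right|left].
  + by exists (n - m)%N; apply: (iI m); rewrite -iterD subnKC.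
  + by exists (m - n)%N; apply: (iI n); rewrite -iterD subnKC.
- by apply/(hprojP f x0 y0); exists n, 0%N.
- by apply/(hprojP f x0 y0); exists 0%N, n.
Qed.

(* Complex structure of H_f: the projection from C^2 minus 0 to H_f is a local
   biholomorphism, so phi is holomorphic iff phi \o hproj locally lifts to
   holomorphic maps into C^2 minus 0.  Differentiability is over C. *)
Definition holomorphic f (phi : Hopf f -> Hopf f) : Prop :=
  forall x : C2, x != 0 -> exists F : C2 -> C2,
    \forall y \near x,
      [/\ differentiable F y, F y != 0 & phi (hproj f y) = hproj f (F y)].

Definition biholomorphic f (phi : Hopf f -> Hopf f) : Prop :=
  holomorphic phi /\
  exists psi, [/\ holomorphic psi, cancel phi psi & cancel psi phi].

Definition HopfAut f (s : Hopf f -> Hopf f) : set (Hopf f -> Hopf f) :=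
  [set phi | biholomorphic phi /\ forall p, phi (s p) = s (phi p)].

Inductive hopf_contraction : Type :=
  | IV of C
  | III of nat & C
  | IIa of nat & C
  | IIb of C
  | IIc of C & C.

Definition cmap (f : hopf_contraction) : C2 -> C2 :=
  match f with
  | IV alpha => fun p => (alpha * p.1, alpha * p.2)
  | III r delta => fun p => (delta ^+ r * p.1, delta * p.2)
  | IIa r delta => fun p => (delta ^+ r * p.1 + p.2 ^+ r, delta * p.2)
  | IIb alpha => fun p => (alpha * p.1 + p.2, alpha * p.2)
  | IIc alpha delta => fun p => (alpha * p.1, delta * p.2)
  end.

Definition admissible (f : hopf_contraction) : Prop :=
  match f with
  | IV alpha | IIb alpha => 0 < `|alpha| < 1
  | III r delta | IIa r delta => (2 <= r)%N /\ 0 < `|delta| < 1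
  | IIc alpha delta =>
    [/\ 0 < `|alpha| < 1, 0 < `|delta| < 1 &
        forall r : nat, alpha != delta ^+ r]
  end.

Definition coeffs (f : hopf_contraction) : seq C :=
  match f with
  | IV alpha => [:: alpha; alpha]
  | III r delta => [:: delta ^+ r; delta]
  | IIa r delta => [:: delta ^+ r; 1; delta]
  | IIb alpha => [:: alpha; 1; alpha]
  | IIc alpha delta => [:: alpha; delta]
  end.

Definition diag_coeffs (f : hopf_contraction) : seq C :=
  match f with
  | IV alpha | IIb alpha => [:: alpha; alpha]
  | III r delta | IIa r delta => [:: delta ^+ r; delta]
  | IIc alpha delta => [:: alpha; delta]
  end.

Definition real_coeffs (f : hopf_contraction) : Prop :=
  {in coeffs f, forall a, a \is Num.real}.

Definition positive_diag (f : hopf_contraction) : Prop :=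
  {in diag_coeffs f, forall a, 0 < a}.

Definition in_IIc' (f : hopf_contraction) : bool :=
  if f is IIc alpha delta then (delta == alpha^* ) && (alpha \isn't Num.real)
  else false.

Definition conj2 (p : C2) : C2 := (p.1^*, p.2^* ).
Definition conj2_swap (p : C2) : C2 := (p.2^*, p.1^* ).
Definition Jmap (p : C2) : C2 := (- p.2^*, p.1^* ).

Definition half_iterate (f : hopf_contraction) : C2 -> C2 :=
  match f with
  | IV alpha => fun p => (sqrtC alpha * p.1, sqrtC alpha * p.2)
  | III r delta => fun p => (sqrtC delta ^+ r * p.1, sqrtC delta * p.2)
  | IIa r delta => fun p =>
      (sqrtC delta ^+ r * p.1 + 2^-1 * sqrtC delta ^- r * p.2 ^+ r,
       sqrtC delta * p.2)
  | IIb alpha => fun p =>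
      (sqrtC alpha * p.1 + 2^-1 * (sqrtC alpha)^-1 * p.2, sqrtC alpha * p.2)
  | IIc alpha delta => fun p => (sqrtC alpha * p.1, sqrtC delta * p.2)
  end.

(* s_f, for f with real coefficients or in II'_c *)
Definition even_structure (f : hopf_contraction) :
    Hopf (cmap f) -> Hopf (cmap f) :=
  hopf_induced (if in_IIc' f then conj2_swap else conj2).

(* sigma_f, for f with real coefficients and positive diagonal coefficients *)
Definition odd_structure (f : hopf_contraction) :
    Hopf (cmap f) -> Hopf (cmap f) :=
  hopf_induced (conj2 \o half_iterate f).

(* sigma_f for f = (alpha z, alpha^* w) in II'_c and a choice beta of
   alpha^(1/2) *)
Definition odd_structure_IIc' (f : hopf_contraction) (beta : C) :
    Hopf (cmap f) -> Hopf (cmap f) :=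
  hopf_induced (conj2_swap \o (fun p => (beta * p.1, beta^* * p.2))).

(* The structure induced by J \o f^(1/2) for f = (alpha z, alpha w), alpha < 0,
   and a choice beta of alpha^(1/2) *)
Definition quaternionic_structure (f : hopf_contraction) (beta : C) :
    Hopf (cmap f) -> Hopf (cmap f) :=
  hopf_induced (Jmap \o (fun p => (beta * p.1, beta * p.2))).

Definition mxact (A : 'M[C]_2) (p : C2) : C2 :=
  (A 0 0 * p.1 + A 0 1 * p.2, A 1 0 * p.1 + A 1 1 * p.2).

Definition quaternion_mx (a b : C) : 'M[C]_2 :=
  \matrix_(i, j) nth 0 (nth [::] [:: [:: a; - b^*]; [:: b; a^*]] i) j.

Definition quaternion_group : set 'M[C]_2 :=
  [set A | exists a b : C, ((a, b) : C2) != 0 /\ A = quaternion_mx a b].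

(* The maps above preserve C^2 minus 0 and commute with f, so that they descend. *)

Lemma pair_neq0 (a b : C) : ((a, b) != 0 :> C2) = (a != 0) || (b != 0).
Proof. by rewrite -pair_eqE negb_and. Qed.

Lemma pos_norm_neq0 (a : C) : 0 < `|a| < 1 -> a != 0.
Proof. by case/andP; rewrite normr_gt0. Qed.

Lemma tri_neq0 (a d : C) (g : C -> C) x : a != 0 -> d != 0 -> g 0 = 0 ->
  x != 0 -> ((a * x.1 + g x.2, d * x.2) : C2) != 0.
Proof.
case: x => z w a0 d0 g0; rewrite !pair_neq0 /=.
have [->|w0] := eqVneq w 0; last by rewrite (mulf_neq0 d0 w0) orbT.
by rewrite /= !orbF g0 addr0 mulr0 eqxx orbF => z0; rewrite mulf_neq0.
Qed.

Lemma tri_inj (a d : C) (g : C -> C) : a != 0 -> d != 0 ->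
  injective (fun x : C2 => (a * x.1 + g x.2, d * x.2) : C2).
Proof.
move=> a0 d0 [z w] [z' w'] /= [+ /(mulfI d0) eww'].
by rewrite eww' => /addIr /(mulfI a0) ->.
Qed.

Lemma cmapE f : exists a d g, cmap f = (fun x => (a * x.1 + g x.2, d * x.2))
  /\ (admissible f -> [/\ a != 0, d != 0 & g 0 = 0]).
Proof.
case: f => [a|r d|r d|a|a d].
- exists a, a, (fun=> 0); split; first by apply/funext => x; rewrite addr0.
  by move=> /pos_norm_neq0.
- exists (d ^+ r), d, (fun=> 0); split; first by apply/funext => x; rewrite addr0.
  by move=> [_ /pos_norm_neq0 d0]; split=> //; rewrite expf_neq0.
- exists (d ^+ r), d, (fun w => w ^+ r); split=> //.
  move=> [r2 /pos_norm_neq0 d0]; split=> //; first by rewrite expf_neq0.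
  by rewrite expr0n; case: r r2.
- exists a, a, id; split=> //.
  by move=> /pos_norm_neq0.
- exists a, d, (fun=> 0); split; first by apply/funext => x; rewrite addr0.
  by move=> [/pos_norm_neq0 a0 /pos_norm_neq0 d0 _].
Qed.

Lemma cmap_inj f : admissible f -> injective (cmap f).
Proof. by have [a [d [g [-> H]]]] := cmapE f; case/H => *; exact: tri_inj. Qed.

Lemma cmap_neq0 f x : admissible f -> x != 0 -> cmap f x != 0.
Proof. by have [a [d [g [-> H]]]] := cmapE f; case/H => *; exact: tri_neq0. Qed.

Lemma conj2_neq0 x : x != 0 -> conj2 x != 0.
Proof. by case: x => z w; rewrite !pair_neq0 !conjC_eq0. Qed.

Lemma conj2_swap_neq0 x : x != 0 -> conj2_swap x != 0.
Proof. by case: x => z w; rewrite !pair_neq0 !conjC_eq0 orbC. Qed.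

Lemma Jmap_neq0 x : x != 0 -> Jmap x != 0.
Proof. by case: x => z w; rewrite !pair_neq0 oppr_eq0 !conjC_eq0 orbC. Qed.

Lemma scale_neq0 (a d : C) x : a != 0 -> d != 0 -> x != 0 ->
  ((a * x.1, d * x.2) : C2) != 0.
Proof. by case: x => z w; rewrite !pair_neq0 !mulf_eq0 => /negPf-> /negPf->. Qed.

Lemma conj2_cmap f x : real_coeffs f -> conj2 (cmap f x) = cmap f (conj2 x).
Proof.
move=> fR; have {}fR a : a \in coeffs f -> a^* = a by move=> /fR /CrealP.
case: f fR => [a|r d|r d|a|a d] fR; rewrite /conj2 /=.
- by rewrite !rmorphM /= !(fR a) ?mem_head.
- by rewrite !rmorphM /= (fR (d ^+ r)) ?(fR d) // !inE eqxx ?orbT.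
- rewrite !(rmorphD, rmorphM) /= [(x.2 ^+ r)^*]rmorphXn /=.
  by rewrite (fR (d ^+ r)) ?(fR d) // !inE eqxx ?orbT.
- by rewrite !(rmorphD, rmorphM) /= !(fR a) // mem_head.
- by rewrite !rmorphM /= (fR a) ?(fR d) // !inE eqxx ?orbT.
Qed.

Lemma half_iterateK f x : admissible f -> half_iterate f (half_iterate f x) = cmap f x.
Proof.
case: f x => [a|r d|r d|a|a d] [z w] /=.
- by rewrite !mulrA -!expr2 !sqrtCK.
- by rewrite !mulrA -!expr2 exprAC !sqrtCK.
- move: (sqrtC d) (sqrtCK d) => s <- [_ /pos_norm_neq0].
  rewrite sqrf_eq0 => s0; have sr0 : s ^+ r != 0 by rewrite expf_neq0.
  rewrite exprMn exprAC; move: (s ^+ r) (w ^+ r) sr0 => u v u0.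
  by congr pair; [field | ring].
- move: (sqrtC a) (sqrtCK a) => s <- /pos_norm_neq0.
  by rewrite sqrf_eq0 => s0; congr pair; [field | ring].
- by rewrite !mulrA -!expr2 !sqrtCK.
Qed.

Lemma half_cmap f x : admissible f -> half_iterate f (cmap f x) = cmap f (half_iterate f x).
Proof. by move=> fA; rewrite -!half_iterateK. Qed.

Lemma half_neq0 f x : admissible f -> x != 0 -> half_iterate f x != 0.
Proof.
move=> fA /(cmap_neq0 fA); rewrite -half_iterateK //; apply: contra_neq => ->.
case: f fA => [a|r d|r d|a|a d] /=; rewrite ?(mulr0, addr0) //.
by case: r => [|r] [] // _ _; rewrite expr0n mulr0 addr0.
Qed.

Lemma conj2_swap_cmap f x : in_IIc' f ->
  conj2_swap (cmap f x) = cmap f (conj2_swap x).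
Proof.
case: f => //= a d /andP[/eqP -> _].
by rewrite /conj2_swap /= !rmorphM /= conjCK.
Qed.

Lemma even_structure_hproj f x : admissible f -> real_coeffs f \/ in_IIc' f ->
  x != 0 ->
  @even_structure f (hproj (cmap f) x) =
  hproj (cmap f) ((if in_IIc' f then conj2_swap else conj2) x).
Proof.
move=> fA fRc; apply: hopf_induced_hproj => y.
  by case: ifP => _; [exact: conj2_swap_neq0 | exact: conj2_neq0].
case: ifP fRc => [fc _|_ [fR|//]]; first exact: conj2_swap_cmap.
exact: conj2_cmap.
Qed.

Lemma odd_structure_hproj f x : admissible f -> real_coeffs f -> x != 0 ->
  @odd_structure f (hproj (cmap f) x) = hproj (cmap f) (conj2 (half_iterate f x)).
Proof.
move=> fA fR; apply: hopf_induced_hproj => y /=.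
  by move=> y0; apply/conj2_neq0/half_neq0.
by rewrite half_cmap // conj2_cmap.
Qed.

Lemma odd_structure_IIc'_hproj f beta x : in_IIc' f -> beta != 0 -> x != 0 ->
  @odd_structure_IIc' f beta (hproj (cmap f) x) =
  hproj (cmap f) (conj2_swap (beta * x.1, beta^* * x.2)).
Proof.
move=> fc b0; apply: hopf_induced_hproj => y /=.
  by move=> y0; apply/conj2_swap_neq0/scale_neq0; rewrite ?conjC_eq0.
rewrite -conj2_swap_cmap //; case: f fc => //= a d _.
by rewrite !(mulrCA beta, mulrCA beta^* ).
Qed.

Lemma quaternionic_structure_hproj (alpha beta : C) x :
    alpha < 0 -> beta != 0 -> x != 0 ->
  @quaternionic_structure (IV alpha) beta (hproj (cmap (IV alpha)) x) =
  hproj (cmap (IV alpha)) (Jmap (beta * x.1, beta * x.2)).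
Proof.
move=> a0 b0; apply: hopf_induced_hproj => y /=.
  by move=> y0; apply/Jmap_neq0/scale_neq0.
have /CrealP aR : alpha \is Num.real by rewrite realE (ltW a0) orbT.
by rewrite /Jmap /= !rmorphM /= aR mulrN !(mulrCA alpha).
Qed.

Lemma mxact_hproj (alpha : C) (A : 'M[C]_2) x : quaternion_group A -> x != 0 ->
  hopf_induced (mxact A) (hproj (cmap (IV alpha)) x) =
  hproj (cmap (IV alpha)) (mxact A x).
Proof.
move=> [a [b [ab0 ->]]]; apply: hopf_induced_hproj => -[z w]; last first.
  by rewrite /mxact /=; congr pair; ring.
rewrite /mxact !mxE /=; apply: contra_neq => -[e1 e2].
have n0 : `|a| ^+ 2 + `|b| ^+ 2 != 0.
  move: ab0; rewrite pair_neq0 paddr_eq0 ?exprn_ge0 // !expf_eq0 /= !normr_eq0.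
  by rewrite negb_and.
congr pair; apply: (mulfI n0); rewrite mulr0 !normCK.
  transitivity (a^* * (a * z + - b^* * w) + b^* * (b * z + a^* * w)).
    ring.
  by rewrite e1 e2 !mulr0 addr0.
transitivity (a * (b * z + a^* * w) - b * (a * z + - b^* * w)).
  ring.
by rewrite e1 e2 !mulr0 subr0.
Qed.

End HopfSurface.

Arguments hopf_induced {R} f g p.
Arguments HopfAut {R f} s phi.
Arguments even_structure {R} f p.
Arguments odd_structure {R} f p.
Arguments odd_structure_IIc' {R} f beta p.
Arguments quaternionic_structure {R} f beta p.

(* Main.v *)
Require Import Defs.
From HB Require Import structures.
From mathcomp Require Import all_boot all_order all_algebra.
From mathcomp Require Import complex qpoly.
From mathcomp Require Import all_classical all_reals all_analysis.
From mathcomp Require Import ring lra.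

Set Implicit Arguments.
Unset Strict Implicit.
Unset Printing Implicit Defensive.

Import Order.TTheory GRing.Theory Num.Theory.
Import numFieldNormedType.Exports.

Local Open Scope ring_scope.
Local Open Scope classical_set_scope.

(* An automorphism phi of H_f lifts to a holomorphic map F of the simply
   connected W = C^2 \ {0}, and F o f = f^k o F for some k.  Iterating this
   relation from a compact annulus, F grows at most polynomially at infinity, so
   by Liouville's theorem its restrictions to the lines w = const <> 0 and
   z = const <> 0 are polynomials of bounded degree, and by interpolation F is a
   polynomial map (which makes Hartogs' theorem unnecessary).  Then F is bounded
   near 0, which excludes k <= 0, and comparing with the lift of the inverse of
   phi gives k = 1.

   Let h be the square root of f.  If F o f = f o F, then u = F_2 o h - d' F_2
   is a polynomial with u o h = - d' u, d' being a diagonal coefficient of h.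
   The leading coefficients of such a u show that - d' is a monomial in the
   diagonal coefficients of h, which is absurd unless u = 0; the first component
   is similar.  Hence F commutes with h, so phi commutes with the map induced by
   h, and commuting with the odd structure is the same as commuting with the
   even one.  For f = alpha I, F is linear, and commuting with J up to a power of
   alpha forces this power to be 1.

   Liouville's theorem rests on Goursat's argument, with contour integrals
   replaced by trapezoid sums over dyadic subdivisions of a square. *)

(** * The modulus and epsilon-delta calculus *)

Section Modulus.
Variable R : realType.
Local Notation C := (Cplx R).
Local Notation C2 := (C2 R).

(** Commuting with an odd structure is an equation in H_f, known for lifts only up to powers of f.
    The comparison with the even structure therefore does not start from it: the lift of every
    automorphism, whether or not it respects a structure, is shown to commute with h exactly. Only
    for alpha I, where the group itself has to be found, are unknown powers handled, and there the
    lift is a matrix, so that finitely many vectors suffice.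

    The usual norms need not be contracted by a triangular f, because the coupling term may outweigh
    the gap 1 - |a|. Sizes are therefore measured by |z| + K |w|^m, in which w^m carries the weight
    of z.

    Goursat's argument is run with a finite exceptional set S on which only continuity is known.
    Divided differences create such points, and removing them would take the removable singularity
    theorem, itself usually a consequence of Cauchy's formula. *)

Definition toC (x : R) : C := x%:C%C.
(** The modulus [|z|] is an element of C; this copy in R is open to real suprema, the Archimedean
    property and linear arithmetic. *)
Definition abs (z : C) : R := complex.Re `|z|.
Definition re (z : C) : R := complex.Re z.
Definition im (z : C) : R := complex.Im z.
Definition iC : C := 'i%C.

HB.instance Definition _ := GRing.RMorphism.copy toC (real_complex R).

Lemma normE z : `|z| = toC (abs z).
Proof. by rewrite /toC /abs RRe_real // normr_real. Qed.

Lemma toC_inj : injective toC. Proof. exact: complexI. Qed.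

Lemma le_toC x y : (toC x <= toC y) = (x <= y). Proof. exact: lecR. Qed.
Lemma lt_toC x y : (toC x < toC y) = (x < y). Proof. exact: ltcR. Qed.

Lemma abs_ge0 z : 0 <= abs z.
Proof. by rewrite -le_toC -normE normr_ge0. Qed.
Lemma absM z t : abs (z * t) = abs z * abs t.
Proof. by apply: toC_inj; rewrite rmorphM /= -!normE normrM. Qed.
Lemma abs_eq0 z : (abs z == 0) = (z == 0).
Proof. by rewrite -(inj_eq toC_inj) -normE rmorph0 normr_eq0. Qed.
Lemma abs0 : abs 0 = 0. Proof. by apply/eqP; rewrite abs_eq0. Qed.
Lemma abs1 : abs 1 = 1.
Proof. by apply: toC_inj; rewrite -normE normr1 rmorph1. Qed.
Lemma abs_gt0 z : (0 < abs z) = (z != 0).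
Proof. by rewrite lt0r abs_eq0 abs_ge0 andbT. Qed.
Lemma absD z t : abs (z + t) <= abs z + abs t.
Proof. by rewrite -le_toC rmorphD /= -!normE ler_normD. Qed.
Lemma absN z : abs (- z) = abs z.
Proof. by apply: toC_inj; rewrite -!normE normrN. Qed.
Lemma absB z t : abs (z - t) <= abs z + abs t.
Proof. by rewrite -(absN t) absD. Qed.
Lemma abs_distC z t : abs (z - t) = abs (t - z).
Proof. by rewrite -absN opprB. Qed.
Lemma absX z n : abs (z ^+ n) = abs z ^+ n.
Proof. by elim: n => [|n IH]; rewrite ?abs1 // !exprS absM IH. Qed.
Lemma absV z : abs z^-1 = (abs z)^-1.
Proof.
have [->|z0] := eqVneq z 0; first by rewrite invr0 abs0 invr0.
apply: (@mulfI _ (abs z)); first by rewrite abs_eq0.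
by rewrite -absM !divff ?abs1 ?abs_eq0.
Qed.
Lemma abs_toC x : abs (toC x) = `|x|.
Proof.
by apply: toC_inj; rewrite -normE normc_def /= expr0n addr0 sqrtr_sqr.
Qed.
Lemma abs_iC : abs iC = 1.
Proof.
by apply: toC_inj; rewrite -normE normc_def /= expr0n add0r expr1n sqrtr1.
Qed.
Lemma abs_re z : `|re z| <= abs z.
Proof.
rewrite -le_toC -normE normc_def lecR -sqrtr_sqr ler_wsqrtr //.
by rewrite lerDl sqr_ge0.
Qed.
Lemma abs_im z : `|im z| <= abs z.
Proof.
rewrite -le_toC -normE normc_def lecR -sqrtr_sqr ler_wsqrtr //.
by rewrite lerDr sqr_ge0.
Qed.
Lemma reimE z : z = toC (re z) + iC * toC (im z).
Proof. exact: complexE. Qed.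
Lemma reD z t : re (z + t) = re z + re t. Proof. by case: z t => ? ? []. Qed.
Lemma imD z t : im (z + t) = im z + im t. Proof. by case: z t => ? ? []. Qed.
Lemma abs_triB z t : abs z - abs t <= abs (z - t).
Proof. by rewrite lerBlDr -{1}(subrK t z) absD. Qed.
End Modulus.

Section EpsilonDelta.
Variable R : realType.
Local Notation C := (Cplx R).
Local Notation C2 := (C2 R).

Definition nrm (x : C2) : R := abs x.1 + abs x.2.

Lemma nrm_ge0 x : 0 <= nrm x. Proof. by rewrite addr_ge0 ?abs_ge0. Qed.
Lemma nrm0 : nrm 0 = 0. Proof. by rewrite /nrm /= abs0 addr0. Qed.
Lemma nrm_eq0 x : (nrm x == 0) = (x == 0).
Proof. by case: x => z w; rewrite paddr_eq0 ?abs_ge0 // !abs_eq0 -pair_eqE. Qed.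
Lemma nrm_gt0 x : (0 < nrm x) = (x != 0).
Proof. by rewrite lt0r nrm_eq0 nrm_ge0 andbT. Qed.
Lemma nrmD x y : nrm (x + y) <= nrm x + nrm y.
Proof. by rewrite /nrm addrACA lerD ?absD. Qed.
Lemma nrmN x : nrm (- x) = nrm x.
Proof. by rewrite /nrm /= !absN. Qed.
Lemma nrm_distC x y : nrm (x - y) = nrm (y - x).
Proof. by rewrite -nrmN opprB. Qed.
Lemma nrm_tri y x z : nrm (x - z) <= nrm (x - y) + nrm (y - z).
Proof. by rewrite -{1}(subrK y x) -addrA nrmD. Qed.

Lemma toC_lt_norm (e : C) : 0 < e -> {r : R | 0 < r & e = toC r}.
Proof.
move=> e0; exists (abs e); first by rewrite abs_gt0 gt_eqF.
by rewrite -normE gtr0_norm.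
Qed.

Lemma near_absP (z : C) (P : C -> Prop) :
  (\forall t \near z, P t) <->
  exists2 e : R, 0 < e & forall t, abs (t - z) < e -> P t.
Proof.
split=> [/nbhs_ballP [e /= /toC_lt_norm [r r0 ->]] H|[e e0 H]].
  exists r => // t tz; apply: H; rewrite /ball /= distrC normE.
  by rewrite lt_toC.
apply/nbhs_ballP; exists (toC e) => /=.
  by rewrite -(rmorph0 (@toC R)) lt_toC.
by move=> t; rewrite /ball /= distrC normE lt_toC => /H.
Qed.

Lemma near_nrmP (x : C2) (P : C2 -> Prop) :
  (\forall y \near x, P y) <->
  exists2 e : R, 0 < e & forall y, nrm (y - x) < e -> P y.
Proof.
split=> [/nbhs_ballP [e /= /toC_lt_norm [r r0 ->]] H|[e e0 H]].
  exists r => // t tz; apply: H; split; rewrite /ball /= distrC normE lt_toC.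
    by apply: le_lt_trans tz; rewrite lerDl abs_ge0.
  by apply: le_lt_trans tz; rewrite lerDr abs_ge0.
apply/nbhs_ballP; exists (toC (e / 2)) => /=.
  by rewrite -(rmorph0 (@toC R)) lt_toC divr_gt0.
move=> [a b] [/=]; rewrite /ball /= ![`|x.1 - _|]distrC ![`|x.2 - _|]distrC.
rewrite !normE !lt_toC => ha hb; apply: H.
by rewrite /nrm /= (splitr e) ltrD.
Qed.

Lemma continuous_nrmP (F : C2 -> C2) x :
  {for x, continuous F} <->
  forall e : R, 0 < e ->
    exists2 d : R, 0 < d & forall y, nrm (y - x) < d -> nrm (F y - F x) < e.
Proof.
split=> [cF e e0|H A /= /near_nrmP [e e0 HA]].
  apply/near_nrmP.
  have : nbhs (F x) [set y | nrm (y - F x) < e] by apply/near_nrmP; exists e.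
  by move/cF.
have [d d0 Hd] := H _ e0.
by apply/near_nrmP; exists d => // y /Hd /HA.
Qed.

Lemma differentiable_nrm_continuous (F : C2 -> C2) x : differentiable F x ->
  forall e : R, 0 < e ->
    exists2 d : R, 0 < d & forall y, nrm (y - x) < d -> nrm (F y - F x) < e.
Proof. by move=> /differentiable_continuous /continuous_nrmP. Qed.

Definition cdiff (g : C -> C) (z : C) : Prop := exists l : C,
  forall e : R, 0 < e -> exists2 d : R, 0 < d & forall t, abs (t - z) < d ->
    abs (g t - g z - l * (t - z)) <= e * abs (t - z).

Definition ccont (g : C -> C) (z : C) : Prop := forall e : R, 0 < e ->
  exists2 d : R, 0 < d & forall t, abs (t - z) < d -> abs (g t - g z) < e.

Lemma cdiff_ccont g z : cdiff g z -> ccont g z.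
Proof.
move=> [l H] e e0; have [d d0 Hd] := H 1 ltr01.
have K0 : 0 < 1 + abs l by rewrite ltr_wpDr ?abs_ge0.
exists (Num.min d (e / (1 + abs l))); first by rewrite lt_min d0 divr_gt0.
move=> t; rewrite lt_min => /andP[/Hd + td].
rewrite ltr_pdivlMr // mulrC mulrDl mul1r in td; move=> h.
apply: le_lt_trans td.
rewrite -(subrK (l * (t - z)) (g t - g z)) (le_trans (absD _ _)) // absM.
by rewrite lerD2r -[leRHS]mul1r.
Qed.

Lemma differentiable_cdiff (g : C -> C) z : differentiable g z -> cdiff g z.
Proof.
move=> /derivable1_diffP /derivable_nbhsP H.
exists ('D_1 g z) => e e0.
have /eqaddoP/(_ (toC e)) := H.
rewrite -(rmorph0 (@toC R)) lt_toC => /(_ e0) /near_absP [d d0 Hd].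
exists d => // t td.
have := Hd (t - z); rewrite subr0 => /(_ td) /=.
rewrite !fctE /= !normE -rmorphM le_toC /= scaler1.
rewrite -[_ *: _]/(_ * _) /shift /= subrK.
by rewrite opprD addrA [_ * (t - z)]mulrC.
Qed.
End EpsilonDelta.

(** * Goursat's theorem for trapezoid sums *)

Section Grid.
Variable R : realType.
Local Notation C := (Cplx R).
Implicit Types (p q : C -> C) (z : C) (h l : R) (n : nat).

(** Trapezoid rule for the integral of [p dz] along the horizontal edge from z to z + h; [trapV] is
    the same for the vertical edge, with dz = i dy. [cell] runs around a square counterclockwise. *)
Definition trapH p z h : C := toC (h / 2) * (p z + p (z + toC h)).
Definition trapV p z h : C := iC R * toC (h / 2) * (p z + p (z + iC R * toC h)).
Definition cell p z h : C :=
  (trapH p z h - trapH p (z + iC R * toC h) h) +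
  (trapV p (z + toC h) h - trapV p z h).

Definition gpt z h (j k : nat) : C :=
  z + toC (h * j%:R) + iC R * toC (h * k%:R).

Definition grid p n z h : C :=
  \sum_(j < n) \sum_(k < n) cell p (gpt z h j k) h.

Definition bdry p n z h : C :=
  \sum_(j < n) (trapH p (gpt z h j 0) h - trapH p (gpt z h j n) h) +
  \sum_(k < n) (trapV p (gpt z h n k) h - trapV p (gpt z h 0 k) h).

Lemma gptS1 z h j k : gpt z h j k + toC h = gpt z h j.+1 k.
Proof. by rewrite /gpt -(natr1 j) mulrDr mulr1 rmorphD /=; ring. Qed.

Lemma gptS2 z h j k : gpt z h j k + iC R * toC h = gpt z h j k.+1.
Proof. by rewrite /gpt -(natr1 k) mulrDr mulr1 rmorphD /=; ring. Qed.

(** Each interior edge belongs to two cells, with opposite signs, so the sum over the cells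
    telescopes to the outer edges. *)
Lemma grid_bdry p n z h : grid p n z h = bdry p n z h.
Proof.
rewrite /grid /bdry /cell.
under eq_bigr do rewrite big_split /=.
rewrite big_split /=; congr (_ + _); last rewrite exchange_big /=.
  apply: eq_bigr => j _; rewrite -opprB -(@telescope_sumr _ 0 n
    (fun k => trapH p (gpt z h j k) h)) // big_mkord -sumrN.
  by apply: eq_bigr => k _; rewrite gptS2 opprB.
apply: eq_bigr => k _; rewrite -(@telescope_sumr _ 0 n
    (fun j => trapV p (gpt z h j k) h)) // big_mkord.
by apply: eq_bigr => j _; rewrite gptS1.
Qed.

Lemma gridB p q n z h :
  grid (fun t => p t - q t) n z h = grid p n z h - grid q n z h.
Proof.
rewrite /grid -sumrB; apply: eq_bigr => j _; rewrite -sumrB.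
by apply: eq_bigr => k _; rewrite /cell /trapH /trapV; ring.
Qed.

(** The trapezoid rule is exact on affine functions, whose integral over a closed contour is 0. *)
Lemma grid_affine (u v : C) n z h : grid (fun t => u + v * t) n z h = 0.
Proof.
rewrite /grid big1 // => j _; rewrite big1 // => k _.
by rewrite /cell /trapH /trapV; ring.
Qed.

Lemma grid_split p n z h :
  grid p (n + n) z h =
  grid p n z h + grid p n (z + toC (h * n%:R)) h +
  (grid p n (z + iC R * toC (h * n%:R)) h +
   grid p n (z + toC (h * n%:R) + iC R * toC (h * n%:R)) h).
Proof.
rewrite /grid big_split_ord /=.
under eq_bigr do rewrite big_split_ord /=.
under [X in _ + X]eq_bigr do rewrite big_split_ord /=.
rewrite !big_split /= addrACA; congr (_ + _ + (_ + _)).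
- apply: eq_bigr => j _; apply: eq_bigr => k _; congr (cell _ _ _).
  by rewrite /gpt natrD mulrDr rmorphD /=; ring.
- apply: eq_bigr => j _; apply: eq_bigr => k _; congr (cell _ _ _).
  by rewrite /gpt natrD mulrDr rmorphD /=; ring.
- apply: eq_bigr => j _; apply: eq_bigr => k _; congr (cell _ _ _).
  by rewrite /gpt !natrD !mulrDr !rmorphD /=; ring.
Qed.

Definition on_bdry z l (t : C) := exists a b : R,
  [/\ t = z + toC a + iC R * toC b, 0 <= a <= l, 0 <= b <= l &
      [\/ a = 0, a = l, b = 0 | b = l]].

Lemma bdry_le p n z h (M : R) : 0 <= h ->
  (forall t, on_bdry z (h * n%:R) t -> abs (p t) <= M) ->
  abs (bdry p n z h) <= 4 * (h * n%:R) * M.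
Proof.
move=> h0 pM.
have trapH_le t : abs (p t) <= M -> abs (p (t + toC h)) <= M ->
    abs (trapH p t h) <= h * M.
  move=> h1 h2; rewrite /trapH absM abs_toC ger0_norm ?divr_ge0 //.
  rewrite [leRHS](_ : _ = h / 2 * (M + M)); last by field.
  by rewrite ler_wpM2l ?divr_ge0 // (le_trans (absD _ _)) // lerD.
have trapV_le t : abs (p t) <= M -> abs (p (t + iC R * toC h)) <= M ->
    abs (trapV p t h) <= h * M.
  move=> h1 h2; rewrite /trapV !absM abs_iC mul1r abs_toC ger0_norm ?divr_ge0 //.
  rewrite [leRHS](_ : _ = h / 2 * (M + M)); last by field.
  by rewrite ler_wpM2l ?divr_ge0 // (le_trans (absD _ _)) // lerD.
have sum_le (F : 'I_n -> C) (B : R) : (forall j, abs (F j) <= B) ->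
    abs (\sum_(j < n) F j) <= n%:R * B.
  move=> FB; rewrite (@le_trans _ _ (\sum_(j < n) B)) //; last first.
    by rewrite sumr_const card_ord mulr_natl.
  elim/big_ind2: _ => //; first by rewrite abs0.
  by move=> x1 x2 y1 y2 h1 h2; rewrite (le_trans (absD _ _)) // lerD.
have bd j k : (j <= n)%N -> (k <= n)%N -> [|| j == 0, j == n, k == 0 | k == n]%N ->
    abs (p (gpt z h j k)) <= M.
  move=> jn kn jk; apply: pM; exists (h * j%:R), (h * k%:R); split=> //.
  - by rewrite mulr_ge0 //= ler_wpM2l // ler_nat.
  - by rewrite mulr_ge0 //= ler_wpM2l // ler_nat.
  case/or4P: jk => /eqP ->; rewrite ?mulr0.
  - exact: Or41. - exact: Or42. - exact: Or43. - exact: Or44.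
have -> : 4 * (h * n%:R) * M = n%:R * (h * M + h * M) + n%:R * (h * M + h * M).
  by ring.
rewrite (le_trans (absD _ _)) // lerD // sum_le // => j.
  rewrite (le_trans (absB _ _)) // lerD //; apply: trapH_le;
    rewrite ?gptS1; apply: bd; rewrite ?eqxx ?orbT ?leqnn //; exact: ltnW.
rewrite (le_trans (absB _ _)) // lerD //; apply: trapV_le;
  rewrite ?gptS2; apply: bd; rewrite ?eqxx ?orbT ?leqnn //; exact: ltnW.
Qed.

Definition in_square z l (t : C) := exists a b : R,
  [/\ t = z + toC a + iC R * toC b, 0 <= a <= l & 0 <= b <= l].

Lemma grid_near_affine p n z h (u v : C) (M : R) : 0 <= h ->
  (forall t, in_square z (h * n%:R) t -> abs (p t - (u + v * t)) <= M) ->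
  abs (grid p n z h) <= 4 * (h * n%:R) * M.
Proof.
move=> h0 H; rewrite -[grid _ _ _ _]subr0 -(grid_affine u v n z h) -gridB.
rewrite grid_bdry; apply: bdry_le => // t [a [b [e ha hb _]]].
by apply: H; exists a, b.
Qed.

Definition dyadic_grid p m z l : C := grid p (2 ^ m) z (l / 2 ^+ m).

(** Level m in each quarter has the same mesh, [l / 2 ^+ m.+1], as level [m.+1] in the whole
    square. *)
Lemma dyadic_gridS p m z l :
  dyadic_grid p m.+1 z l =
  dyadic_grid p m z (l / 2) + dyadic_grid p m (z + toC (l / 2)) (l / 2) +
  (dyadic_grid p m (z + iC R * toC (l / 2)) (l / 2) +
   dyadic_grid p m (z + toC (l / 2) + iC R * toC (l / 2)) (l / 2)).
Proof.
rewrite /dyadic_grid expnS mul2n -addnn grid_split exprS.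
have -> : l / (2 * 2 ^+ m) = l / 2 / 2 ^+ m by rewrite invfM mulrA.
by rewrite natrX divfK ?expf_neq0.
Qed.

End Grid.

Section SquareInduction.
Variable R : realType.

(** Bisection: a square failing [G] has a failing quarter, and the resulting nested squares shrink
    to a point that contradicts the local hypothesis. This point may lie on the sides of the
    squares, so the local hypothesis covers all small closed squares containing it. *)
Lemma square_induction (G : R -> R -> R -> Prop) :
  (forall x y l, 0 < l -> G x y (l / 2) -> G (x + l / 2) y (l / 2) ->
     G x (y + l / 2) (l / 2) -> G (x + l / 2) (y + l / 2) (l / 2) -> G x y l) ->
  (forall x y, exists2 d : R, 0 < d & forall x' y' l', 0 < l' < d ->
     x' <= x <= x' + l' -> y' <= y <= y' + l' -> G x' y' l') ->
  forall x y l, 0 < l -> G x y l.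
Proof.
move=> merge loc x0 y0 l0 l00; apply: contrapT => bad0.
pose bad (t : R * R * R) := 0 < t.2 /\ ~ G t.1.1 t.1.2 t.2.
have [st stP] : {st : R * R * R -> R * R * R & forall t, bad t ->
    [/\ bad (st t), (st t).2 = t.2 / 2, t.1.1 <= (st t).1.1 <= t.1.1 + t.2 / 2 &
        t.1.2 <= (st t).1.2 <= t.1.2 + t.2 / 2]}.
  apply: (@choice _ _ (fun t t' => bad t -> [/\ bad t', t'.2 = t.2 / 2,
     t.1.1 <= t'.1.1 <= t.1.1 + t.2 / 2 & t.1.2 <= t'.1.2 <= t.1.2 + t.2 / 2])).
  move=> [[x y] l] /=; have [[/= l_gt0 nG]|nb] := pselect (bad (x, y, l));
    last by exists (x, y, l).
  apply: contrapT => none; apply: nG.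
  have l2 : 0 < l / 2 by rewrite divr_gt0.
  have sub x' y' : x <= x' <= x + l / 2 -> y <= y' <= y + l / 2 -> G x' y' (l / 2).
    move=> hx hy; apply: contrapT => nG; apply: none; exists (x', y', l / 2).
    by [].
  by apply: merge => //; apply: sub; lra.
pose s n := iter n st (x0, y0, l0).
have sbad n : bad (s n) by elim: n => //= n /stP [].
have sl n : (s n).2 = l0 / 2 ^+ n.
  elim: n => [|n IH]; first by rewrite expr0 divr1.
  by have [_ -> _ _] := stP _ (sbad n); rewrite IH exprS invfM mulrCA mulrC.
have nested (f : R * R * R -> R) : (forall t, bad t -> f t <= f (st t) <= f t + t.2 / 2) ->
    exists x, forall n, f (s n) <= x <= f (s n) + (s n).2.
  move=> fst.
  have mono n k : f (s n) <= f (s (k + n)%N) <= f (s n) + (s n).2 - (s (k + n)%N).2.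
    elim: k => [|k /andP[h1 h2]]; first by rewrite lexx addrK lexx.
    have /andP[h3 h4] := fst _ (sbad (k + n)%N).
    have [_ h5 _ _] := stP _ (sbad (k + n)%N).
    rewrite addSn /= (le_trans h1 h3) /= h5.
    by apply: le_trans h4 _; lra.
  have up n m : f (s m) <= f (s n) + (s n).2.
    have [nm|mn] := leqP n m.
      have := mono n (m - n)%N; rewrite subnK // => /andP[_ h].
      by have [h0 _] := sbad m; lra.
    have := mono m (n - m)%N; rewrite subnK ?(ltnW mn) // => /andP[h _].
    by have [h0 _] := sbad n; lra.
  exists (sup (range (f \o s))) => n; apply/andP; split.
    apply: ub_le_sup; last by exists n.
    by exists (f (s 0%N) + (s 0%N).2) => _ [m _ <-]; exact: up.
  by apply: ge_sup => [|_ [m _ <-]]; [exists (f (s n)), n | exact: up].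
have [x hx] := nested (fun t => t.1.1) (fun t bt => let: And4 _ _ h _ := stP t bt in h).
have [y hy] := nested (fun t => t.1.2) (fun t bt => let: And4 _ _ _ h := stP t bt in h).
have [d d0 Hd] := loc x y.
have [n hn] : exists n, l0 / 2 ^+ n < d.
  have [n nP] : exists n : nat, l0 / d < n%:R.
    exists (Num.bound (l0 / d)); apply: archi_boundP.
    by rewrite divr_ge0 // ltW.
  exists n; rewrite ltr_pdivrMr ?exprn_gt0 // mulrC -ltr_pdivrMr //.
  by apply: lt_trans nP _; rewrite -natrX ltr_nat ltn_expl.
by have [s0 []] := sbad n; apply: Hd; rewrite ?sl ?hx ?hy // -?sl ?s0 ?hx ?hy // sl.
Qed.
End SquareInduction.

Section Goursat.
Variable R : realType.
Local Notation C := (Cplx R).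
Implicit Types (p q : C -> C) (z : C) (x y h l : R) (S : seq C).

(* The sum counts, with half-weights on the boundary, the points of S in the
   square; unlike a sum of indicators of closed squares it is additive under
   subdivision. *)
Definition sq_weight S x y l : R := l ^+ 2 +
  \sum_(s <- S) (Num.sg (x + l - re s) - Num.sg (x - re s)) *
                (Num.sg (y + l - im s) - Num.sg (y - im s)).

Lemma sq_weight_split S x y l :
  sq_weight S x y l =
    sq_weight S x y (l / 2) + sq_weight S (x + l / 2) y (l / 2) +
    (sq_weight S x (y + l / 2) (l / 2) +
     sq_weight S (x + l / 2) (y + l / 2) (l / 2)).
Proof.
have half (u : R) : u + l / 2 + l / 2 = u + l by field.
rewrite /sq_weight !half.
have -> : l ^+ 2 = (l / 2) ^+ 2 + (l / 2) ^+ 2 + ((l / 2) ^+ 2 + (l / 2) ^+ 2).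
  by field.
set A := (l / 2) ^+ 2; rewrite [LHS](_ : _ = A + A + (A + A) +
  \sum_(s <- S) ((Num.sg (x + l / 2 - re s) - Num.sg (x - re s)) *
                (Num.sg (y + l / 2 - im s) - Num.sg (y - im s)) +
                (Num.sg (x + l - re s) - Num.sg (x + l / 2 - re s)) *
                (Num.sg (y + l / 2 - im s) - Num.sg (y - im s)) +
                ((Num.sg (x + l / 2 - re s) - Num.sg (x - re s)) *
                (Num.sg (y + l - im s) - Num.sg (y + l / 2 - im s)) +
                (Num.sg (x + l - re s) - Num.sg (x + l / 2 - re s)) *
                (Num.sg (y + l - im s) - Num.sg (y + l / 2 - im s))))); last first.
  by congr (_ + _); apply: eq_bigr => s _; ring.
rewrite !big_split /=; ring.
Qed.

Lemma sg_incr (u v : R) : u < v -> 0 <= Num.sg v - Num.sg u.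
Proof. by move=> uv; case: (sgrP u) => hu; case: (sgrP v) => hv; lra. Qed.

Lemma sg_jump (u v : R) : u < v -> u <= 0 <= v -> 1 <= Num.sg v - Num.sg u.
Proof. by move=> uv h; case: (sgrP u) => hu; case: (sgrP v) => hv; lra. Qed.

Lemma sq_weight_term_ge0 x y l (s : C) : 0 < l ->
  0 <= (Num.sg (x + l - re s) - Num.sg (x - re s)) *
       (Num.sg (y + l - im s) - Num.sg (y - im s)).
Proof. by move=> l0; rewrite mulr_ge0 // sg_incr //; lra. Qed.

Lemma sq_weight_ge S x y l : 0 < l -> l ^+ 2 <= sq_weight S x y l.
Proof.
by move=> l0; rewrite lerDl sumr_ge0 // => s _; exact: sq_weight_term_ge0.
Qed.

Lemma sq_weight_ge1 S x y l (s : C) : s \in S -> 0 < l ->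
  x <= re s <= x + l -> y <= im s <= y + l -> 1 <= sq_weight S x y l.
Proof.
move=> sS l0 hx hy; rewrite /sq_weight (big_rem _ sS) /=.
apply: ler_wpDl; first exact: sqr_ge0.
apply: ler_wpDr; first by apply: sumr_ge0 => t _; exact: sq_weight_term_ge0.
by rewrite -[leLHS]mulr1 ler_pM // sg_jump //; lra.
Qed.

(** The error allowed on a square is proportional to [sq_weight], which is additive, so the
    estimates merge under subdivision. At a point where p is differentiable, the affine
    approximation gives an error quadratic in the side, paid by the area term. At a point of S,
    continuity only gives an error linear in the side, which for small squares stays below [e'] and
    is paid by the count, at least 1 as soon as the closed square contains the point. *)
Theorem goursat p S : (forall z, ccont p z) ->
  (forall z, z \notin S -> cdiff p z) ->
  forall z l (e : R), 0 < l -> 0 < e ->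
    exists m0, forall m, (m0 <= m)%N -> abs (dyadic_grid p m z l) <= e.
Proof.
move=> pc pd z l e l0 e0.
pose cor x y : C := toC x + iC R * toC y.
suff H e' x y l' : 0 < e' -> 0 < l' -> exists m0, forall m, (m0 <= m)%N ->
    abs (dyadic_grid p m (cor x y) l') <= e' * sq_weight S x y l'.
  have w0 : 0 < sq_weight S (re z) (im z) l.
    by apply: lt_le_trans (sq_weight_ge _ _ _ l0); rewrite exprn_gt0.
  have := H (e / sq_weight S (re z) (im z) l) (re z) (im z) l.
  by rewrite /cor -reimE divfK ?gt_eqF //; apply; rewrite ?divr_gt0.
move=> {e e0 l l0 z} e0.
pose G x y l := exists m0, forall m, (m0 <= m)%N ->
    abs (dyadic_grid p m (cor x y) l) <= e' * sq_weight S x y l.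
apply: (square_induction (G := G)) => {x y l'} [x y l l0|x y].
  move=> [m1 h1] [m2 h2] [m3 h3] [m4 h4].
  exists (maxn (maxn m1 m2) (maxn m3 m4)).+1 => -[//|m].
  rewrite ltnS !geq_max => /andP[/andP[/h1 {}h1 /h2 {}h2] /andP[/h3 {}h3 /h4 {}h4]].
  rewrite dyadic_gridS sq_weight_split [leRHS]mulrDr.
  rewrite (mulrDr _ (sq_weight _ x y _)) (mulrDr _ (sq_weight _ x (y + _) _)).
  have e1 : cor x y + toC (l / 2) = cor (x + l / 2) y.
    by rewrite /cor rmorphD /=; ring.
  have e2 : cor x y + iC R * toC (l / 2) = cor x (y + l / 2).
    by rewrite /cor rmorphD /=; ring.
  have e3 : cor (x + l / 2) y + iC R * toC (l / 2) = cor (x + l / 2) (y + l / 2).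
    by rewrite /cor rmorphD /=; ring.
  rewrite e1 e2 e3 (le_trans (absD _ _)) //.
  by apply: lerD; rewrite (le_trans (absD _ _)) //; apply: lerD.
pose s := cor x y.
have res : re s = x by rewrite /re /s /cor /= ; ring.
have ims : im s = y by rewrite /im /s /cor /= ; ring.
have near_s x' y' l' t : 0 < l' -> x' <= x <= x' + l' -> y' <= y <= y' + l' ->
    in_square (cor x' y') l' t -> abs (t - s) <= 2 * l'.
  move=> l0 hx hy [a [b [-> ha hb]]].
  have -> : cor x' y' + toC a + iC R * toC b - s =
            toC (x' + a - x) + iC R * toC (y' + b - y).
    by rewrite /s /cor !rmorphB !rmorphD /=; ring.
  rewrite (le_trans (absD _ _)) // absM abs_iC mul1r !abs_toC.
  have ? : `|x' + a - x| <= l' by rewrite ler_norml; lra.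
  have ? : `|y' + b - y| <= l' by rewrite ler_norml; lra.
  lra.
have side l' m : l' / 2 ^+ m * (2 ^ m)%N%:R = l'.
  by rewrite natrX divfK ?expf_neq0.
have [sS|/pd [v Hv]] := boolP (s \in S).
  have [d d0 Hd] := pc s 1 ltr01.
  pose M := abs (p s) + 1.
  have M0 : 0 < M by rewrite ltr_wpDl ?abs_ge0.
  exists (Num.min (d / 2) (e' / (4 * M))).
    by rewrite lt_min !divr_gt0 // mulr_gt0.
  move=> x' y' l' /andP[l0]; rewrite lt_min => /andP[ld le] hx hy.
  exists 0%N => m _; apply: (@le_trans _ _ (4 * l' * M)).
    have := @grid_near_affine R p (2 ^ m) (cor x' y') (l' / 2 ^+ m) 0 0 M.
    rewrite side; apply; first by rewrite divr_ge0 ?exprn_ge0 // ltW.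
    move=> t /(near_s _ _ _ _ l0 hx hy) ht.
    rewrite mul0r addr0 subr0 -(subrK (p s) (p t)) (le_trans (absD _ _)) //.
    rewrite addrC lerD2l ltW // Hd //; lra.
  rewrite ltr_pdivlMr ?mulr_gt0 // in le.
  rewrite (le_trans (y := e')) //; first by apply: ltW; lra.
  by rewrite ler_peMr ?(ltW e0) // (sq_weight_ge1 sS) // ?res ?ims.
(* The divisor 8 is the factor 4 of the perimeter times the factor 2 of [near_s], so that the total
   is [e' * l' ^+ 2]. *)
have [d d0 Hd] := Hv (e' / 8) ltac:(by rewrite divr_gt0).
exists (d / 2); first by rewrite divr_gt0.
move=> x' y' l' /andP[l0 ld] hx hy.
exists 0%N => m _; apply: (@le_trans _ _ (4 * l' * (e' / 8 * (2 * l')))).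
  have := @grid_near_affine R p (2 ^ m) (cor x' y') (l' / 2 ^+ m) (p s - v * s) v.
  move=> /(_ (e' / 8 * (2 * l'))).
  rewrite side; apply; first by rewrite divr_ge0 ?exprn_ge0 // ltW.
  move=> t /(near_s _ _ _ _ l0 hx hy) ht.
  have -> : p t - (p s - v * s + v * t) = p t - p s - v * (t - s) by ring.
  rewrite (le_trans (Hd _ _)) //; first lra.
  by rewrite ler_wpM2l // divr_ge0 // ltW.
rewrite [leLHS](_ : _ = e' * l' ^+ 2); last by field.
by rewrite ler_wpM2l ?(ltW e0) // sq_weight_ge.
Qed.
End Goursat.

(** * Liouville's theorem *)

Section DividedDifference.
Variable R : realType.
Local Notation C := (Cplx R).
Implicit Types (p q g : C -> C) (z a : C).

Lemma cdiff_differentiable g z : cdiff g z -> differentiable g z.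
Proof.
move=> [l H]; apply/derivable1_diffP/cvg_ex; exists l => /=.
move=> A /near_absP [e e0 HA].
have [d d0 Hd] := H (e / 2) ltac:(by rewrite divr_gt0).
suff : \forall t \near (0 : C), t != 0 -> A (t^-1 *: (g (t%:A + z) - g z)) by [].
apply/near_absP; exists d => // t.
rewrite subr0 => td t0; apply: HA; have := Hd (t + z).
rewrite addrK => /(_ td) h.
rewrite scaler1 -[_ *: _]/(_ * _) -[l in X in abs (X)](mulKf t0) -mulrBr absM absV.
rewrite mulrC ltr_pdivrMr ?abs_gt0 // [t * l]mulrC (le_lt_trans h) //.
by rewrite ltr_pM2r ?abs_gt0 // gtr_pMr // invf_lt1 // ltr1n.
Qed.

Lemma ccontP g z : ccont g z <-> {for z, continuous g}.
Proof.
split=> [H A /= /near_absP [e e0 HA]|cg e e0].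
  by have [d d0 Hd] := H _ e0; apply/near_absP; exists d => // t /Hd /HA.
apply/near_absP.
have : nbhs (g z) [set t | abs (t - g z) < e] by apply/near_absP; exists e.
by move/cg.
Qed.

Lemma ccont_near (g g' : C -> C) z : (\forall t \near z, g' t = g t) ->
  ccont g z -> ccont g' z.
Proof.
move=> /near_absP [d d0 Hd] H e e0; have [d' d0' Hd'] := H e e0.
exists (Num.min d d'); first by rewrite lt_min d0.
move=> t; rewrite lt_min => /andP[/Hd -> /Hd' +].
by rewrite (Hd z) // subrr abs0.
Qed.

Lemma cdiff_near (g g' : C -> C) z : (\forall t \near z, g' t = g t) ->
  cdiff g z -> cdiff g' z.
Proof.
move=> /near_absP [d d0 Hd] [l H]; exists l => e e0; have [d' d0' Hd'] := H e e0.
exists (Num.min d d'); first by rewrite lt_min d0.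
move=> t; rewrite lt_min => /andP[/Hd -> /Hd' +].
by rewrite (Hd z) // subrr abs0.
Qed.

(** The value at a is the derivative of q, which yields continuity there but not
    differentiability. *)
Lemma divided_difference q a : (forall z, ccont q z) -> cdiff q a ->
  exists p : C -> C, [/\ forall t, t != a -> p t = (q t - q a) / (t - a),
     forall z, ccont p z & forall z, z != a -> cdiff q z -> cdiff p z].
Proof.
move=> qc [l ql].
exists (fun t => if t == a then l else (q t - q a) / (t - a)).
have off z : z != a -> \forall t \near z,
    (if t == a then l else (q t - q a) / (t - a)) = (q t - q a) / (t - a).
  move=> za; apply/near_absP; exists (abs (z - a)).
    by rewrite abs_gt0 subr_eq0.
  by move=> t; case: eqP => // ->; rewrite abs_distC ltxx.
split=> [t /negPf -> //|z|z za /cdiff_differentiable qd]; last first.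
  apply: (cdiff_near (off z za)); apply: differentiable_cdiff.
  apply: differentiableM; first exact: differentiableB.
  by apply: differentiableV; rewrite ?subr_eq0.
have [->|za] := eqVneq z a; last first.
  apply: (ccont_near (off z za)); apply/ccontP.
  apply: (@continuousM _ C (fun t => q t - q a) (fun t => (t - a)^-1)).
    by apply: continuousB; [apply/ccontP | exact: cst_continuous].
  apply: continuousV; first by rewrite subr_eq0.
  by apply: continuousB; [exact: cvg_id | exact: cst_continuous].
move=> e e0; have [d d0 Hd] := ql (e / 2) ltac:(by rewrite divr_gt0).
exists d => // t td; rewrite eqxx; case: eqP => [_|/eqP ta].
  by rewrite subrr abs0.
have ta0 : t - a != 0 by rewrite subr_eq0.
rewrite -[l in X in _ - X](mulfK ta0) -mulrBl absM absV.
rewrite ltr_pdivrMr ?abs_gt0 // (le_lt_trans (Hd _ td)) //.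
by rewrite ltr_pM2r ?abs_gt0 // gtr_pMr // invf_lt1 // ltr1n.
Qed.
End DividedDifference.

Section Liouville.
Variable R : realType.
Local Notation C := (Cplx R).
Implicit Types (p q g : C -> C) (z a : C) (u v h L : R) (n : nat).

Lemma toC_pair u v : toC u + iC R * toC v = (u +i* v)%C.
Proof. by rewrite [RHS]complexE. Qed.
Lemma re_inv u v : re ((toC u + iC R * toC v)^-1) = u / (u ^+ 2 + v ^+ 2).
Proof. by rewrite toC_pair. Qed.
Lemma im_inv u v : im ((toC u + iC R * toC v)^-1) = - (v / (u ^+ 2 + v ^+ 2)).
Proof. by rewrite toC_pair. Qed.
Lemma imM_toC u z : im (toC u * z) = u * im z.
Proof. by case: z => x y /=; rewrite /im /= mul0r addr0. Qed.
Lemma imM_iC z : im (iC R * z) = re z.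
Proof. by case: z => x y; rewrite /im /= mul0r add0r mul1r. Qed.
Lemma imN z : im (- z) = - im z. Proof. by case: z. Qed.
Lemma imB z a : im (z - a) = im z - im a. Proof. by rewrite imD imN. Qed.
Lemma reM_toC u z : re (toC u * z) = u * re z.
Proof. by case: z => x y /=; rewrite /re /= mul0r subr0. Qed.
Lemma im_sum (I : finType) (F : I -> C) : im (\sum_i F i) = \sum_i im (F i).
Proof. by apply: (big_morph (@im R)) => //; exact: imD. Qed.

(* A discrete form of [Im (\oint dz / z) = 2 pi]; the constant 4 suffices. *)
Lemma grid_inv n z0 h L : (0 < n)%N -> 0 < L -> h * n%:R = 2 * L ->
  4 <= im (grid (fun t => (t - z0)^-1) n (z0 - toC L - iC R * toC L) h).
Proof.
move=> n0 L0 hn; rewrite grid_bdry.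
set z := z0 - _ - _; set r := fun t => _.
have nR : 0 < n%:R :> R by rewrite ltr0n.
have h0 : 0 < h by rewrite -(pmulr_lgt0 _ nR) hn mulr_gt0.
have gE j k : r (gpt z h j k) =
    (toC (h * j%:R - L) + iC R * toC (h * k%:R - L))^-1.
  by rewrite /r /gpt /z !rmorphB /=; congr (_^-1); ring.
have hj j : (j <= n)%N -> - L <= h * j%:R - L <= L.
  move=> jn; have : h * j%:R <= h * n%:R by rewrite ler_wpM2l ?ler_nat // ltW.
  have : 0 <= h * j%:R by rewrite mulr_ge0 // ltW.
  by rewrite hn; lra.
have low u : - L <= u <= L -> (2 * L)^-1 <= L / (u ^+ 2 + L ^+ 2).
  move=> uL; have L2 : 0 < L ^+ 2 by rewrite exprn_gt0.
  rewrite ler_pdivlMr ?ltr_wpDl ?sqr_ge0 // mulrC ler_pdivrMr ?mulr_gt0 //.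
  by nra.
have hnL : h * n%:R - L = L by rewrite hn; ring.
have h0L : h * 0%:R - L = - L by rewrite mulr0 sub0r.
have B j : (j <= n)%N -> (2 * L)^-1 <= im (r (gpt z h j 0)).
  by move=> /hj /low; rewrite gE im_inv h0L mulNr opprK sqrrN.
have T j : (j <= n)%N -> im (r (gpt z h j n)) <= - (2 * L)^-1.
  by move=> /hj /low; rewrite gE im_inv hnL lerN2.
have Rt k : (k <= n)%N -> (2 * L)^-1 <= re (r (gpt z h n k)).
  by move=> /hj /low; rewrite gE re_inv hnL addrC.
have Lf k : (k <= n)%N -> re (r (gpt z h 0 k)) <= - (2 * L)^-1.
  by move=> /hj /low; rewrite gE re_inv h0L mulNr lerN2 sqrrN addrC.
(* Each column or row contributes at least h / L, and the n of them add up to 2 because h n = 2 L;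
   the two directions together give 4. *)
have sum_ge (F : 'I_n -> R) : (forall j, h / L <= F j) -> 2 <= \sum_j F j.
  move=> FB; apply: (@le_trans _ _ (\sum_(j < n) h / L)); last exact: ler_sum.
  rewrite sumr_const card_ord -[_ *+ n]mulr_natr mulrAC hn -mulrA.
  by rewrite divff ?mulr1 // gt_eqF.
have h2 : 0 <= h / 2 by rewrite divr_ge0 // ltW.
have q4 : h / L = h / 2 * ((2 * L)^-1 + (2 * L)^-1 - (- (2 * L)^-1 - (2 * L)^-1)).
  by field; rewrite gt_eqF.
rewrite /bdry imD !im_sum (_ : 4 = 2 + 2) ?lerD ?sum_ge //; last by ring.
  move=> j; rewrite imB /trapH !imM_toC !gptS1 !imD -mulrBr q4 ler_wpM2l //.
  have jn := ltn_ord j.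
  by apply: lerB; apply: lerD; rewrite ?B ?T // ltnW.
move=> k; rewrite imB /trapV -!mulrA !imM_iC !reM_toC !gptS2 !reD -mulrBr q4.
rewrite ler_wpM2l //; have kn := ltn_ord k.
by apply: lerB; apply: lerD; rewrite ?Rt ?Lf // ltnW.
Qed.

(** Cauchy's formula on a large square around z0. The grid sum of (q - q z0) / (z - z0) is small by
    Goursat; on the boundary q / (z - z0) is of order 1 / L^2 against a perimeter 8 L; so q z0 times
    the grid sum of 1 / (z - z0), which is at least 4 in modulus, is too small unless q z0 = 0. *)
Lemma decaying_eq0 q (S : seq C) (M r : R) :
  (forall z, ccont q z) -> (forall z, z \notin S -> cdiff q z) ->
  (forall z, r <= abs z -> abs (q z) * abs z <= M) ->
  forall z, z \notin S -> q z = 0.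
Proof.
move=> qc qd qM z0 z0S; have [p [pE pc pd]] := divided_difference qc (qd _ z0S).
have pS z : z \notin z0 :: S -> cdiff p z.
  by rewrite inE negb_or => /andP[zz0 /qd]; exact: pd.
apply/eqP; rewrite -abs_eq0; apply/negP => /negP qz0.
have {}qz0 : 0 < abs (q z0) by rewrite lt0r qz0 abs_ge0.
pose M' := `|M| + 1.
have M0 : 0 < M' by rewrite ltr_wpDl.
have {}qM z : r <= abs z -> abs (q z) * abs z <= M'.
  by move=> /qM h; rewrite (le_trans h) // (le_trans (ler_norm _)) // lerDl.
(* With L at least twice |r| and |z0|, boundary points satisfy |t| >= L / 2 >= r, where the decay
   applies; the third term makes the boundary sum 16 M' / L at most |q z0|. Goursat with tolerance
   |q z0| then gives 4 |q z0| <= 2 |q z0|, a contradiction. *)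
pose L := `|r| * 2 + abs z0 * 2 + 16 * M' / abs (q z0) + 1.
have [? ?] := (abs_ge0 z0, normr_ge0 r).
have ? : 0 < 16 * M' / abs (q z0) by rewrite divr_gt0 // mulr_gt0.
have [L0 L1 L2 L3] : [/\ 0 < L, `|r| * 2 <= L, abs z0 * 2 <= L &
    16 * M' / abs (q z0) <= L] by rewrite /L; split; lra.
pose cor := z0 - toC L - iC R * toC L.
have [m Hm] := goursat pc pS cor (l := 2 * L) ltac:(by rewrite mulr_gt0) qz0.
have {}Hm := Hm m (leqnn _); rewrite /dyadic_grid in Hm.
set n := (2 ^ m)%N in Hm; set h := (_ / _) in Hm.
have n0 : (0 < n)%N by rewrite expn_gt0.
have hn : h * n%:R = 2 * L by rewrite /h /n natrX divfK ?expf_neq0.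
have h0 : 0 <= h by rewrite divr_ge0 ?exprn_ge0 // mulr_ge0 // ltW.
have W := grid_inv z0 n0 L0 hn.
have : abs (grid (fun t => p t - (- q z0) * (t - z0)^-1) n cor h) <=
    4 * (h * n%:R) * (2 * M' / L ^+ 2).
  rewrite grid_bdry; apply: bdry_le => // t [a [b [tE]]]; rewrite hn => ha hb ab.
  have tz : t - z0 = toC (a - L) + iC R * toC (b - L).
    by rewrite tE /cor !rmorphB /=; ring.
  have far : L <= abs (t - z0).
    have hre : `|a - L| <= abs (t - z0).
      by have := abs_re (t - z0); rewrite {1}tz toC_pair.
    have him : `|b - L| <= abs (t - z0).
      by have := abs_im (t - z0); rewrite {1}tz toC_pair.
    have : L <= `|a - L| \/ L <= `|b - L|.
      by case: ab => ->; [left|left|right|right]; rewrite ler_normr; lra.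
    by case=> h1; rewrite (le_trans h1).
  have tz0 : t != z0 by rewrite -subr_eq0 -abs_gt0 (lt_le_trans L0).
  rewrite pE // mulNr opprK -mulrDl subrK absM absV.
  have tL : L / 2 <= abs t by have := absB t z0; lra.
  have {}qM : abs (q t) * abs t <= M'.
    by apply: qM; have := ler_norm r; lra.
  have q2 : abs (q t) <= 2 * M' / L.
    rewrite ler_pdivlMr //.
    have := ler_wpM2l (abs_ge0 (q t)) tL; lra.
  have -> : 2 * M' / L ^+ 2 = 2 * M' / L * L^-1 by field; rewrite gt_eqF.
  by rewrite ler_pM ?abs_ge0 ?invr_ge0 ?abs_ge0 // lef_pV2 // posrE (lt_le_trans L0).
rewrite gridB hn => H.
have sc : grid (fun t => - q z0 * (t - z0)^-1) n cor h =
    - q z0 * grid (fun t => (t - z0)^-1) n cor h.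
  rewrite /grid mulr_sumr; apply: eq_bigr => j _; rewrite mulr_sumr.
  by apply: eq_bigr => k _; rewrite /cell /trapH /trapV; ring.
rewrite sc in H; set w := grid _ n _ h in W sc H.
have W' : 4 <= abs w by rewrite (le_trans W) // (le_trans (ler_norm _)) ?abs_im.
have : abs (q z0) * abs w <= abs (q z0) + 4 * (2 * L) * (2 * M' / L ^+ 2).
  rewrite -absM -absN -mulNr -[- q z0 * w](subKr (grid p n cor h)).
  by rewrite (le_trans (absB _ _)) // lerD.
have -> : 4 * (2 * L) * (2 * M' / L ^+ 2) = 16 * M' / L.
  by field; rewrite gt_eqF.
have : 16 * M' / L <= abs (q z0).
  by rewrite ler_pdivrMr // [_ * L]mulrC -ler_pdivrMr.
by have := ler_wpM2l (ltW qz0) W'; lra.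
Qed.

Lemma avoid_seq (S : seq C) : exists a : C, a \notin S.
Proof.
exists (toC (1 + \sum_(s <- S) abs s)); apply/negP => aS.
have : abs (toC (1 + \sum_(s <- S) abs s)) <= \sum_(s <- S) abs s.
  rewrite {2}(big_rem _ aS) /= lerDl sumr_ge0 // => s _; exact: abs_ge0.
rewrite abs_toC ger0_norm ?addr_ge0 ?sumr_ge0 // => [|s _]; last exact: abs_ge0.
by lra.
Qed.

(* The divided difference at a lowers the growth by one degree, at the price of
   one more point at which differentiability is not known. *)
Lemma growth_polynomial n q (S : seq C) (M r : R) :
  (forall z, ccont q z) -> (forall z, z \notin S -> cdiff q z) ->
  (forall z, r <= abs z -> abs (q z) * abs z <= M * abs z ^+ n) ->
  exists2 P : {poly C}, (size P <= n)%N & forall z, z \notin S -> q z = P.[z].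
Proof.
(* Bounding |q z| |z| rather than |q z| makes n = 0 the decaying case. *)
elim: n q S M r => [|n IH] q S M r qc qd qM.
  exists 0; first by rewrite size_poly0.
  move=> z zS; rewrite horner0; apply: (decaying_eq0 qc qd _ zS (M := M) (r := r)).
  by move=> t /qM; rewrite mulr1.
have [a aS] := avoid_seq S.
have [p [pE pc pd]] := divided_difference qc (qd _ aS).
have pS z : z \notin a :: S -> cdiff p z.
  by rewrite inE negb_or => /andP[za /qd]; exact: pd.
have [|P sP PE] := IH p (a :: S) (2 * (M + abs (q a))) (`|r| + 1 + 2 * abs a) pc pS.
  move=> z zr; have [[? ?] ?] := (abs_ge0 a, normr_ge0 r, ler_norm r).
  have z1 : 1 <= abs z by lra.
  have z0 : 0 < abs z by lra.
  have za : abs z / 2 <= abs (z - a) by have := abs_triB z a; lra.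
  have za0 : 0 < abs (z - a) by apply: lt_le_trans za; rewrite divr_gt0.
  have zn : z != a by rewrite -subr_eq0 -abs_gt0.
  have {}qM : abs (q z) <= M * abs z ^+ n.
    by rewrite -(ler_pM2r z0) -mulrA -exprSr qM //; lra.
  rewrite pE // absM absV mulrAC ler_pdivrMr //.
  have h1 : abs (q z - q a) <= (M + abs (q a)) * abs z ^+ n.
    rewrite (le_trans (absB _ _)) // mulrDl lerD //.
    by rewrite ler_peMr ?abs_ge0 // exprn_ege1.
  have h2 := le_trans (abs_ge0 _) h1.
  rewrite -mulrA [leRHS](_ : _ = (M + abs (q a)) * abs z ^+ n * (2 * abs (z - a))).
    by apply: ler_pM; rewrite ?abs_ge0 //; lra.
  by ring.
exists (P * ('X - a%:P) + (q a)%:P).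
  rewrite (leq_trans (size_polyD _ _)) // geq_max.
  rewrite (leq_trans (size_polyC_leq1 _)) // andbT.
  rewrite (leq_trans (size_polyMleq _ _)) // size_XsubC addn2 //.
move=> z zS; rewrite !hornerE; have [->|za] := eqVneq z a.
  by rewrite subrr mulr0 add0r.
by rewrite -PE ?inE ?negb_or ?za // pE // divfK ?subr_eq0 // subrK.
Qed.

Theorem polynomial_growth_polynomial n q (M r : R) :
  (forall z, cdiff q z) ->
  (forall z, r <= abs z -> abs (q z) <= M * abs z ^+ n) ->
  exists2 P : {poly C}, (size P <= n.+1)%N & forall z, q z = P.[z].
Proof.
move=> qd qM; have [] := @growth_polynomial n.+1 q [::] M r.
- by move=> z; exact/cdiff_ccont/qd.
- by move=> z _.
- by move=> z /qM h; rewrite exprSr mulrA ler_wpM2r ?abs_ge0.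
by move=> P sP PE; exists P => // z; apply: PE.
Qed.
End Liouville.

(** * Lifting to the universal covering *)

Section Differentiability.
Variable R : realType.
Local Notation C := (Cplx R).
Local Notation C2 := (C2 R).

Lemma near_eq_differentiable (K : numFieldType) (V W : normedModType K)
    (f g : V -> W) (x : V) :
  (\forall y \near x, g y = f y) -> differentiable f x -> differentiable g x.
Proof.
move=> fg [[dc dE]].
have gE : g = cst (g (lim (nbhs x))) + 'd f x \o center (lim (nbhs x))
    +o_x (center (lim (nbhs x))).
  move: dE; rewrite lim_id // => /eqaddoP fo; apply/eqaddoP => e /fo.
  have gx := nbhs_singleton fg.
  by apply: filterS2 fg => y gy; rewrite !fctE /= gy gx.
apply/diffP.
pose P := fun d : {linear V -> W} => continuous d /\ forall y,
  g y = g (lim (nbhs x)) + d (y - lim (nbhs x)) +o_(y \near x) (y - lim (nbhs x)).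
apply: (@getPex _ P); exists ('d f x); split=> //.
by move: gE; rewrite funeqE.
Qed.

Lemma differentiable_fst (x : C2) : differentiable (fst : C2 -> C) x.
Proof. by apply: (@linear_differentiable C C2 C fst) => y; apply: cvg_fst. Qed.
Lemma differentiable_snd (x : C2) : differentiable (snd : C2 -> C) x.
Proof. by apply: (@linear_differentiable C C2 C snd) => y; apply: cvg_snd. Qed.

(** The five contractions are of this form, with c = 0 in the diagonal classes and m = r in II_a, m
    = 1 elsewhere; so are their square roots and inverses, with the same m. *)
Definition tri (a c : C) (m : nat) (d : C) : C2 -> C2 :=
  fun x => (a * x.1 + c * x.2 ^+ m, d * x.2).

Lemma differentiable_tri a c m d x : differentiable (tri a c m d) x.
Proof.
apply: differentiable_pair.
  apply: differentiableD; first exact/differentiableZ/differentiable_fst.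
  apply: differentiableZ; elim: m => [|m IH]; first exact: differentiable_cst.
  under eq_fun do rewrite exprS.
  by apply: differentiableM => //; exact: differentiable_snd.
exact/differentiableZ/differentiable_snd.
Qed.
End Differentiability.

Section Segments.
Variable R : realType.
Local Notation C := (Cplx R).
Local Notation C2 := (C2 R).

(** Continuation along [0, 1]: near each s the truth of [P] passes between any two points, so the
    supremum of the points where [P] holds is attained and equals 1. *)
Lemma unit_interval_induction (P : R -> Prop) : P 0 ->
  (forall s : R, 0 <= s <= 1 -> exists2 d : R, 0 < d & forall s1 s2 : R,
     0 <= s1 <= 1 -> 0 <= s2 <= 1 -> `|s1 - s| < d -> `|s2 - s| < d ->
     P s1 -> P s2) ->
  P 1.
Proof.
move=> P0 loc; pose A := [set s | 0 <= s <= 1 /\ P s].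
have A0 : A 0 by rewrite /A /= lexx ler01.
have Aub : ubound A 1 by move=> s [/andP[]].
have Asup : has_sup A by split; [exists 0 | exists 1].
have s1 : 0 <= sup A <= 1.
  apply/andP; split; first by apply: ub_le_sup => //; exists 1.
  by apply: ge_sup => //; exists 0.
have [d d0 Hd] := loc _ s1.
have [s [s01 Ps] hs] := sup_adherent d0 Asup.
have ssup : s <= sup A by apply: ub_le_sup; [exists 1 | split].
pose t := Num.min 1 (sup A + d / 2).
have t1 : t <= 1 by rewrite ge_min lexx.
have t2 : t <= sup A + d / 2 by rewrite ge_min lexx orbT.
have t3 : sup A <= t by rewrite le_min; lra.
have Pt : P t.
  by apply: (Hd s) => //; rewrite ?ltr_norml; lra.
have : t <= sup A by apply: ub_le_sup; [exists 1 | split => //; lra].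
move: Pt; rewrite /t; by case: (leP 1 (sup A + d / 2)) => // h _ hs'; exfalso; lra.
Qed.

Definition seg (e x : C2) (s : R) : C2 := e + toC s *: (x - e).

Lemma seg0 e x : seg e x 0 = e.
Proof. by rewrite /seg rmorph0 scale0r addr0. Qed.
Lemma seg1 e x : seg e x 1 = x.
Proof. by rewrite /seg rmorph1 scale1r addrC subrK. Qed.
Lemma segE (z w z' w' : C) s :
  seg (z, w) (z', w') s = (z + toC s * (z' - z), w + toC s * (w' - w)).
Proof. by []. Qed.

Lemma nrmZ (k : C) (x : C2) : nrm (k *: x) = abs k * nrm x.
Proof. by rewrite /nrm /= !absM mulrDr. Qed.

Lemma seg_dist e x s t : nrm (seg e x s - seg e x t) = `|s - t| * nrm (x - e).
Proof.
rewrite /seg opprD addrACA subrr add0r -scalerBl -rmorphB nrmZ abs_toC.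
by [].
Qed.

Lemma seg_near e x s (r : R) : 0 < r -> exists2 d : R, 0 < d &
  forall t, `|t - s| < d -> nrm (seg e x t - seg e x s) < r.
Proof.
move=> r0; have n1 : 0 < nrm (x - e) + 1 by rewrite ltr_wpDl ?nrm_ge0.
exists (r / (nrm (x - e) + 1)); first by rewrite divr_gt0.
move=> t; rewrite ltr_pdivlMr // seg_dist => h; apply: le_lt_trans h.
by rewrite ler_wpM2l // lerDl.
Qed.

Lemma seg_seg_near e x p q t1 t2 u (r : R) : 0 <= u <= 1 ->
  nrm (p - seg e x t1) < r -> nrm (q - seg e x t2) < r ->
  nrm (seg p q u - seg e x (t1 + u * (t2 - t1))) < r.
Proof.
move=> /andP[u0 u1] hp hq.
have -> : seg p q u - seg e x (t1 + u * (t2 - t1)) =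
    toC (1 - u) *: (p - seg e x t1) + toC u *: (q - seg e x t2).
  rewrite /seg !(rmorphD, rmorphB, rmorphM, rmorph1) /=.
  by case: e x p q {hp hq} => [? ?] [? ?] [? ?] [? ?]; congr pair => /=;
    rewrite -![_ *: _]/(_ * _); ring.
rewrite (le_lt_trans (nrmD _ _)) // !nrmZ !abs_toC !ger0_norm ?subr_ge0 //.
have [->|u_neq0] := eqVneq u 0; first by rewrite mul0r addr0 subr0 mul1r.
have {}u0 : 0 < u by rewrite lt0r u_neq0.
have h1 : (1 - u) * nrm (p - seg e x t1) <= (1 - u) * r.
  by rewrite ler_wpM2l ?subr_ge0 // ltW.
have h2 : u * nrm (q - seg e x t2) < u * r by rewrite ltr_pM2l.
lra.
Qed.

Lemma seg_sub_ball p q y (r : R) u : 0 <= u <= 1 ->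
  nrm (p - y) < r -> nrm (q - y) < r -> nrm (seg p q u - y) < r.
Proof.
move=> hu hp hq; have := @seg_seg_near y y p q 0 0 u r hu.
by rewrite !seg0 /seg !subrr !scaler0 addr0; apply.
Qed.
End Segments.

(** * Lifting along segments *)

Section Covering.
Variable R : realType.
Local Notation C := (Cplx R).
Local Notation C2 := (C2 R).

(** What the covering argument uses of f: a differentiable inverse and a positive function that f
    contracts. On W the group generated by f then acts freely with discrete orbits, since v
    decreases strictly along them. *)
Record lyapunov (f fi : C2 -> C2) (v : C2 -> R) (lam : R) : Prop := Lyapunov {
  lyap_fK : cancel f fi;
  lyap_fiK : cancel fi f;
  lyap_f_neq0 : forall x, x != 0 -> f x != 0;
  lyap_fi_neq0 : forall x, x != 0 -> fi x != 0;
  lyap_df : forall x, differentiable f x;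
  lyap_dfi : forall x, differentiable fi x;
  lyap_v_gt0 : forall x, x != 0 -> 0 < v x;
  lyap_v_cont : forall x (e : R), 0 < e -> exists2 d : R, 0 < d &
    forall y, nrm (y - x) < d -> `|v y - v x| < e;
  lyap_lam : 0 < lam < 1;
  lyap_v_f : forall x, v (f x) <= lam * v x }.

Variables (f fi : C2 -> C2) (v : C2 -> R) (lam : R).
Hypothesis H : lyapunov f fi v lam.

Let fI : injective f := can_inj (lyap_fK H).

Lemma lyap_iter n x : v (iter n f x) <= lam ^+ n * v x.
Proof.
elim: n => [|n IH]; first by rewrite mul1r.
have /andP[l0 _] := lyap_lam H.
by rewrite /= (le_trans (lyap_v_f H _)) // exprS -mulrA ler_wpM2l // ltW.
Qed.

Lemma iter_neq0 n x : x != 0 -> iter n f x != 0.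
Proof. by move=> x0; elim: n => //= n; exact: lyap_f_neq0 H _. Qed.

Lemma hproj_iter n x : x != 0 -> hproj f (iter n f x) = hproj f x.
Proof.
by move=> x0; apply/(hprojP f (iter_neq0 n x0) x0); exists 0%N, n.
Qed.

(** Near y the function v is almost constant, while two distinct points of one orbit have values of
    v in a ratio at most [lam]. *)
Lemma hproj_loc_inj (y : C2) : y != 0 -> exists2 e : R, 0 < e &
  forall x x', x != 0 -> x' != 0 -> nrm (x - y) < e -> nrm (x' - y) < e ->
  hproj f x = hproj f x' -> x = x'.
Proof.
move=> y0; have vy := lyap_v_gt0 H y0; have /andP[l0 l1] := lyap_lam H.
have r0 : 0 < v y * (1 - lam) / 4 by rewrite divr_gt0 // mulr_gt0 // subr_gt0.
have [e e0 He] := lyap_v_cont H y r0; exists e => // x x' x0 x'0.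
suff key x1 n : x1 != 0 -> nrm (x1 - y) < e -> nrm (iter n f x1 - y) < e -> n = 0%N.
  move=> hx hx' /(hopf_relE fI x0 x'0) [] [n E]; rewrite E in hx hx' *.
    by rewrite (key x n).
  by rewrite (key x' n).
move=> x10 /He h1 /He h2; case: n h2 => // n h2; exfalso.
have := lyap_v_f H (iter n f x1); rewrite -iterS.
have := lyap_iter n x1.
have : lam ^+ n * v x1 <= v x1.
  by rewrite ler_piMl ?(ltW (lyap_v_gt0 H x10)) // exprn_ile1 // ltW.
move: h1 h2; rewrite !ltr_norml => /andP[a1 a2] /andP[a3 a4] b1 b2 b3.
have b4 : v (iter n.+1 f x1) <= lam * v x1.
  by rewrite (le_trans b3) // ler_wpM2l ?(ltW l0) // (le_trans b2).
nra.
Qed.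

Definition deck (T : C2 -> C2) := exists n, T = iter n f \/ T = iter n fi.

Lemma fiter_iterK n : cancel (iter n f) (iter n fi).
Proof. by elim: n => // n IH x; rewrite iterSr /= (lyap_fK H). Qed.

Lemma deck_props T : deck T -> [/\ forall x, differentiable T x,
  forall x, x != 0 -> T x != 0 & forall x, x != 0 -> hproj f (T x) = hproj f x].
Proof.
have dit (g : C2 -> C2) n : (forall x, differentiable g x) ->
    forall x, differentiable (iter n g) x.
  move=> dg x; elim: n => [|n IH]; first exact: (@ex_diff _ _ _ _ _ _ _ (is_diff_id x)).
  exact: differentiable_comp IH (dg _).
have iter_fi_neq0 n x : x != 0 -> iter n fi x != 0.
  by move=> x0; elim: n => //= n; exact: lyap_fi_neq0 H _.
move=> [n [->|->]]; split.
- by apply: dit; exact: lyap_df H.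
- by move=> x; exact: iter_neq0.
- by move=> x; exact: hproj_iter.
- by apply: dit; exact: lyap_dfi H.
- by move=> x; exact: iter_fi_neq0.
move=> x x0; rewrite -(hproj_iter n (iter_fi_neq0 n x x0)); congr hproj.
by elim: n x {x0} => // n IH x; rewrite iterSr /= (lyap_fiK H) IH.
Qed.

Lemma deck_exists x y : x != 0 -> y != 0 -> hproj f x = hproj f y ->
  exists2 T, deck T & T x = y.
Proof.
move=> x0 y0 /(hopf_relE fI x0 y0) [] [n ->].
  by exists (iter n f) => //; exists n; left.
by exists (iter n fi); rewrite ?fiter_iterK //; exists n; right.
Qed.

Definition lift_at (phi : Hopf f -> Hopf f) (F : C2 -> C2) (y : C2) :=
  [/\ differentiable F y, F y != 0 & phi (hproj f y) = hproj f (F y)].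

Lemma lift_at_deck phi F T y : deck T -> lift_at phi F y -> lift_at phi (T \o F) y.
Proof.
move=> /deck_props [dT T0 pT] [dF F0 pF]; split => /=.
- exact: (differentiable_comp dF (dT (F y))).
- exact: T0.
- by rewrite pT.
Qed.

Lemma lift_at_near phi F G y : (\forall x \near y, G x = F x) ->
  lift_at phi F y -> lift_at phi G y.
Proof.
move=> GF [dF F0 pF]; have Gy := nbhs_singleton GF.
by split; rewrite ?Gy //; exact: near_eq_differentiable dF.
Qed.

(** Both agreement and disagreement are open along the segment: the first because the projection is
    locally injective, the second by continuity. *)
Lemma lift_unique phi F F' e x :
  (forall s, 0 <= s <= 1 -> lift_at phi F (seg e x s) /\ lift_at phi F' (seg e x s)) ->
  F e = F' e -> F x = F' x.
Proof.
move=> L Fe; rewrite -(seg1 e x).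
apply: (unit_interval_induction (P := fun s => F (seg e x s) = F' (seg e x s))).
  by rewrite seg0.
move=> s hs; have [[dF F0 pF] [dF' F'0 pF']] := L s hs.
suff [r r0 Hr] : exists2 r : R, 0 < r & forall t1 t2, 0 <= t1 <= 1 -> 0 <= t2 <= 1 ->
    nrm (seg e x t1 - seg e x s) < r -> nrm (seg e x t2 - seg e x s) < r ->
    F (seg e x t1) = F' (seg e x t1) -> F (seg e x t2) = F' (seg e x t2).
  have [d d0 Hd] := seg_near e x s r0; exists d => // t1 t2 h1 h2 /Hd h3 /Hd h4.
  exact: Hr.
have [E|NE] := eqVneq (F (seg e x s)) (F' (seg e x s)).
  have [r r0 Hr] := hproj_loc_inj F0.
  have [d1 d10 H1] := differentiable_nrm_continuous dF r0.
  have [d2 d20 H2] := differentiable_nrm_continuous dF' r0.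
  exists (Num.min d1 d2); first by rewrite lt_min d10.
  move=> t1 t2 _ ht2 _; rewrite lt_min => /andP[h1 h2] _.
  have [[_ G0 pG] [_ G'0 pG']] := L t2 ht2.
  by apply: Hr => //; [exact: H1 | rewrite E; exact: H2 | rewrite -pG].
pose r := nrm (F (seg e x s) - F' (seg e x s)) / 2.
have r0 : 0 < r by rewrite divr_gt0 // nrm_gt0 subr_eq0.
have [d1 d10 H1] := differentiable_nrm_continuous dF r0.
have [d2 d20 H2] := differentiable_nrm_continuous dF' r0.
exists (Num.min d1 d2); first by rewrite lt_min d10.
move=> t1 t2 _ _; rewrite lt_min => /andP[/H1 h1 /H2 h2] _ E; exfalso.
have := nrm_tri (F (seg e x t1)) (F (seg e x s)) (F' (seg e x s)).
move: h1 h2; rewrite -E [nrm (F (seg e x s) - F (seg e x t1))]nrm_distC /r.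
by lra.
Qed.

Definition tube (r : R) (e x : C2) (s : R) (y : C2) :=
  exists2 t, 0 <= t <= s & nrm (y - seg e x t) < r.

Lemma tube_near r e x s y : tube r e x s y -> \forall y' \near y, tube r e x s y'.
Proof.
move=> [t ht h]; apply/near_nrmP; exists (r - nrm (y - seg e x t)).
  by rewrite subr_gt0.
move=> y' h'; exists t => //; have := nrm_tri y y' (seg e x t); lra.
Qed.

(** The lift is carried on a tube around the segment, not on the segment, because [lift_at] asks for
    differentiability, hence for a neighbourhood. *)
Lemma tube_lift phi e x y0 : holomorphic phi ->
  (forall s, 0 <= s <= 1 -> seg e x s != 0) -> y0 != 0 ->
  phi (hproj f e) = hproj f y0 ->
  exists r F, [/\ 0 < r, F e = y0 & forall y, tube r e x 1 y -> lift_at phi F y].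
Proof.
move=> hol seg_neq0 y00 py0.
apply: (unit_interval_induction (P := fun s => exists r F,
  [/\ 0 < r, F e = y0 & forall y, tube r e x s y -> lift_at phi F y])).
  have e0 : e != 0 by rewrite -(seg0 e x) seg_neq0 // lexx ler01.
  have [F /near_nrmP [r r0 LF]] := hol _ e0.
  have [_ F0 pF] : lift_at phi F e by apply: LF; rewrite subrr nrm0.
  have [T dT TF] : exists2 T, deck T & T (F e) = y0.
    by apply: deck_exists => //; rewrite -pF.
  exists r, (T \o F); split=> // y [t ht]; have -> : t = 0 by lra.
  by rewrite seg0 => /LF; exact: lift_at_deck.
move=> s hs; have [F0 /near_nrmP [r r0 LF0]] := hol _ (seg_neq0 s hs).
have r2 : 0 < r / 2 by rewrite divr_gt0.
have [d d0 Hd] := seg_near e x s r2.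
exists d => // s1 s2 hs1 hs2 ds1 ds2 [r1 [F [r10 Fe LF]]].
have h1 := Hd _ ds1.
have tube1 : tube r1 e x s1 (seg e x s1).
  by exists s1; rewrite ?subrr ?nrm0 //; lra.
have [_ FF0 pF] := LF _ tube1.
have [_ F00 pF0] : lift_at phi F0 (seg e x s1) by apply: LF0; lra.
have [T dT TF] := deck_exists F00 FF0 (etrans (esym pF0) pF).
(* The lift F reaching s1 is continued by the local lift F0 around s, corrected by the deck
   transformation T that matches them at s1. *)
pose G y := if `[< tube r1 e x s1 y >] then F y else T (F0 y).
have GF y : tube r1 e x s1 y -> G y = F y by move=> ty; rewrite /G asboolT.
have GF0 y : nrm (y - seg e x s) < r -> G y = T (F0 y).
  move=> hy; rewrite /G; case: asboolP => // ty.
  (* The two lifts agree on the overlap because y is joined to the point at s1 by a segment inside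
     both the tube and the ball. *)
  apply: (@lift_unique phi F (T \o F0) (seg e x s1)); last by rewrite /= TF.
  move=> u hu; split; last first.
    by apply: lift_at_deck => //; apply: LF0; apply: seg_sub_ball => //; lra.
  apply: LF; have [t ht hy'] := ty.
  exists (s1 + u * (t - s1)); last first.
    by apply: seg_seg_near => //; rewrite subrr nrm0.
  have : u * (s1 - t) <= s1 - t by rewrite ler_piMl //; lra.
  have : 0 <= u * (s1 - t) by rewrite mulr_ge0 //; lra.
  lra.
(* With r / 2, a point of the new tube near a parameter beyond s1 stays within r of the point at
   s. *)
exists (Num.min r1 (r / 2)), G; split.
- by rewrite lt_min r10.
- rewrite GF //; exists 0; rewrite ?seg0 ?subrr ?nrm0 //; lra.
move=> y [t ht]; rewrite lt_min => /andP[hy1 hy2].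
have [ts1|s1t] := leP t s1.
  have ty : tube r1 e x s1 y by exists t => //; lra.
  by apply: lift_at_near (LF _ ty); apply: filterS (tube_near ty).
have hy : nrm (y - seg e x s) < r.
  apply: le_lt_trans (nrm_tri (seg e x t) _ _) _.
  have : nrm (seg e x t - seg e x s) < r / 2.
    by apply: Hd; move: ds1 ds2; rewrite !ltr_norml; lra.
  by lra.
apply: lift_at_near (lift_at_deck dT (LF0 _ hy)).
apply/near_nrmP; exists (r - nrm (y - seg e x s)); first by rewrite subr_gt0.
by move=> y' hy'; apply: GF0; have := nrm_tri y y' (seg e x s); lra.
Qed.
End Covering.

Local Arguments re : simpl never.
Local Arguments im : simpl never.
Local Arguments toC : simpl never.

(** * Global lifts on C^2 minus 0 *)

Section GlobalLift.
Variable R : realType.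
Local Notation C := (Cplx R).
Local Notation C2 := (C2 R).
Variables (f fi : C2 -> C2) (v : C2 -> R) (lam : R).
Hypothesis H : lyapunov f fi v lam.
Implicit Types (phi : Hopf f -> Hopf f).

(** Each x is given its own lift, along the segment from e to x. These fit together because the tube
    of x contains a thinner tube around the segment to any nearby x', and lifts with value y0 at e
    are unique. *)
Lemma star_lift phi e y0 : holomorphic phi -> y0 != 0 ->
  phi (hproj f e) = hproj f y0 ->
  exists G, forall x, (forall s : R, 0 <= s <= 1 -> seg e x s != 0) -> lift_at phi G x.
Proof.
move=> hol y00 py0.
pose good x (t : R * (C2 -> C2)) :=
  [/\ 0 < t.1, t.2 e = y0 & forall y, tube t.1 e x 1 y -> lift_at phi t.2 y].
have [t tP] : {t : C2 -> R * (C2 -> C2) & forall x, (exists u, good x u) -> good x (t x)}.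
  apply: (@choice _ _ (fun x t => (exists u, good x u) -> good x t)) => x.
  have [[u gu]|none] := pselect (exists u, good x u); first by exists u.
  by exists (0, fun=> 0).
exists (fun x => (t x).2 x) => x xU.
have /tP [r0 Fe LF] : exists u, good x u.
  by have [r [F [? ? ?]]] := tube_lift H hol xU y00 py0; exists (r, F).
set r := (t x).1 in r0 LF; set F := (t x).2 in Fe LF.
have tube_x : tube r e x 1 x.
  by exists 1; rewrite ?seg1 ?subrr ?nrm0 ?lexx ?ler01.
apply: lift_at_near (LF _ tube_x); apply/near_nrmP.
exists (r / 2); first by rewrite divr_gt0.
move=> x' hx'.
have gx' : good x' (r / 2, F).
  split=> //=; first by rewrite divr_gt0.
  move=> y [s hs hy]; apply: LF; exists s => //.
  apply: le_lt_trans (nrm_tri (seg e x' s) _ _) _.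
  suff : nrm (seg e x' s - seg e x s) <= nrm (x' - x) by move=> ?; lra.
  have -> : seg e x' s - seg e x s = toC s *: (x' - x).
    by rewrite /seg opprD addrACA subrr add0r -scalerBr opprB addrA subrK.
  have /andP[s0 s1] := hs.
  by rewrite nrmZ abs_toC ger0_norm // ler_piMl ?nrm_ge0.
have [r'0 F'e LF'] := tP x' (ex_intro _ _ gx').
have [_ _ LF2] := gx'.
apply: (@lift_unique _ _ _ _ _ H phi _ _ e); last by rewrite F'e Fe.
have on_tube (r1 : R) s : 0 < r1 -> 0 <= s <= 1 -> tube r1 e x' 1 (seg e x' s).
  by move=> r10 hs; exists s; rewrite ?subrr ?nrm0.
by move=> s hs; split; [apply: LF' | apply: LF2]; apply: on_tube; rewrite ?divr_gt0.
Qed.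

Lemma lift_unique2 phi F F' e y x :
  (forall s : R, 0 <= s <= 1 ->
     lift_at phi F (seg e y s) /\ lift_at phi F' (seg e y s)) ->
  (forall s : R, 0 <= s <= 1 ->
     lift_at phi F (seg y x s) /\ lift_at phi F' (seg y x s)) ->
  F e = F' e -> F x = F' x.
Proof. by move=> h1 h2 /(lift_unique H h1) /(lift_unique H h2). Qed.

Lemma reN (z : C) : re (- z) = - re z. Proof. by case: z. Qed.

(** A base point off the line w = 0, z real, in both coordinates: every other point off the line is
    reached in two segments, changing one coordinate at a time, while the fixed coordinate keeps the
    path off the line. *)
Let p0 : C2 := (iC R, 1).

Lemma im_iC : im (iC R) = 1. Proof. by []. Qed.
Lemma p0_neq0 : p0 != 0. Proof. by rewrite pair_neq0 oner_neq0 orbT. Qed.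

Lemma imC_neq0 (z : C) : im z != 0 -> z != 0.
Proof. by apply: contra_neq => ->. Qed.

(* The complement of a real line in C^2 is connected. *)
Lemma lift_unique_off_line phi F F' :
  (forall x, (x.2 != 0) || (im x.1 != 0) -> lift_at phi F x /\ lift_at phi F' x) ->
  F p0 = F' p0 -> forall x, (x.2 != 0) || (im x.1 != 0) -> F x = F' x.
Proof.
move=> L E [z w] /= /orP[w0|z0].
  apply: (@lift_unique2 phi _ _ p0 (iC R, w)) => // s hs; apply: L => /=.
    by rewrite subrr scaler0 addr0 im_iC oner_neq0 orbT.
  by rewrite subrr scaler0 addr0 w0.
apply: (@lift_unique2 phi _ _ p0 (z, 1)) => // s hs; apply: L => /=.
  by rewrite subrr scaler0 addr0 oner_neq0.
by rewrite subrr scaler0 addr0 z0 orbT.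
Qed.

Lemma global_lift_unique phi F F' :
  (forall x, x != 0 -> lift_at phi F x /\ lift_at phi F' x) ->
  F p0 = F' p0 -> forall x, x != 0 -> F x = F' x.
Proof.
move=> L E [z w]; rewrite pair_neq0 orbC => /orP[w0|z0].
  apply: (lift_unique_off_line (phi := phi)) => //= [x xA|]; last by rewrite w0.
  apply: L; case: x xA => a b /= /orP[b0|a0]; rewrite pair_neq0 ?b0 ?orbT //.
  by rewrite imC_neq0.
apply: (@lift_unique2 phi _ _ p0 (z, 1)) => // s hs; apply: L;
  rewrite segE pair_neq0.
  by rewrite subrr mulr0 addr0 oner_neq0 orbT.
by rewrite subrr mulr0 addr0 z0.
Qed.

(** The star of (1, 0) misses only the ray from 0 through (-1, 0), and that of (-1, 0) the opposite
    ray. After a deck correction at [p0] the two lifts agree off the line w = 0, z real, which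
    contains both rays. F takes the first where re z > 0 and the second elsewhere; the points of W
    with re z = 0 are off that line, so F is a lift near them too. *)
Lemma global_lift phi : holomorphic phi ->
  exists F, forall x, x != 0 -> lift_at phi F x.
Proof.
move=> hol.
have star (e : C2) : e != 0 -> exists G, forall x,
    (forall s : R, 0 <= s <= 1 -> seg e x s != 0) -> lift_at phi G x.
  move=> e0; apply: (@star_lift phi e (hrepr (phi (hproj f e)))) => //.
    exact: hrepr_neq0.
  by rewrite hreprK.
have [G1 L1] := star (1, 0) ltac:(by rewrite pair_neq0 oner_neq0).
have [G2' L2'] := star (-1, 0) ltac:(by rewrite pair_neq0 oppr_eq0 oner_neq0).
have seg_neq0 (a : R) x s : a != 0 -> (x.2 != 0) || (im x.1 != 0) ->
    seg (toC a, 0) x s != 0.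
  case: x => z w a0; rewrite segE pair_neq0 subr0 add0r mulf_eq0 negb_or.
  have [->|s0] /= := eqVneq s 0.
    by rewrite rmorph0 mul0r addr0 (inj_eq (@toC_inj R) a 0) a0.
  rewrite [toC s == 0](inj_eq (@toC_inj R) s 0) s0 /= => /orP[->|z0].
    by rewrite orbT.
  rewrite imC_neq0 // imD imM_toC imB; have -> : im (toC a) = 0 :> R by [].
  by rewrite add0r subr0 mulf_neq0.
have off1 x : (x.2 != 0) || (im x.1 != 0) -> lift_at phi G1 x.
  move=> hx; apply: L1 => s _; rewrite -[1](rmorph1 (@toC R)).
  by apply: seg_neq0; rewrite ?oner_neq0.
have off2' x : (x.2 != 0) || (im x.1 != 0) -> lift_at phi G2' x.
  move=> hx; apply: L2' => s _; rewrite -[-1](rmorphN1 (@toC R)).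
  by apply: seg_neq0; rewrite ?oppr_eq0 ?oner_neq0.
have off_p0 : (p0.2 != 0) || (im p0.1 != 0) by rewrite oner_neq0.
have [T dT TE] : exists2 T, deck f fi T & T (G2' p0) = G1 p0.
  have [[_ a1 a2] [_ b1 b2]] := (off1 _ off_p0, off2' _ off_p0).
  by apply: (deck_exists H) => //; rewrite -a2 -b2.
pose G2 := T \o G2'.
have agree x : (x.2 != 0) || (im x.1 != 0) -> G1 x = G2 x.
  apply: (lift_unique_off_line (phi := phi)); last by rewrite /G2 /= TE.
  by move=> y hy; split; [exact: off1 | apply/(lift_at_deck H dT)/off2'].
have pos1 x : 0 < re x.1 -> lift_at phi G1 x.
  case: x => z w /= z0; apply: L1 => s hs; rewrite segE pair_neq0.
  apply/orP; left; apply: contraTneq z0 => E.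
  have : re (1 + toC s * (z - 1)) = 0 by rewrite E.
  rewrite reD reM_toC reD; have [-> ->] : re (1 : C) = 1 /\ re (-1 : C) = -1 by [].
  move=> h; rewrite -leNgt; nra.
have neg2 x : re x.1 < 0 -> lift_at phi G2 x.
  case: x => z w /= z0; apply: (lift_at_deck H dT); apply: L2' => s hs.
  rewrite segE pair_neq0; apply/orP; left; apply: contraTneq z0 => E.
  have : re (-1 + toC s * (z - -1)) = 0 by rewrite E.
  rewrite opprK reD reM_toC reD.
  have [-> ->] : re (1 : C) = 1 /\ re (-1 : C) = -1 by [].
  move=> h; rewrite -leNgt; nra.
pose F x := if 0 < re x.1 then G1 x else G2 x.
have near_re (x : C2) (P : R -> Prop) :
    (exists2 e : R, 0 < e & forall u, `|u - re x.1| < e -> P u) ->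
    \forall y \near x, P (re y.1).
  move=> [e e0 He]; apply/near_nrmP; exists e => // y hy; apply: He.
  have -> : re y.1 - re x.1 = re (y - x).1 by rewrite /= reD reN.
  apply: le_lt_trans (abs_re _) _; apply: le_lt_trans hy.
  by rewrite /nrm lerDl abs_ge0.
exists F => x x0; have [z0|z0|z0] := ltgtP (re x.1) 0.
- apply: lift_at_near (neg2 _ z0).
  apply: filterS (near_re x (fun u => u < 0) _) => [y hy|].
    by rewrite /F ltNge ltW.
  by exists (- re x.1); [lra | move=> u; rewrite ltr_norml; lra].
- apply: lift_at_near (pos1 _ z0).
  apply: filterS (near_re x (fun u => 0 < u) _) => [y hy|]; first by rewrite /F hy.
  by exists (re x.1); [lra | move=> u; rewrite ltr_norml; lra].
have hx : (x.2 != 0) || (im x.1 != 0).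
  case: x x0 z0 => z w; rewrite pair_neq0 => /orP[z0 /= rz|->//].
  apply/orP; right; apply: contra_neq z0 => iz.
  by rewrite (reimE z) rz iz rmorph0 mulr0 addr0.
apply: lift_at_near (off1 _ hx).
suff off_near : \forall y \near x, (y.2 != 0) || (im y.1 != 0).
  by apply: filterS off_near => y hy; rewrite /F; case: ifP => // _; rewrite agree.
apply/near_nrmP; exists (abs x.2 + `|im x.1|).
  move: hx; rewrite -abs_gt0 -normr_gt0 => /orP[h|h].
    by rewrite ltr_pwDl.
  by rewrite ltr_wpDl ?abs_ge0.
move=> y hy; apply: contraTT hy; rewrite negb_or !negbK => /andP[/eqP y2 /eqP y1].
rewrite -leNgt /nrm /= y2 sub0r absN addrC lerD2r.
by apply: le_trans (abs_im _); rewrite imD imN y1 sub0r normrN.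
Qed.

Lemma lift_deck phi F F' :
  (forall x, x != 0 -> lift_at phi F x) -> (forall x, x != 0 -> lift_at phi F' x) ->
  exists2 T, deck f fi T & forall x, x != 0 -> F' x = T (F x).
Proof.
move=> LF LF'; have [[_ a1 a2] [_ b1 b2]] := (LF _ p0_neq0, LF' _ p0_neq0).
have [T dT TE] : exists2 T, deck f fi T & T (F p0) = F' p0.
  by apply: (deck_exists H) => //; rewrite -a2 -b2.
exists T => //; apply: (@global_lift_unique phi F' (T \o F)); last by rewrite /= TE.
move=> y y0; split; first exact: LF'.
exact: (lift_at_deck H dT (LF y y0)).
Qed.
End GlobalLift.

(** * Growth of lifts *)

Section Growth.
Variable R : realType.
Local Notation C := (Cplx R).
Local Notation C2 := (C2 R).

Lemma expr_lt_eps (x e : R) : 0 < x < 1 -> 0 < e -> exists n, x ^+ n < e.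
Proof.
move=> /andP[x0 x1] e0.
have : (fun n => x ^+ n) @ \oo --> (0 : R) by apply: cvg_expr; rewrite ger0_norm ?ltW.
move=> /cvgrPdist_lt /(_ _ e0) [n _ /(_ n (leqnn n))] /=.
by rewrite sub0r normrN ger0_norm ?exprn_ge0 ?(ltW x0) //; exists n.
Qed.

Definition box_pt (t : (R * R) * (R * R)) : C2 :=
  (toC t.1.1 + iC R * toC t.1.2, toC t.2.1 + iC R * toC t.2.2).

Lemma box_pt_near (t : (R * R) * (R * R)) (e : R) : 0 < e ->
  \forall t' \near t, nrm (box_pt t' - box_pt t) < e.
Proof.
move=> e0; apply/nbhs_ballP; exists (e / 4) => /=; first by rewrite divr_gt0.
move=> [[x1 x2] [x3 x4]]; case: t => [[y1 y2] [y3 y4]] /= [] [] /= + + [] /= + +.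
rewrite /ball /= ![`|y1 - _|]distrC ![`|y2 - _|]distrC ![`|y3 - _|]distrC.
rewrite ![`|y4 - _|]distrC => h1 h2 h3 h4.
have key (u1 u2 w1 w2 : R) : abs (toC u1 + iC R * toC u2 - (toC w1 + iC R * toC w2))
    <= `|u1 - w1| + `|u2 - w2|.
  have -> : toC u1 + iC R * toC u2 - (toC w1 + iC R * toC w2) =
      toC (u1 - w1) + iC R * toC (u2 - w2) by rewrite !rmorphB /=; ring.
  by rewrite (le_trans (absD _ _)) // absM abs_iC mul1r !abs_toC.
rewrite /nrm /box_pt /=.
have := key x1 x2 y1 y2; have := key x3 x4 y3 y4; lra.
Qed.

(** Local bounds become uniform by compactness of the box. The property [P M] may itself exempt
    points, as is needed for lifts, which are not controlled at 0. *)
Lemma box_bounded (P : R -> C2 -> Prop) (B : R) :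
  (forall x, exists2 d : R, 0 < d & exists M0 : R, forall M y, M0 <= M ->
     nrm (y - x) < d -> P M y) ->
  exists M, forall x, nrm x <= B -> P M x.
Proof.
move=> loc.
pose I : set R := `[- B, B]%classic; pose Q := (I `*` I) `*` (I `*` I).
have cI : compact I by exact: (@segment_compact R (- B) B).
have cQ : compact Q by apply: compact_setX; exact: compact_setX.
have := (compact_near_coveringP Q).1 cQ R +oo%R (fun M t => P M (box_pt t)).
move=> /(_ _) [t _|M0 [_ HM]].
  have [d d0 [M0 Hd]] := loc (box_pt t).
  exists ([set t' | nrm (box_pt t' - box_pt t) < d], [set M | M0 < M]).
    by split; [exact: box_pt_near | exists M0; split; rewrite ?num_real].
  by move=> [t' M] [/= h1 h2]; apply: Hd => //; exact: ltW.
exists (M0 + 1) => x hx.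
have := HM (M0 + 1) ltac:(by rewrite ltrDl) ((re x.1, im x.1), (re x.2, im x.2)).
rewrite /box_pt -!reimE -surjective_pairing; apply.
have [h1 h2] : abs x.1 <= B /\ abs x.2 <= B.
  by move: hx (abs_ge0 x.1) (abs_ge0 x.2); rewrite /nrm; lra.
have ok (u : R) : `|u| <= B -> I u by rewrite /I /= in_itv /= ler_norml.
by split; split => /=; apply: ok; [exact: le_trans (abs_re _) _ |
   exact: le_trans (abs_im _) _|exact: le_trans (abs_re _) _ |
   exact: le_trans (abs_im _) _].
Qed.

Variables (f fi : C2 -> C2) (v : C2 -> R) (lam Lam : R).
Hypothesis H : lyapunov f fi v lam.
Hypothesis v0 : v 0 = 0.
Hypothesis v_fi : forall x, v (fi x) <= Lam * v x.
Hypothesis Lam1 : 1 <= Lam.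
Hypothesis nrm_v : forall x, nrm x <= 1 + 2 * v x.

Lemma lyap_ge0 x : 0 <= v x.
Proof. by have [->|/(lyap_v_gt0 H)/ltW] := eqVneq x 0; rewrite ?v0. Qed.

Lemma deck_growth T : deck f fi T -> exists2 L : R, 1 <= L & forall x, v (T x) <= L * v x.
Proof.
have /andP[l0 l1] := lyap_lam H.
move=> [n [->|->]].
  exists 1 => // x; rewrite (le_trans (lyap_iter H n x)) // mul1r.
  by rewrite ler_piMl ?lyap_ge0 // exprn_ile1 // ltW.
exists (Lam ^+ n); first exact: exprn_ege1.
move=> x; elim: n => [|n IH]; first by rewrite mul1r.
rewrite /= (le_trans (v_fi _)) // exprS -mulrA ler_wpM2l //.
by rewrite (le_trans _ Lam1).
Qed.

Lemma deck_inv T : deck f fi T -> exists2 T', deck f fi T' & cancel T T'.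
Proof.
move=> [n [->|->]].
  by exists (iter n fi); [exists n; right | exact: (fiter_iterK H)].
exists (iter n f); first by exists n; left.
by elim: n => // n IH x; rewrite iterSr /= (lyap_fiK H) IH.
Qed.

(** Every forward orbit starting with v >= 1 meets the compact annulus 1 <= v <= Lam, since v (f x)
    >= v x / Lam. Going back one step, F x = T' (F (f x)) costs a factor L but gains lam^n from v (f
    x)^n. *)
Lemma lift_growth (F T : C2 -> C2) :
  (forall x, x != 0 -> differentiable F x) -> deck f fi T ->
  (forall x, x != 0 -> F (f x) = T (F x)) ->
  exists n (M : R), forall x, 1 <= v x -> v (F x) <= M * v x ^+ n.
Proof.
move=> dF dT FT; have [T' dT' TT'] := deck_inv dT.
have [L L1 HL] := deck_growth dT'.
have /andP[l0 l1] := lyap_lam H; have L0 : 0 < L by rewrite (lt_le_trans _ L1).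
have Lam0 : 0 < Lam by rewrite (lt_le_trans _ Lam1).
(* The degree n is chosen so that L lam^n < 1, which lets the same constant survive every step. *)
have [n Hn] : exists n, lam ^+ n < L^-1 by apply: expr_lt_eps; rewrite ?l0 // invr_gt0.
have [M HM] : exists M, forall x, nrm x <= 1 + 2 * Lam -> 1 <= v x -> v (F x) <= M.
  apply: (@box_bounded (fun M x => 1 <= v x -> v (F x) <= M)) => x.
  have [->|x0] := eqVneq x 0.
    have [d d0 Hd] := lyap_v_cont H 0 ltr01; exists d => //; exists 0.
    by move=> M y _ /Hd; rewrite v0 subr0 ltr_norml => /andP[_ h]; lra.
  have [e e0 He] := lyap_v_cont H (F x) ltr01.
  have [d d0 Hd] := differentiable_nrm_continuous (dF x x0) e0.
  exists d => //; exists (v (F x) + 1) => M y hM /Hd /He.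
  by rewrite ltr_norml => /andP[_ h] _; lra.
have annulus x : 1 <= v x <= Lam -> v (F x) <= M.
  by move=> /andP[h1 h2]; apply: HM => //; have := nrm_v x; lra.
exists n, `|M|.
have base x : 1 <= v x <= Lam -> v (F x) <= `|M| * v x ^+ n.
  move=> hx; rewrite (le_trans (annulus _ hx)) // (le_trans (ler_norm _)) //.
  by rewrite ler_peMr // exprn_ege1 //; case/andP: hx.
suff key k x : 1 <= v x -> lam ^+ k * v x <= Lam -> v (F x) <= `|M| * v x ^+ n.
  move=> x x1; have vx0 : 0 < v x by rewrite (lt_le_trans _ x1).
  have [k Hk] : exists k, lam ^+ k < Lam / v x by apply: expr_lt_eps; rewrite ?l0 // divr_gt0.
  by apply: (key k) => //; rewrite -ler_pdivlMr // ltW.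
elim: k x => [|k IH] x x1 hx; first by apply: base; rewrite x1 -[v x]mul1r.
have [xL|xL] := leP (v x) Lam; first by apply: base; rewrite x1.
have x0 : x != 0 by apply: contraTneq x1 => ->; rewrite v0 -ltNge.
have vx0 : 0 < v x by rewrite (lt_le_trans _ x1).
have fx1 : 1 <= v (f x).
  have := v_fi (f x); rewrite (lyap_fK H) => h.
  have : Lam * 1 < Lam * v (f x) by lra.
  by rewrite ltr_pM2l // => /ltW.
have : v (F (f x)) <= `|M| * v (f x) ^+ n.
  apply: IH => //; apply: le_trans hx; rewrite exprSr -mulrA.
  by rewrite ler_wpM2l ?exprn_ge0 ?(ltW l0) // (lyap_v_f H).
rewrite -[v (F x)]/(v (F x)) => h.
have -> : F x = T' (F (f x)) by rewrite FT // TT'.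
apply: le_trans (HL _) _.
have h2 : v (f x) ^+ n <= lam ^+ n * v x ^+ n.
  by rewrite -exprMn lerXn2r ?nnegrE ?lyap_ge0 ?mulr_ge0 ?(ltW l0) ?(ltW vx0) ?(lyap_v_f H).
have h3 : L * lam ^+ n <= 1 by rewrite mulrC -ler_pdivlMr // mul1r ltW.
apply: (@le_trans _ _ (L * (`|M| * (lam ^+ n * v x ^+ n)))).
  by rewrite ler_wpM2l ?(ltW L0) // (le_trans h) // ler_wpM2l.
rewrite [leLHS](_ : _ = L * lam ^+ n * (`|M| * v x ^+ n)); last by ring.
by rewrite ler_piMl // mulr_ge0 ?exprn_ge0 // ltW.
Qed.
End Growth.

(** * A Lyapunov function for triangular contractions *)

Section Triangular.
Variable R : realType.
Local Notation C := (Cplx R).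
Local Notation C2 := (C2 R).
Variables (a c d : C) (m : nat).
Hypotheses (ha : 0 < abs a < 1) (hd : 0 < abs d < 1) (m0 : (0 < m)%N).

Definition tri_inv : C2 -> C2 := tri a^-1 (- (a^-1 * c * d ^- m)) m d^-1.

Definition tri_rho : R := Num.max (abs a) (abs d).
(** Large enough that |c| <= K (1 - rho) / 2: the coupling term then uses up half of the gap 1 -
    rho, and the contraction factor is (1 + rho) / 2. *)
Definition tri_weight : R := 1 + 2 * abs c / (1 - tri_rho).
Definition tri_norm (x : C2) : R := abs x.1 + tri_weight * abs x.2 ^+ m.

Let a0 : a != 0. Proof. by rewrite -abs_gt0; case/andP: ha. Qed.
Let d0 : d != 0. Proof. by rewrite -abs_gt0; case/andP: hd. Qed.

Lemma tri_rho_lt1 : tri_rho < 1.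
Proof. by rewrite gt_max; case/andP: ha => _ ->; case/andP: hd. Qed.

Lemma tri_weight_ge1 : 1 <= tri_weight.
Proof.
by rewrite lerDl divr_ge0 ?mulr_ge0 ?abs_ge0 // subr_ge0 ltW // tri_rho_lt1.
Qed.

Lemma tri_invK : cancel (tri a c m d) tri_inv.
Proof.
case=> z w; rewrite /tri_inv /tri /=; congr pair; last by rewrite mulKf.
have dm : d ^+ m != 0 by rewrite expf_neq0.
by rewrite exprMn; move: (w ^+ m) (d ^+ m) dm => W D D0; field; rewrite D0 a0.
Qed.

Lemma tri_Kinv : cancel tri_inv (tri a c m d).
Proof.
case=> z w; rewrite /tri_inv /tri /=; congr pair; last by rewrite mulVKf.
have dm : d ^+ m != 0 by rewrite expf_neq0.
rewrite exprMn exprVn; move: (w ^+ m) (d ^+ m) dm => W D D0.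
by field; rewrite a0 D0.
Qed.

Lemma tri_map_neq0 (k l e : C) x : k != 0 -> e != 0 -> x != 0 -> tri k l m e x != 0.
Proof.
move=> k0 e0; apply: (tri_neq0 (g := fun w => l * w ^+ m)) => //.
by rewrite expr0n eqn0Ngt m0 mulr0.
Qed.

Lemma tri_norm_contracts x :
  tri_norm (tri a c m d x) <= (1 + tri_rho) / 2 * tri_norm x.
Proof.
case: x => z w; rewrite /tri_norm /tri /= absM exprMn.
have hrho := tri_rho_lt1; have hK := tri_weight_ge1.
have ra : abs a <= tri_rho by rewrite le_max lexx.
have rd : abs d ^+ m <= tri_rho.
  apply: le_trans (_ : abs d <= _); last by rewrite le_max lexx orbT.
  case/andP: hd => _ /ltW d1; case: m m0 => [//|n] _.
  by rewrite exprS ler_piMr ?abs_ge0 // exprn_ile1 // abs_ge0.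
have cK : abs c <= tri_weight * (1 - tri_rho) / 2.
  have r1 : 1 - tri_rho != 0 by rewrite gt_eqF // subr_gt0.
  rewrite [leRHS](_ : _ = (1 - tri_rho) / 2 + abs c); last by rewrite /tri_weight; field.
  by rewrite lerDr divr_ge0 // subr_ge0 ltW.
set W := abs w ^+ m; have W0 : 0 <= W by rewrite exprn_ge0 // abs_ge0.
have h1 : abs (a * z + c * w ^+ m) <= tri_rho * abs z + tri_weight * (1 - tri_rho) / 2 * W.
  rewrite (le_trans (absD _ _)) // !absM absX lerD // ler_wpM2r ?abs_ge0 //.
have h2 : tri_weight * (abs d ^+ m * W) <= tri_weight * (tri_rho * W).
  by rewrite ler_wpM2l ?(le_trans _ hK) // ler_wpM2r.
have h3 : tri_rho * abs z <= (1 + tri_rho) / 2 * abs z.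
  by rewrite ler_wpM2r ?abs_ge0 //; lra.
apply: le_trans (lerD h1 h2) _; rewrite [leRHS]mulrDr.
rewrite [leLHS](_ : _ = tri_rho * abs z + (1 + tri_rho) / 2 * (tri_weight * W)).
  by rewrite lerD2r.
by field.
Qed.

Definition tri_dil : R := (abs a)^-1 + abs (a^-1 * c * d ^- m) + (abs d ^+ m)^-1.

Lemma tri_dil_ge1 : 1 <= tri_dil.
Proof.
rewrite /tri_dil -addrA ler_wpDr ?addr_ge0 ?abs_ge0 ?invr_ge0 ?exprn_ge0 ?abs_ge0 //.
by case/andP: ha => h1 /ltW h2; rewrite invf_ge1.
Qed.

Lemma tri_norm_inv x : tri_norm (tri_inv x) <= tri_dil * tri_norm x.
Proof.
case: x => z w; rewrite /tri_norm /tri_inv /tri /= absM absV exprMn exprVn.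
have hK := tri_weight_ge1.
set W := abs w ^+ m; have W0 : 0 <= W by rewrite exprn_ge0 // abs_ge0.
have h1 : abs (a^-1 * z + - (a^-1 * c * d ^- m) * w ^+ m) <=
    (abs a)^-1 * abs z + abs (a^-1 * c * d ^- m) * (tri_weight * W).
  rewrite (le_trans (absD _ _)) // !absM absN absX !absV !absM !absV lerD //.
  by rewrite ler_wpM2l ?ler_peMl // !mulr_ge0 ?invr_ge0 ?abs_ge0.
apply: le_trans (lerD h1 (lexx _)) _.
set A := (abs a)^-1; set B := abs (_ * _); set D := (_ ^+ _)^-1.
have [A0 B0 D0] : [/\ 0 <= A, 0 <= B & 0 <= D].
  by split; rewrite ?invr_ge0 ?exprn_ge0 ?abs_ge0.
have KW : 0 <= tri_weight * W by rewrite mulr_ge0 // (le_trans _ hK).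
rewrite -subr_ge0 /tri_dil -/A -/B -/D.
rewrite [leRHS](_ : _ = (B + D) * abs z + A * (tri_weight * W)); last by ring.
by rewrite addr_ge0 // mulr_ge0 ?addr_ge0 ?abs_ge0.
Qed.

Lemma tri_norm0 : tri_norm 0 = 0.
Proof. by rewrite /tri_norm /= abs0 add0r expr0n eqn0Ngt m0 mulr0. Qed.

Lemma abs1_tri_norm x : abs x.1 <= tri_norm x.
Proof.
rewrite /tri_norm lerDl mulr_ge0 ?exprn_ge0 ?abs_ge0 //.
exact: le_trans tri_weight_ge1.
Qed.

Lemma expr_tri_norm x : abs x.2 ^+ m <= tri_norm x.
Proof.
apply: (@le_trans _ _ (tri_weight * abs x.2 ^+ m)); last by rewrite lerDr abs_ge0.
by rewrite ler_peMl ?exprn_ge0 ?abs_ge0 // tri_weight_ge1.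
Qed.

Lemma abs2_tri_norm x : abs x.2 <= 1 + tri_norm x.
Proof.
have [h|/ltW h] := leP (abs x.2) 1.
  by rewrite (le_trans h) // lerDl (le_trans (abs_ge0 _) (abs1_tri_norm x)).
rewrite (le_trans _ (_ : abs x.2 ^+ m <= _)) //.
  by case: m m0 => [//|n] _; rewrite exprS ler_peMr ?abs_ge0 // exprn_ege1.
by rewrite (le_trans (expr_tri_norm x)) // lerDr.
Qed.

Lemma nrm_tri_norm x : nrm x <= 1 + 2 * tri_norm x.
Proof. by have := abs1_tri_norm x; have := abs2_tri_norm x; rewrite /nrm; lra. Qed.

Lemma tri_lyapunov :
  lyapunov (tri a c m d) tri_inv tri_norm ((1 + tri_rho) / 2).
Proof.
have K0 : 0 < tri_weight by rewrite (lt_le_trans _ tri_weight_ge1).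
split.
- exact: tri_invK.
- exact: tri_Kinv.
- by move=> x; exact: tri_map_neq0.
- by move=> x; apply: tri_map_neq0; rewrite ?invr_eq0.
- by move=> x; exact: differentiable_tri.
- by move=> x; exact: differentiable_tri.
- move=> [z w]; rewrite pair_neq0 /tri_norm /= => /orP[z0|w0].
    by rewrite ltr_wpDr ?abs_gt0 // mulr_ge0 ?exprn_ge0 ?abs_ge0 // ltW.
  by rewrite ltr_wpDl ?abs_ge0 // mulr_gt0 // exprn_gt0 // abs_gt0.
- move=> x e e0.
  (* The map sending (z, w) to (K w^m, 0) is a [tri], so the continuity of K w^m comes from
     [differentiable_tri]. *)
  have cg := differentiable_nrm_continuous (differentiable_tri 0 (toC tri_weight) m 0 x).
  have [r r0 Hr] := cg (e / 2) ltac:(by rewrite divr_gt0).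
  exists (Num.min r (e / 2)); first by rewrite lt_min r0 divr_gt0.
  move=> y; rewrite lt_min => /andP[/Hr h1 h2].
  have h3 : abs (toC tri_weight * y.2 ^+ m - toC tri_weight * x.2 ^+ m) < e / 2.
    apply: le_lt_trans h1; rewrite /tri /nrm /= !mul0r !add0r oppr0 abs0 addr0.
    by [].
  have h4 : abs (y.1 - x.1) < e / 2.
    by apply: le_lt_trans h2; rewrite /nrm lerDl abs_ge0.
  have key (u u' : C) : `|abs u - abs u'| <= abs (u - u').
    by have := abs_triB u u'; have := abs_triB u' u; rewrite abs_distC ler_norml; lra.
  have E t : tri_weight * abs t ^+ m = abs (toC tri_weight * t ^+ m).
    by rewrite absM abs_toC absX gtr0_norm.
  rewrite /tri_norm !E opprD addrACA; apply: le_lt_trans (ler_normD _ _) _.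
  have := key y.1 x.1; have := key (toC tri_weight * y.2 ^+ m) (toC tri_weight * x.2 ^+ m).
  lra.
- by have := tri_rho_lt1; have : abs a <= tri_rho; [rewrite le_max lexx | case/andP: ha; lra].
- exact: tri_norm_contracts.
Qed.
End Triangular.

(** * Bivariate polynomials *)

Section BivariatePolynomials.
Variable K : numFieldType.
Implicit Types (P Q : {poly K}) (B : {poly {poly K}}) (u : K * K -> K).

Definition beval B (z w : K) : K := B.[z%:P].[w].

Lemma poly_eq0_off0 P : (forall z, z != 0 -> P.[z] = 0) -> P = 0.
Proof.
move=> P0; apply: (@roots_geq_poly_eq0 _ _ [seq k.+1%:R | k <- iota 0 (size P)]).
- by apply/allP => _ /mapP [k _ ->]; rewrite /root P0 // pnatr_eq0.
- rewrite map_inj_uniq ?iota_uniq // => j k /eqP; rewrite eqr_nat eqSS.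
  by move/eqP.
by rewrite size_map size_iota.
Qed.

Lemma bevalE B z w : beval B z w = (map_poly (horner_eval w) B).[z].
Proof.
by rewrite -[z in RHS](hornerC z w) -[z%:P.[w]]/(horner_eval w z%:P) horner_map.
Qed.

(** Lagrange interpolation in z at the nodes 1, ..., n + 1. The nodes are nonzero, so by the second
    hypothesis the interpolated values are polynomials in w. *)
Lemma separately_polynomial (u : K -> K -> K) (n : nat) :
  (forall w, w != 0 -> exists2 P : {poly K}, (size P <= n)%N & forall z, u z w = P.[z]) ->
  (forall z, z != 0 -> exists Q : {poly K}, forall w, u z w = Q.[w]) ->
  exists B, forall z w, (z != 0) || (w != 0) -> u z w = beval B z w.
Proof.
move=> uz uw; pose x (k : nat) : K := k.+1%:R.
have x0 k : x k != 0 by rewrite pnatr_eq0.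
have xI : injective x by move=> j k /eqP; rewrite eqr_nat eqSS => /eqP.
have {uz} uz w : w != 0 -> exists2 P : {poly K}, (size P <= n.+1)%N & forall z, u z w = P.[z].
  by move=> /uz [P sP PE]; exists P => //; exact: leqW.
have [Q QE] : {Q : nat -> {poly K} & forall k w, u (x k) w = (Q k).[w]}.
  by apply: (@choice _ _ (fun k Q => forall w, u (x k) w = Q.[w])) => k; exact: uw.
pose L (i : 'I_n.+1) : {poly K} := (lagrange n.+1 x)`_i.
pose B := \sum_(i < n.+1) (Q i)%:P * map_poly polyC (L i).
have BE z w : beval B z w = \sum_(i < n.+1) (Q i).[w] * (L i).[z].
  rewrite /beval /B horner_sum horner_sum; apply: eq_bigr => i _.
  rewrite hornerM hornerC hornerM; congr (_ * _).
  by rewrite horner_map hornerC.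
have on_w z w : w != 0 -> u z w = beval B z w.
  move=> /uz [P sP PE]; rewrite PE {1}(lagrange_gen (ltn0Sn n) xI sP) BE horner_sum.
  apply: eq_bigr => i _; rewrite hornerM hornerC -PE QE; congr (_ * _).
  by rewrite /L nth_lagrange.
(* Interpolation does not reach w = 0; there, for fixed z <> 0, both sides are polynomials in w that
   agree for w <> 0. *)
exists B => z w; have [->|w0 _] := eqVneq w 0; last exact: on_w.
rewrite orbF => z0; have [P PE] := uw z z0.
rewrite PE /beval; congr (_.[_]); apply/eqP; rewrite -subr_eq0; apply/eqP.
by apply: poly_eq0_off0 => t t0; rewrite hornerD hornerN -PE on_w // subrr.
Qed.

Lemma coef_comp_affine P (a b : K) i : (size P <= i.+1)%N ->
  (P \Po (a *: 'X + b%:P))`_i = P`_i * a ^+ i.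
Proof.
move=> sP; set l := _ + _.
have sl : (size l <= 2)%N.
  rewrite (leq_trans (size_polyD _ _)) // geq_max.
  rewrite (leq_trans (size_scale_leq _ _)) ?size_polyX //.
  by rewrite (leq_trans (size_polyC_leq1 _)).
have szX k : (size (l ^+ k) <= k.+1)%N.
  rewrite (leq_trans (size_poly_exp_leq _ _)) // ltnS -[leqRHS]mul1n leq_mul2r.
  by rewrite -ltnS (leq_trans (leqSpred _)) ?orbT //; case: (size l) sl => // -[|[]].
have lead k : (l ^+ k)`_k = a ^+ k.
  elim: k => [|k IH]; first by rewrite coef1.
  rewrite exprS mulrDl coefD -scalerAl coefZ coefXM /= IH mul_polyC coefZ.
  by rewrite (nth_default _ (szX k)) mulr0 addr0 exprS.
rewrite coef_comp_poly.
have [lt|ge] := ltnP i (size P); last first.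
  rewrite (nth_default _ ge) mul0r big1 // => j _.
  by rewrite [_`_i]nth_default ?mulr0 // (leq_trans (szX j)) // (leq_trans (ltn_ord j)).
rewrite (bigD1 (Ordinal lt)) //= lead big1 ?addr0 // => j jP.
rewrite [_`_i]nth_default ?mulr0 // (leq_trans (szX j)) // ltn_neqAle.
by rewrite (_ : (j != i :> nat)) // -ltnS (leq_trans (ltn_ord j)).
Qed.

(** The translation by c w^m does not touch the leading coefficient p in z, so p(d w) a^i = k p(w);
    the leading coefficient of p in turn gives a^i d^j = k. *)
Lemma beval_eigenvalue B (a c d k : K) m : B != 0 ->
  (forall z w, w != 0 -> beval B (a * z + c * w ^+ m) (d * w) = k * beval B z w) ->
  exists i j, k = a ^+ i * d ^+ j.
Proof.
move=> B0 H; pose i := (size B).-1; pose p := lead_coef B.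
have sB : size B = i.+1 by rewrite -polySpred.
have p0 : p != 0 by rewrite lead_coef_eq0.
have pE w : w != 0 -> p.[d * w] * a ^+ i = k * p.[w].
  move=> w0.
  have E : map_poly (horner_eval (d * w)) B \Po (a *: 'X + (c * w ^+ m)%:P) =
      k *: map_poly (horner_eval w) B.
    apply/eqP; rewrite -subr_eq0; apply/eqP; apply: poly_eq0_off0 => z _.
    rewrite hornerD hornerN horner_comp !hornerE -!bevalE.
    by rewrite H // subrr.
  move/polyP: E => /(_ i); rewrite coef_comp_affine; last first.
    by rewrite -sB size_poly.
  by rewrite coefZ !coef_map.
have E : a ^+ i *: (p \Po (d *: 'X + 0%:P)) = k *: p.
  apply/eqP; rewrite -subr_eq0; apply/eqP; apply: poly_eq0_off0 => w w0.
  by rewrite hornerD hornerN !hornerZ horner_comp !hornerE -pE // mulrC subrr.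
exists i, (size p).-1.
move/polyP: E => /(_ (size p).-1); rewrite !coefZ coef_comp_affine -?polySpred //.
by rewrite mulrCA mulrC => /mulIf -> //; rewrite -lead_coefE lead_coef_eq0.
Qed.

Definition bipoly u := exists B, forall x, u x = beval B x.1 x.2.

Lemma bipoly_cst k : bipoly (fun=> k).
Proof. by exists k%:P%:P => x; rewrite /beval !hornerC. Qed.
Lemma bipoly_fst : bipoly fst.
Proof. by exists 'X => x; rewrite /beval hornerX hornerC. Qed.
Lemma bipoly_snd : bipoly snd.
Proof. by exists ('X%:P) => x; rewrite /beval hornerC hornerX. Qed.
Lemma bipolyD u u' : bipoly u -> bipoly u' -> bipoly (fun x => u x + u' x).
Proof.
by move=> [B BE] [B' B'E]; exists (B + B') => x; rewrite /beval !hornerD BE B'E.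
Qed.
Lemma bipolyM u u' : bipoly u -> bipoly u' -> bipoly (fun x => u x * u' x).
Proof.
by move=> [B BE] [B' B'E]; exists (B * B') => x; rewrite /beval !hornerM BE B'E.
Qed.
Lemma bipolyZ k u : bipoly u -> bipoly (fun x => k * u x).
Proof. exact: (bipolyM (bipoly_cst k)). Qed.
Lemma bipolyX u n : bipoly u -> bipoly (fun x => u x ^+ n).
Proof.
move=> bu; elim: n => [|n IH]; first exact: bipoly_cst.
by have [B BE] := bipolyM bu IH; exists B => x; rewrite exprS BE.
Qed.
Lemma bipoly_sum n (u : 'I_n -> K * K -> K) : (forall i, bipoly (u i)) ->
  bipoly (fun x => \sum_(i < n) u i x).
Proof.
elim: n u => [|n IH] u bu.
  by have [B BE] := bipoly_cst 0; exists B => x; rewrite big_ord0 -BE.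
have [B BE] := bipolyD (IH _ (fun i => bu (widen_ord (leqnSn n) i))) (bu ord_max).
by exists B => x; rewrite big_ord_recr -BE.
Qed.

Lemma bipoly_comp u (p q : K * K -> K) : bipoly u -> bipoly p -> bipoly q ->
  bipoly (fun x => u (p x, q x)).
Proof.
move=> [B BE] bp bq.
have [B' B'E] : bipoly (fun x => \sum_(i < size B)
    (\sum_(j < size B`_i) B`_i`_j * q x ^+ j) * p x ^+ i).
  apply: bipoly_sum => i; apply: bipolyM; last exact: bipolyX.
  by apply: bipoly_sum => j; apply/bipolyZ/bipolyX.
exists B' => x; rewrite -B'E BE /= /beval [B.[_]]horner_coef horner_sum.
apply: eq_bigr => i _; rewrite hornerM horner_coef; congr (_ * _).
by rewrite -polyC_exp hornerC.
Qed.

Lemma bipoly_eigen_eq0 u (a c d k : K) m : bipoly u ->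
  (forall i j, k <> a ^+ i * d ^+ j) ->
  (forall x, x != 0 -> u (a * x.1 + c * x.2 ^+ m, d * x.2) = k * u x) ->
  forall x, u x = 0.
Proof.
move=> [B BE] kad H x; rewrite BE.
have [->|B0] := eqVneq B 0; first by rewrite /beval !horner0.
have [z w w0|i [j]] := @beval_eigenvalue B a c d k m B0; last by move/kad.
have := H (z, w); rewrite !BE; apply.
by rewrite -pair_eqE negb_and /= w0 orbT.
Qed.

Lemma bipoly_bounded u : bipoly u ->
  exists M : K, forall z w, `|z| <= 1 -> `|w| <= 1 -> `|u (z, w)| <= M.
Proof.
move=> [B BE].
have polyb P : exists2 M : K, 0 <= M & forall w, `|w| <= 1 -> `|P.[w]| <= M.
  elim/poly_ind: P => [|P b [M M0 HM]].
    by exists 0 => // w _; rewrite horner0 normr0.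
  exists (M + `|b|) => [|w w1]; first by rewrite addr_ge0.
  rewrite !hornerE (le_trans (ler_normD _ _)) // lerD2r normrM -[M]mulr1.
  by rewrite ler_pM ?HM.
have [M HM] : exists M : K, forall z w, `|z| <= 1 -> `|w| <= 1 -> `|beval B z w| <= M.
  elim/poly_ind: B {BE u} => [|B P [M HM]].
    by exists 0 => z w _ _; rewrite /beval !horner0 normr0.
  have [M' M'0 HM'] := polyb P; exists (M + M') => z w z1 w1.
  rewrite /beval !hornerE (le_trans (ler_normD _ _)) // lerD ?HM' // normrM.
  by rewrite -[M]mulr1 ler_pM // HM.
by exists M => z w z1 w1; rewrite BE HM.
Qed.

Lemma expr_eq_self (k : K) n : 0 < `|k| < 1 -> k ^+ n = k -> n = 1%N.
Proof.
move=> /andP[k0 k1]; case: n => [|[|n]] // /(congr1 (fun t => `|t|)).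
  by rewrite normr1 => E; rewrite -E ltxx in k1.
rewrite normrX exprS -[RHS]mulr1 => /mulfI E.
have : `|k| ^+ n.+1 < 1 by rewrite exprn_ilt1.
by rewrite E ?ltxx // gt_eqF.
Qed.

(** The coefficient of z^i w^j is multiplied by k^(i+j), and k^(i+j) = k only if i + j = 1. *)
Lemma bipoly_homogeneous1 u (k : K) : bipoly u -> 0 < `|k| < 1 ->
  (forall x, x != 0 -> u (k * x.1, k * x.2) = k * u x) ->
  exists p q, forall x, u x = p * x.1 + q * x.2.
Proof.
move=> [B BE] k01 H.
have scal (P : {poly K}) i : (P \Po (k *: 'X))`_i = k ^+ i * P`_i.
  rewrite coef_comp_poly; have [lt|ge] := ltnP i (size P).
    rewrite (bigD1 (Ordinal lt)) //= exprZn coefZ coefXn eqxx mulr1 mulrC big1 ?addr0 //.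
    move=> j; rewrite -val_eqE /= => ji.
    by rewrite exprZn coefZ coefXn eq_sym (negPf ji) !mulr0.
  rewrite (nth_default _ ge) mulr0 big1 // => j _.
  by rewrite exprZn coefZ coefXn gtn_eqF ?mulr0 // (leq_trans (ltn_ord j)).
have coefB i j : k ^+ (i + j) * B`_i`_j = k * B`_i`_j.
  have E w : w != 0 -> k ^+ i * (B`_i).[k * w] = k * (B`_i).[w].
    move=> w0.
    have /polyP /(_ i) : map_poly (horner_eval (k * w)) B \Po (k *: 'X) =
        k *: map_poly (horner_eval w) B.
      apply/eqP; rewrite -subr_eq0; apply/eqP; apply: poly_eq0_off0 => z _.
      rewrite hornerD hornerN horner_comp !hornerE -!bevalE.
      have := H (z, w); rewrite !BE => -> //=; first by rewrite subrr.
      by rewrite -pair_eqE negb_and /= w0 orbT.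
    by rewrite scal coefZ !coef_map.
  have /polyP /(_ j) : k ^+ i *: (B`_i \Po (k *: 'X)) = k *: B`_i.
    apply/eqP; rewrite -subr_eq0; apply/eqP; apply: poly_eq0_off0 => w w0.
    by rewrite hornerD hornerN !hornerZ horner_comp !hornerE E // subrr.
  by rewrite !coefZ scal mulrA exprD.
have Bij i j : (i + j)%N <> 1%N -> B`_i`_j = 0.
  move=> ij; apply/eqP; apply/negP => /negP B0.
  by apply/ij/(expr_eq_self k01)/(mulIf B0)/coefB.
exists B`_1`_0, B`_0`_1 => x; rewrite BE.
have E : B = (B`_1`_0)%:P%:P * 'X + ((B`_0`_1)%:P * 'X)%:P.
  apply/polyP => i; apply/polyP => j.
  rewrite coefD coefMX coefC coefD.
  case: i => [|[|i]] /=.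
  - rewrite coef0 add0r coefC /= coefMX coefC.
    by case: j => [|[|j]] //=; exact: Bij.
  - by rewrite !coefC /= if_same addr0; case: j => [|j] //=; exact: Bij.
  - by rewrite coef0 add0r coefC /= coef0; exact: Bij.
by rewrite {1}E /beval !hornerE.
Qed.
End BivariatePolynomials.

(** * Lifts of automorphisms *)

Section AutomorphismLift.
Variable R : realType.
Local Notation C := (Cplx R).
Local Notation C2 := (C2 R).
Variables (a c d : C) (m : nat).
Hypotheses (ha : 0 < abs a < 1) (hd : 0 < abs d < 1) (m0 : (0 < m)%N).

Local Notation f := (tri a c m d).
Local Notation fi := (tri_inv a c d m).
Local Notation v := (tri_norm a c d m).
Local Notation K := (tri_weight a c d).
Local Notation lam := ((1 + tri_rho a d) / 2).

Let HL := tri_lyapunov c ha hd m0.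
Let K1 : 1 <= K := tri_weight_ge1 c ha hd.
Let K0 : 0 < K. Proof. exact: lt_le_trans K1. Qed.

(** A line w = const <> 0 lies in W, so u is entire on it, and v grows like |z| there, which bounds
    the degree by n; on z = const <> 0 the function v grows like |w|^m, and the growth exponent is m
    n. *)
Lemma growth_bipoly (u : C2 -> C) (n : nat) (M : R) : 0 <= M ->
  (forall x, x != 0 -> differentiable u x) ->
  (forall x, 1 <= v x -> abs (u x) <= 1 + M * v x ^+ n) ->
  exists2 U : C2 -> C, bipoly U & forall x, x != 0 -> u x = U x.
Proof.
move=> M0 du gu.
have diff1 w z : w != 0 -> cdiff (fun z => u (z, w)) z.
  move=> w0; apply: differentiable_cdiff.
  apply: (@differentiable_comp C C C2 C (fun z => (z, w)) u); last first.
    by apply: du; rewrite pair_neq0 w0 orbT.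
  by apply: differentiable_pair => //; exact: differentiable_cst.
have diff2 z w : z != 0 -> cdiff (fun w => u (z, w)) w.
  move=> z0; apply: differentiable_cdiff.
  apply: (@differentiable_comp C C C2 C (fun w => (z, w)) u); last first.
    by apply: du; rewrite pair_neq0 z0.
  by apply: differentiable_pair => //; exact: differentiable_cst.
have poly1 w : w != 0 ->
    exists2 P : {poly C}, (size P <= n.+1)%N & forall z, u (z, w) = P.[z].
  move=> w0; apply: (@polynomial_growth_polynomial R n _ (1 + M * 2 ^+ n)
    (1 + K * abs w ^+ m)) => [z|z hz]; first exact: diff1.
  have W0 : 0 <= K * abs w ^+ m by rewrite mulr_ge0 ?exprn_ge0 ?abs_ge0 // ltW.
  have vE : v (z, w) = abs z + K * abs w ^+ m by [].
  have z1 : 1 <= abs z by lra.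
  have v1 : 1 <= v (z, w) by rewrite vE; lra.
  rewrite (le_trans (gu _ v1)) // mulrDl mul1r lerD ?exprn_ege1 //.
  rewrite -mulrA ler_wpM2l // -exprMn lerXn2r ?nnegrE ?mulr_ge0 ?abs_ge0 //; rewrite ?vE; lra.
have poly2 z : z != 0 -> exists Q : {poly C}, forall w, u (z, w) = Q.[w].
  move=> z0; have [||P _ PE] := @polynomial_growth_polynomial R (m * n)%N
      (fun w => u (z, w)) (1 + M * (1 + K) ^+ n) (1 + abs z); last by exists P.
    by move=> w; exact: diff2.
  move=> w hw; have vE : v (z, w) = abs z + K * abs w ^+ m by [].
  have z0' := abs_ge0 z.
  have w1 : 1 <= abs w by lra.
  have wm : abs w <= abs w ^+ m.
    by case: m m0 => [//|k] _; rewrite exprS ler_peMr ?abs_ge0 // exprn_ege1.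
  have Kw : abs w ^+ m <= K * abs w ^+ m by rewrite ler_peMl // exprn_ge0 ?abs_ge0.
  have v1 : 1 <= v (z, w) by rewrite vE; lra.
  have v2 : v (z, w) <= (1 + K) * abs w ^+ m by rewrite vE [leRHS]mulrDl mul1r lerD2r; lra.
  rewrite (le_trans (gu _ v1)) // mulrDl mul1r lerD ?exprn_ege1 //.
  rewrite -mulrA ler_wpM2l // exprM -exprMn lerXn2r ?nnegrE //; first lra.
  by rewrite (le_trans _ v2) // (le_trans _ v1).
have [B BE] := separately_polynomial poly1 poly2.
exists (fun x => beval B x.1 x.2); first by exists B.
by case=> z w; rewrite pair_neq0 => /BE.
Qed.

Lemma lift_bipoly (F T : C2 -> C2) :
  (forall x, x != 0 -> differentiable F x) -> deck f fi T ->
  (forall x, x != 0 -> F (f x) = T (F x)) ->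
  exists U1 U2 : C2 -> C, [/\ bipoly U1, bipoly U2 &
    forall x, x != 0 -> F x = (U1 x, U2 x)].
Proof.
move=> dF dT FT.
have [n [M HM]] := lift_growth HL (tri_norm0 a c d m0)
  (tri_norm_inv c m ha hd) (tri_dil_ge1 c d m ha) (nrm_tri_norm c ha hd m0) dF dT FT.
have v_ge0 x : 0 <= v x := lyap_ge0 HL (tri_norm0 a c d m0) x.
have M0 : 0 <= `|M| by [].
have HM' x : 1 <= v x -> v (F x) <= `|M| * v x ^+ n.
  by move=> /HM h; rewrite (le_trans h) // ler_wpM2r ?exprn_ge0 ?ler_norm.
have [|x x1|U1 bU1 E1] := @growth_bipoly (fun x => (F x).1) n `|M| M0.
- move=> x x0; apply: (differentiable_comp (dF x x0)); exact: differentiable_fst.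
- have := abs1_tri_norm c m ha hd (F x); have := HM' x x1; lra.
have [|x x1|U2 bU2 E2] := @growth_bipoly (fun x => (F x).2) n `|M| M0.
- move=> x x0; apply: (differentiable_comp (dF x x0)); exact: differentiable_snd.
- by rewrite (le_trans (abs2_tri_norm c ha hd m0 (F x))) // lerD2l HM'.
exists U1, U2; split=> // x x0; rewrite -E1 // -E2 //; exact: surjective_pairing.
Qed.

(** The identity is excluded by injectivity, as f has no fixed point in W. If T were a negative
    power of f, the values of F along the orbit of a point p would leave every bounded set while the
    orbit tends to 0, where the polynomial F is bounded. *)
Lemma deck_iter (F T : C2 -> C2) :
  (forall x, x != 0 -> differentiable F x) -> deck f fi T ->
  (forall x, x != 0 -> F (f x) = T (F x)) ->
  (forall x, x != 0 -> F x != 0) ->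
  (forall x y, x != 0 -> y != 0 -> F x = F y -> x = y) ->
  exists2 n, (0 < n)%N & T = iter n f.
Proof.
move=> dF dT FT F0 FI.
have [U1 [U2 [bU1 bU2 FU]]] := lift_bipoly dF dT FT.
have /andP[l0 l1] := lyap_lam HL.
pose p : C2 := (1, 0); have p0 : p != 0 by rewrite pair_neq0 oner_neq0.
have vp := lyap_v_gt0 HL p0.
have nofix x : x != 0 -> f x != x.
  move=> x0; apply/eqP => E; have := lyap_v_f HL x; rewrite E.
  by have := lyap_v_gt0 HL x0; nra.
have T_neq_id : F (f p) != F p.
  by apply: contraNneq (nofix p p0) => /FI -> //; exact: lyap_f_neq0 HL _ p0.
case: dT => n [TE|TE]; rewrite TE in FT *.
  by exists n => //; case: n FT {TE} => // /(_ p p0) /eqP; rewrite (negPf T_neq_id).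
case: n FT {TE} => [|n] FT.
  by have /eqP := FT p p0; rewrite (negPf T_neq_id).
exfalso.
have step j : v (F p) <= lam ^+ j * v (F (iter j f p)).
  elim: j => [|j IH]; first by rewrite mul1r.
  apply: le_trans IH _; rewrite exprSr -mulrA ler_wpM2l ?exprn_ge0 ?(ltW l0) //.
  have pj := iter_neq0 HL j p0.
  have -> : F (iter j f p) = iter n.+1 f (F (iter j.+1 f p)).
    rewrite /= FT //.
    have fK : cancel (iter n.+1 fi) (iter n.+1 f).
      by elim: (n.+1) => // k IHk y; rewrite iterSr /= (lyap_fiK HL) IHk.
    exact/esym/fK.
  apply: le_trans (lyap_iter HL _ _) _.
  rewrite exprS -mulrA ler_wpM2l ?(ltW l0) //.
  rewrite ler_piMl ?exprn_ile1 ?(ltW l0) ?(ltW l1) //.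
  by rewrite ltW // (lyap_v_gt0 HL) // F0 // (iter_neq0 HL j.+1 p0).
have [M1 HM1] := bipoly_bounded bU1; have [M2 HM2] := bipoly_bounded bU2.
pose B := abs M1 + K * abs M2 ^+ m.
have B0 : 0 <= B by rewrite addr_ge0 ?abs_ge0 // mulr_ge0 ?exprn_ge0 ?abs_ge0 // ltW.
have absM (u M : C) : `|u| <= M -> abs u <= abs M.
  by move=> uM; rewrite -le_toC -!normE (ger0_norm (le_trans _ uM)).
have bnd x : x != 0 -> v x <= 1 -> v (F x) <= B.
  case: x => z w x0 x1.
  have z1 : `|z| <= 1.
    rewrite normE -(rmorph1 (@toC R)) le_toC.
    exact: le_trans (abs1_tri_norm c m ha hd (z, w)) x1.
  have w1 : `|w| <= 1.
    rewrite normE -(rmorph1 (@toC R)) le_toC -(@ler_pXn2r _ m) ?nnegrE ?abs_ge0 //.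
    by rewrite expr1n (le_trans (expr_tri_norm c m ha hd (z, w)) x1).
  rewrite FU // /tri_norm /= lerD ?absM ?HM1 // ler_wpM2l ?(ltW K0) //.
  by rewrite lerXn2r ?nnegrE ?abs_ge0 // absM ?HM2.
(* Here j1 brings the orbit of p into v <= 1, where v after F is bounded by B; j2 then makes the
   resulting bound smaller than v (F p). *)
have [j1 Hj1] : exists j, lam ^+ j < (v p)^-1 by apply: expr_lt_eps; rewrite ?l0 ?l1 ?invr_gt0.
have vF := lyap_v_gt0 HL (F0 p p0).
have [j2 Hj2] : exists j, lam ^+ j < v (F p) / (B + 1).
  by apply: expr_lt_eps; rewrite ?l0 ?l1 ?divr_gt0 // ltr_wpDl.
have := step (j1 + j2)%N; apply/negP; rewrite -ltNge.
have pj := iter_neq0 HL (j1 + j2)%N p0.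
have h1 : v (iter (j1 + j2) f p) <= 1.
  apply: le_trans (lyap_iter HL _ _) _; rewrite -ler_pdivlMr // mul1r ltW //.
  apply: le_lt_trans Hj1; rewrite exprD ler_piMr ?exprn_ge0 ?(ltW l0) //.
  by rewrite exprn_ile1 ?(ltW l0) ?(ltW l1).
apply: (@le_lt_trans _ _ (lam ^+ j2 * (B + 1))).
  apply: ler_pM => //; rewrite ?exprn_ge0 ?(ltW l0) //.
  - by rewrite ltW // (lyap_v_gt0 HL) // F0.
  - by rewrite addnC exprD ler_piMr ?exprn_ge0 ?(ltW l0) // exprn_ile1 ?(ltW l0) ?(ltW l1).
  - by rewrite (le_trans (bnd _ pj h1)) // lerDl.
by rewrite -ltr_pdivlMr // ltr_wpDl.
Qed.

Theorem automorphism_lift (phi : Hopf f -> Hopf f) : biholomorphic phi ->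
  exists U1 U2 : C2 -> C, [/\ bipoly U1, bipoly U2,
    forall x, x != 0 -> (U1 x, U2 x) != 0 :> C2,
    forall x, x != 0 -> phi (hproj f x) = hproj f (U1 x, U2 x) &
    forall x, x != 0 -> (U1 (f x), U2 (f x)) = f (U1 x, U2 x)].
Proof.
move=> [hphi [psi [hpsi phiK psiK]]].
have [F LF] := global_lift HL hphi; have [G LG] := global_lift HL hpsi.
have f0 (x : C2) : x != 0 -> f x != 0 by exact: lyap_f_neq0 HL _.
have lift_f (ph : Hopf f -> Hopf f) Q : (forall x, x != 0 -> lift_at ph Q x) ->
    exists2 T, deck f fi T & forall x, x != 0 -> Q (f x) = T (Q x).
  move=> LQ; apply: (@lift_deck _ _ _ _ _ HL ph Q (Q \o f) LQ) => x x0.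
  have [dQ Q0 pQ] := LQ _ (f0 x x0); split; last first.
  - by rewrite -[hproj f x](hproj_iter HL 1 x0).
  - exact: Q0.
  exact: (differentiable_comp (lyap_df HL x) dQ).
have lift_inj (ph ps : Hopf f -> Hopf f) P Q : cancel ph ps ->
    (forall x, x != 0 -> lift_at ph P x) -> (forall x, x != 0 -> lift_at ps Q x) ->
    exists2 S, deck f fi S & forall x, x != 0 -> Q (P x) = S x.
  move=> phK LP LQ.
  apply: (@lift_deck _ _ _ _ _ HL id id (Q \o P)) => x x0.
    by split; [exact: (@ex_diff _ _ _ _ _ _ _ (is_diff_id x)) | exact: x0 |].
  have [dP P0 pP] := LP x x0; have [dQ Q0 pQ] := LQ _ P0; split; last first.
  - by rewrite -pQ -pP phK.
  - exact: Q0.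
  exact: (differentiable_comp dP dQ).
have [S dS GF] := lift_inj _ _ _ _ phiK LF LG.
have [S' dS' FG] := lift_inj _ _ _ _ psiK LG LF.
have inj_of (P Q S0 : C2 -> C2) : deck f fi S0 ->
    (forall x, x != 0 -> Q (P x) = S0 x) ->
    forall x y, x != 0 -> y != 0 -> P x = P y -> x = y.
  move=> /(deck_inv HL) [S1 _ S0K] QP x y x0 y0 E.
  by apply: (can_inj S0K); rewrite -!QP // E.
have [TF dTF FT] := lift_f _ _ LF; have [TG dTG GT] := lift_f _ _ LG.
have dF x : x != 0 -> differentiable F x by move=> /LF [].
have dG x : x != 0 -> differentiable G x by move=> /LG [].
have F0 x : x != 0 -> F x != 0 by move=> /LF [].
have G0 x : x != 0 -> G x != 0 by move=> /LG [].
have [n n0 TFE] := deck_iter dF dTF FT F0 (inj_of _ _ _ dS GF).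
have [l l0 TGE] := deck_iter dG dTG GT G0 (inj_of _ _ _ dS' FG).
have [U1 [U2 [bU1 bU2 FU]]] := lift_bipoly dF dTF FT.
(* G after F is a deck transformation S, which commutes with f, while F and G turn f into f^n and
   f^l. Hence f (S p) = f^(n l) (S p), and n l = 1 since f has no periodic point in W. *)
have n1 : n = 1%N.
  pose p : C2 := (1, 0); have p0 : p != 0 by rewrite pair_neq0 oner_neq0.
  have Giter k x : x != 0 -> G (iter k f x) = iter (k * l) f (G x).
    move=> x0; elim: k => // k IH.
    by rewrite /= GT ?(iter_neq0 HL) // TGE IH -iterD mulSn.
  have Sf x : S (f x) = f (S x).
    case: dS => k [->|->]; first by rewrite -iterSr.
    apply: (can_inj (lyap_fiK HL)); rewrite (lyap_fK HL).
    by elim: k x => [|k IH] x; rewrite /= ?(lyap_fK HL) // IH.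
  have E : f (S p) = iter (n * l) f (S p).
    by rewrite -Sf -GF ?f0 // FT // TFE Giter ?F0 // GF.
  have Sp0 : S p != 0 by rewrite -GF // G0 // F0.
  have /eqP : (n * l)%N = 1%N.
    case: (n * l)%N (muln_gt0 n l) E => [|[|k]] //; rewrite ?n0 ?l0 // => _.
    rewrite iterSr => E; exfalso; have /andP[r0 r1] := lyap_lam HL.
    have := lyap_iter HL k.+1 (f (S p)); rewrite -E leNgt => /negP; apply.
    rewrite gtr_pMl ?exprn_ilt1 ?(ltW r0) //.
    exact/(lyap_v_gt0 HL)/f0.
  by rewrite muln_eq1 => /andP[/eqP].
exists U1, U2; split=> // x x0.
- by rewrite -FU // F0.
- by rewrite -FU //; have [] := LF x x0.
- by rewrite -!FU ?f0 // FT // TFE n1.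
Qed.
End AutomorphismLift.

(** * Even and odd structures *)

Section SquareRoot.
Variable R : realType.
Local Notation C := (Cplx R).
Local Notation C2 := (C2 R).

Lemma norm_abs_lt1 (a : C) : 0 < `|a| < 1 -> 0 < abs a < 1.
Proof. by rewrite normE -(rmorph0 (@toC R)) -(rmorph1 (@toC R)) !lt_toC. Qed.

Definition lifts (f : C2 -> C2) (phi : Hopf f -> Hopf f) (U1 U2 : C2 -> C) :=
  [/\ forall x, x != 0 -> (U1 x, U2 x) != 0 :> C2,
      forall x, x != 0 -> phi (hproj f x) = hproj f (U1 x, U2 x) &
      forall x, x != 0 -> (U1 (f x), U2 (f x)) = f (U1 x, U2 x)].

Lemma contraction_tri (f : hopf_contraction R) : admissible f ->
  exists a c m d, [/\ cmap f = tri a c m d, 0 < abs a < 1, 0 < abs d < 1, (0 < m)%N &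
    exists a' c' d', half_iterate f = tri a' c' m d' /\
      (positive_diag f -> 0 < a' /\ 0 < d')].
Proof.
have pw (x : C) n : (0 < n)%N -> 0 < abs x < 1 -> 0 < abs (x ^+ n) < 1.
  move=> n0 /andP[x0 x1]; rewrite absX exprn_gt0 // exprn_ilt1 ?ltW //.
  by rewrite -lt0n.
case: f => [al|r de|r de|al|al de] /=.
- move=> /norm_abs_lt1 h; exists al, 0, 1%N, al; split=> //.
    by apply/funext => x; rewrite /tri mul0r addr0.
  exists (sqrtC al), 0, (sqrtC al); split.
    by apply/funext => x; rewrite /tri mul0r addr0.
  by move=> /(_ al (mem_head _ _)) ?; rewrite sqrtC_gt0.
- move=> [r2 /norm_abs_lt1 h]; exists (de ^+ r), 0, 1%N, de; split=> //.
  + by apply/funext => x; rewrite /tri mul0r addr0.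
  + by apply: pw => //; case: r r2.
  exists (sqrtC de ^+ r), 0, (sqrtC de); split.
    by apply/funext => x; rewrite /tri mul0r addr0.
  move=> /(_ de); rewrite !inE eqxx orbT => /(_ isT) de0.
  by rewrite exprn_gt0 ?sqrtC_gt0.
- move=> [r2 /norm_abs_lt1 h]; exists (de ^+ r), 1, r, de; split=> //.
  + by apply/funext => x; rewrite /tri mul1r.
  + by apply: pw => //; case: r r2.
  + by case: r r2.
  exists (sqrtC de ^+ r), (2^-1 * sqrtC de ^- r), (sqrtC de); split=> //.
  move=> /(_ de); rewrite !inE eqxx orbT => /(_ isT) de0.
  by rewrite exprn_gt0 ?sqrtC_gt0.
- move=> /norm_abs_lt1 h; exists al, 1, 1%N, al; split=> //.
    by apply/funext => x; rewrite /tri mul1r.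
  exists (sqrtC al), (2^-1 * (sqrtC al)^-1), (sqrtC al); split=> //.
  by move=> /(_ al (mem_head _ _)) ?; rewrite sqrtC_gt0.
move=> [/norm_abs_lt1 h1 /norm_abs_lt1 h2 _]; exists al, 0, 1%N, de; split=> //.
  by apply/funext => x; rewrite /tri mul0r addr0.
exists (sqrtC al), 0, (sqrtC de); split.
  by apply/funext => x; rewrite /tri mul0r addr0.
move=> H; rewrite !sqrtC_gt0; split; apply: H; rewrite !inE eqxx ?orbT //.
Qed.

Lemma contraction_lift (f : hopf_contraction R) (phi : Hopf (cmap f) -> Hopf (cmap f)) :
  admissible f -> biholomorphic phi ->
  exists U1 U2, [/\ bipoly U1, bipoly U2 & lifts phi U1 U2].
Proof.
move=> /contraction_tri [a [c [m [d [E ha hd m0 _]]]]]; move: phi; rewrite E.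
move=> phi /(automorphism_lift ha hd m0) [U1 [U2 [b1 b2 h1 h2 h3]]].
by exists U1, U2.
Qed.

(* Both differences are eigenvectors of the pullback by the square root h, for
   the eigenvalues -d' and -a'. *)
Lemma commutes_with_root (f : C2 -> C2) (phi : Hopf f -> Hopf f) (U1 U2 : C2 -> C)
    (a' c' d' : C) m :
  bipoly U1 -> bipoly U2 -> lifts phi U1 U2 ->
  (forall x, tri a' c' m d' (tri a' c' m d' x) = f x) ->
  (forall i j, - a' <> a' ^+ i * d' ^+ j) ->
  (forall i j, - d' <> a' ^+ i * d' ^+ j) ->
  let h := tri a' c' m d' in forall x, (U1 (h x), U2 (h x)) = h (U1 x, U2 x).
Proof.
move=> b1 b2 [_ _ Uf] hhf na nd h; rewrite -/h in hhf.
have comp_h (U : C2 -> C) : bipoly U -> bipoly (fun x => U (h x)).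
  move=> bU; apply: (bipoly_comp (p := fun x => a' * x.1 + c' * x.2 ^+ m)
    (q := fun x => d' * x.2)) => //.
    apply: bipolyD; first exact/bipolyZ/bipoly_fst.
    exact/bipolyZ/bipolyX/bipoly_snd.
  exact/bipolyZ/bipoly_snd.
have Uhh x : x != 0 -> (U1 (h (h x)), U2 (h (h x))) = h (h (U1 x, U2 x)).
  by move=> x0; rewrite !hhf Uf.
have e2 x : U2 (h x) = d' * U2 x.
  apply/eqP; rewrite -subr_eq0 -mulNr; apply/eqP; move: x.
  apply: (@bipoly_eigen_eq0 _ (fun x => U2 (h x) + - d' * U2 x) a' c' d' (- d') m) => //.
    by apply: bipolyD; [exact: comp_h | exact: bipolyZ].
  move=> x x0; have [_ E2] := Uhh x x0.
  by rewrite -[(_, _)]/(h x) E2 /h /tri /=; ring.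
have e1 x : U1 (h x) = a' * U1 x + c' * U2 x ^+ m.
  apply/eqP; rewrite -subr_eq0 opprD -!mulNr; apply/eqP; move: x.
  apply: (@bipoly_eigen_eq0 _ (fun x => U1 (h x) + (- a' * U1 x + - c' * U2 x ^+ m))
    a' c' d' (- a') m) => //.
    apply: bipolyD; first exact: comp_h.
    by apply: bipolyD; [exact: bipolyZ | exact/bipolyZ/bipolyX].
  move=> x x0; have [E1 _] := Uhh x x0.
  rewrite -[(_ + _, _)]/(h x) E1 e2 /h /tri /= exprMn.
  move: (U2 x ^+ m) (d' ^+ m) => W D; ring.
by move=> x; rewrite e1 e2.
Qed.

Lemma hproj_surj (f : C2 -> C2) (p : Hopf f) : exists2 x, x != 0 & p = hproj f x.
Proof. by exists (hrepr p); rewrite ?hreprK ?hrepr_neq0. Qed.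

(** Since [U] commutes with h, the even condition at h x is the odd condition at x. Conversely, the
    odd condition at h x involves k (h (h x)) = f (k x), in the class of k x, and becomes the even
    condition at x. *)
Lemma commutes_odd_even (f h k : C2 -> C2) (phi s1 s2 : Hopf f -> Hopf f)
    (U1 U2 : C2 -> C) (U := fun x => (U1 x, U2 x) : C2) :
  (forall x, x != 0 -> f x != 0) -> (forall x, x != 0 -> h x != 0) ->
  (forall x, x != 0 -> k x != 0) ->
  (forall x, h (h x) = f x) -> (forall x, k (f x) = f (k x)) ->
  (forall x, x != 0 -> s1 (hproj f x) = hproj f (k (h x))) ->
  (forall x, x != 0 -> s2 (hproj f x) = hproj f (k x)) ->
  lifts phi U1 U2 -> (forall x, U (h x) = h (U x)) ->
  (forall p, phi (s1 p) = s1 (phi p)) <-> (forall p, phi (s2 p) = s2 (phi p)).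
Proof.
move=> f0 h0 k0 hhf kf s1E s2E [U0 phiE Uf] Uh.
have pf x : x != 0 -> hproj f (f x) = hproj f x.
  by move=> x0; apply/hprojP; rewrite ?f0 //; exists 0%N, 1%N.
have E1 x : x != 0 -> phi (s1 (hproj f x)) = s1 (phi (hproj f x)) <->
    hproj f (U (k (h x))) = hproj f (k (U (h x))).
  by move=> x0; rewrite s1E // phiE ?k0 ?h0 // phiE // s1E ?U0 // Uh.
have E2 x : x != 0 -> phi (s2 (hproj f x)) = s2 (phi (hproj f x)) <->
    hproj f (U (k x)) = hproj f (k (U x)).
  by move=> x0; rewrite s2E // phiE ?k0 // phiE // s2E ?U0.
split=> H p; have [x x0 ->] := hproj_surj p; last first.
  by apply/E1 => //; apply/(E2 _ (h0 _ x0)).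
apply/E2 => //; have /(E1 _ (h0 _ x0)) := H (hproj f (h x)).
rewrite hhf kf /U Uf ?k0 // Uf // kf !pf //; first exact: k0 (U0 _ x0).
exact/U0/k0.
Qed.

Lemma HopfAut_eq (f : C2 -> C2) (s1 s2 : Hopf f -> Hopf f) :
  (forall phi, biholomorphic phi ->
    (forall p, phi (s1 p) = s1 (phi p)) <-> (forall p, phi (s2 p) = s2 (phi p))) ->
  HopfAut s1 = HopfAut s2.
Proof. by move=> H; apply/seteqP; split=> phi [bphi] /(H phi bphi). Qed.

Lemma HopfAut_odd_even (f : hopf_contraction R) : admissible f ->
  real_coeffs f -> positive_diag f ->
  HopfAut (odd_structure f) = HopfAut (even_structure f).
Proof.
move=> fA fR fP; apply: HopfAut_eq => phi bphi.
have [U1 [U2 [b1 b2 L]]] := contraction_lift fA bphi.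
have nc : in_IIc' f = false.
  case: f fP {fA fR phi bphi U1 U2 b1 b2 L} => //= al de fP.
  have al0 : 0 < al by apply: fP; rewrite mem_head.
  by rewrite (gtr0_real al0) andbF.
have [a [c [m [d [E ha hd m0 [a' [c' [d' [Eh /(_ fP) [a'0 d'0]]]]]]]]]] := contraction_tri fA.
(* Positive diagonal coefficients make every monomial in a' and d' positive. *)
have neg (x : C) i j : 0 < x -> - x <> a' ^+ i * d' ^+ j.
  move=> x0 e; have : 0 < - x by rewrite e mulr_gt0 ?exprn_gt0.
  by rewrite oppr_gt0 => /(lt_trans x0); rewrite ltxx.
apply: (@commutes_odd_even _ (half_iterate f) (@conj2 R) _ _ _ U1 U2) => //.
- by move=> x; exact: cmap_neq0.
- by move=> x; exact: half_neq0.
- by move=> x; exact: conj2_neq0.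
- by move=> x; exact: half_iterateK.
- by move=> x; exact: conj2_cmap.
- by move=> x; exact: odd_structure_hproj.
- by move=> x x0; rewrite even_structure_hproj ?nc //; left.
rewrite Eh; apply: (commutes_with_root b1 b2 L) => [x|i j|i j]; try exact: neg.
by rewrite -Eh half_iterateK.
Qed.

(** Let x be beta or its conjugate. If - x is a monomial of exponents i, j in beta and its
    conjugate, moduli force i + j = 1, so - x is itself beta or its conjugate. Then beta = 0, or
    beta is opposite to its conjugate, which would make alpha = - |beta|^2 real. *)
Lemma HopfAut_odd_even_IIc' (f : hopf_contraction R) (beta : C) : admissible f ->
  in_IIc' f -> beta ^+ 2 = (diag_coeffs f)`_0 ->
  HopfAut (odd_structure_IIc' f beta) = HopfAut (even_structure f).
Proof.
move=> fA fc bE; apply: HopfAut_eq => phi bphi.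
have [U1 [U2 [b1 b2 L]]] := contraction_lift fA bphi.
have [al fE [al1 alNR]] : exists2 al : C, f = IIc al al^* & 0 < `|al| < 1 /\ al \isn't Num.real.
  case: f fc fA {bE phi bphi U1 U2 b1 b2 L} => //= al de /andP[/eqP -> ?] [? _ _].
  by exists al.
have {}bE : beta ^+ 2 = al by rewrite bE fE.
have al0 := pos_norm_neq0 al1.
have be0 : beta != 0 by rewrite -sqrf_eq0 bE.
have nbe : `|beta| < 1.
  have /andP[_] := al1; rewrite -bE normrX expr_lt1 //.
have cb : beta^* != - beta.
  apply/eqP => e; move/negP: alNR; apply.
  have -> : al = - `|beta| ^+ 2 by rewrite normCK e mulrN opprK -expr2.
  by rewrite realN realX // realE normr_ge0.
have bN : - beta != beta.
  by rewrite -subr_eq0 -opprD oppr_eq0 -mulr2n mulrn_eq0.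
have key (x : C) i j : `|x| = `|beta| -> - x != beta -> - x != beta^* ->
    - x <> beta ^+ i * beta^* ^+ j.
  move=> nx x1 x2 e; have := congr1 (fun t => `|t|) e.
  rewrite normrN nx normrM !normrX norm_conjC -exprD.
  move=> /esym /(@expr_eq_self _ `|beta|); rewrite normr_id normr_gt0 be0 nbe.
  case: i j e => [|[|i]] [|[|j]] e // /(_ isT) // _.
    by move: x2; rewrite e !expr0 mul1r expr1 eqxx.
  by move: x1; rewrite e !expr0 mulr1 expr1 eqxx.
have Eh : (fun p => (beta * p.1, beta^* * p.2)) = tri beta 0 1 beta^* :> (C2 -> C2).
  by apply/funext => x; rewrite /tri mul0r addr0.
have hhf x : tri beta 0 1 beta^* (tri beta 0 1 beta^* x) = cmap f x.
  rewrite -Eh fE /=; congr pair; first by rewrite mulrA -expr2 bE.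
  by rewrite mulrA -expr2 -rmorphXn /= bE.
apply: (@commutes_odd_even _ (tri beta 0 1 beta^*) (@conj2_swap R) _ _ _ U1 U2) => //.
- by move=> x; exact: cmap_neq0.
- by move=> x x0; rewrite -Eh; apply: scale_neq0; rewrite ?conjC_eq0.
- by move=> x; exact: conj2_swap_neq0.
- by move=> x; exact: conj2_swap_cmap.
- by move=> x x0; rewrite odd_structure_IIc'_hproj // -Eh.
- by move=> x x0; rewrite even_structure_hproj ?fc //; right.
apply: (commutes_with_root b1 b2 L) => [//|i j|i j]; apply: key => //.
- by rewrite eq_sym.
- by rewrite norm_conjC.
- by rewrite eqr_oppLR.
- by rewrite -rmorphN (inj_eq (can_inj conjCK)).
Qed.
End SquareRoot.

(** * Quaternionic structures *)

Section Quaternionic.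
Variable R : realType.
Local Notation C := (Cplx R).
Local Notation C2 := (C2 R).

Lemma quaternion_mxact (a b : C) (x : C2) :
  mxact (quaternion_mx a b) x = (a * x.1 + - b^* * x.2, b * x.1 + a^* * x.2).
Proof. by rewrite /mxact !mxE. Qed.

Lemma mxact_mul (A B : 'M[C]_2) (x : C2) : mxact (A *m B) x = mxact A (mxact B x).
Proof.
rewrite /mxact !mxE !big_ord_recl !big_ord0 /= !addr0.
have -> : lift ord0 ord0 = 1 :> 'I_2 by exact: val_inj.
by congr pair; ring.
Qed.

Lemma quaternion_mxM (a b a' b' : C) :
  quaternion_mx a b *m quaternion_mx a' b' =
  quaternion_mx (a * a' - b^* * b') (b * a' + a^* * b').
Proof.
apply/matrixP => i j; rewrite !mxE !big_ord_recl big_ord0 /= !mxE /= addr0.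
rewrite !(rmorphD, rmorphB, rmorphM, rmorphN) /= !conjCK.
by case: i j => [[|[|i]] hi] [[|[|j]] hj] //=; ring.
Qed.

Lemma normC2_neq0 (a b : C) : ((a, b) : C2) != 0 -> a * a^* + b * b^* != 0.
Proof.
rewrite pair_neq0 -!normCK paddr_eq0 ?exprn_ge0 // !expf_eq0 /= !normr_eq0.
by rewrite negb_and.
Qed.

Lemma mxact_neq0 (A : 'M[C]_2) (x : C2) : quaternion_group A -> x != 0 -> mxact A x != 0.
Proof.
move=> [a [b [/normC2_neq0 n0 ->]]]; case: x => z w; rewrite quaternion_mxact /=.
apply: contra_neq => -[e1 e2]; congr pair; apply: (mulfI n0); rewrite mulr0.
  transitivity (a^* * (a * z + - b^* * w) + b^* * (b * z + a^* * w)); first by ring.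
  by rewrite e1 e2 !mulr0 addr0.
transitivity (a * (b * z + a^* * w) - b * (a * z + - b^* * w)); first by ring.
by rewrite e1 e2 !mulr0 subr0.
Qed.

(** The pair defining the product is its first column, that is, A applied to (a', b'), hence
    nonzero. *)
Lemma quaternion_group_mul (A B : 'M[C]_2) :
  quaternion_group A -> quaternion_group B -> quaternion_group (A *m B).
Proof.
move=> gA [a' [b' [ab0 BE]]]; have [a [b [_ AE]]] := gA.
exists (a * a' - b^* * b'), (b * a' + a^* * b').
split; last by rewrite AE BE quaternion_mxM.
by have := mxact_neq0 gA ab0; rewrite AE quaternion_mxact /= mulNr.
Qed.

Lemma quaternion_group_inv (A : 'M[C]_2) : quaternion_group A ->
  exists2 B, quaternion_group B & A *m B = 1%:M /\ B *m A = 1%:M.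
Proof.
move=> [a [b [ab0 ->]]]; have n0 := normC2_neq0 ab0; set n := _ + _ in n0.
have nR : n^* = n by rewrite /n rmorphD !rmorphM /= !conjCK; ring.
have q1 : quaternion_mx 1 0 = 1%:M :> 'M[C]_2.
  apply/matrixP => i j; rewrite !mxE rmorph0 rmorph1 oppr0.
  by case: i j => [[|[|i]] hi] [[|[|j]] hj].
exists (quaternion_mx (a^* / n) (- b / n)).
  exists (a^* / n), (- b / n); split=> //; move: ab0.
  by rewrite !pair_neq0 !mulf_eq0 invr_eq0 (negPf n0) !orbF conjC_eq0 oppr_eq0.
rewrite !quaternion_mxM -q1 !(rmorphM, rmorphN) /= fmorphV /= nR conjCK.
by split; congr quaternion_mx; rewrite /n in n0 *; field.
Qed.

Lemma differentiable_mxact (A : 'M[C]_2) (x : C2) : differentiable (mxact A) x.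
Proof.
have d1 := @differentiable_fst R x; have d2 := @differentiable_snd R x.
by apply: differentiable_pair; apply: differentiableD; apply: differentiableZ.
Qed.

Section IV.
Variables (alpha beta : C).
Hypotheses (al0 : alpha < 0) (al1 : `|alpha| < 1) (bE : beta ^+ 2 = alpha).
Local Notation f := (cmap (IV alpha)).
Local Notation s := (@quaternionic_structure R (IV alpha) beta).

Let alpha0 : alpha != 0. Proof. by rewrite lt_eqF. Qed.
Let beta0 : beta != 0. Proof. by rewrite -sqrf_eq0 bE. Qed.
Let fA : admissible (IV alpha).
Proof. by rewrite /= normr_gt0 alpha0. Qed.

Lemma expz_conj (k : int) : (alpha ^ k)^* = alpha ^ k.
Proof.
have aR : alpha^* = alpha by apply/CrealP; rewrite realE (ltW al0) orbT.
by case: k => n; rewrite ?NegzE -?exprnN ?fmorphV ?rmorphXn /= aR.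
Qed.

Lemma iter_scaling n (x : C2) : iter n f x = (alpha ^+ n * x.1, alpha ^+ n * x.2).
Proof.
elim: n => [|n IH]; first by rewrite !mul1r -surjective_pairing.
by rewrite iterS IH /= !exprS !mulrA.
Qed.

Lemma hproj_scaling (x y : C2) : x != 0 -> y != 0 ->
  hproj f x = hproj f y <-> exists k : int, x = (alpha ^ k * y.1, alpha ^ k * y.2).
Proof.
move=> x0 y0; rewrite (hopf_relE (cmap_inj fA) x0 y0); split.
  move=> [] [n ->]; rewrite iter_scaling /=; last by exists n%:Z.
  exists (- n%:Z); rewrite -exprnN !mulrA mulVf ?expf_neq0 // !mul1r.
  exact: surjective_pairing.
move=> [[n|n] ->]; [right|left]; first by exists n; rewrite iter_scaling.
exists n.+1; rewrite iter_scaling NegzE -exprnN /= !mulrA divff ?expf_neq0 // !mul1r.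
exact: surjective_pairing.
Qed.

(** An integral power of alpha of modulus 1 has exponent 0, so the value - 1 is excluded although
    alpha is negative. *)
Lemma expz_sqr1 (k : int) : alpha ^ k * alpha ^ k = 1 -> alpha ^ k = 1.
Proof.
move=> h; have {}h : `|alpha ^ k| = 1.
  by apply/eqP; rewrite -(@pexpr_eq1 _ _ 2) // -normrX expr2 h normr1.
case: k h => n; rewrite ?NegzE -?exprnN -?exprnP.
  case: n => [|n] //; rewrite normrX => h.
  by have := @exprn_ilt1 _ n.+1 _ (normr_ge0 alpha) al1; rewrite h ltxx.
rewrite normfV normrX => /(congr1 (fun t => t^-1)); rewrite invrK invr1 => h.
by have := @exprn_ilt1 _ n.+1 _ (normr_ge0 alpha) al1; rewrite h ltxx.
Qed.

Lemma mxact_scale (A : 'M[C]_2) (k : C) x : mxact (k *: A) x =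
  (k * (mxact A x).1, k * (mxact A x).2).
Proof. by rewrite /mxact !mxE /=; congr pair; ring. Qed.

Lemma Jmap_mxact (A : 'M[C]_2) (x : C2) : quaternion_group A ->
  Jmap (beta * (mxact A x).1, beta * (mxact A x).2) =
  mxact A (Jmap (beta * x.1, beta * x.2)).
Proof.
move=> [a [b [_ ->]]]; rewrite !quaternion_mxact /Jmap /=.
rewrite !(rmorphD, rmorphM, rmorphN) /= !conjCK; congr pair; ring.
Qed.

Lemma holomorphic_mxact (A : 'M[C]_2) : quaternion_group A ->
  holomorphic (hopf_induced f (mxact A)).
Proof.
move=> gA x x0; exists (mxact A); apply/near_nrmP; exists (nrm x).
  by rewrite nrm_gt0.
move=> y hy; have y0 : y != 0.
  by apply: contraTneq hy => ->; rewrite sub0r nrmN ltxx.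
split; [exact: differentiable_mxact | exact: mxact_neq0 | exact: mxact_hproj].
Qed.

Lemma mxact_comp (A B : 'M[C]_2) : quaternion_group A -> quaternion_group B ->
  hopf_induced f (mxact (A *m B)) =
  hopf_induced f (mxact A) \o hopf_induced f (mxact B).
Proof.
move=> gA gB; apply/funext => p; have [x x0 ->] := hproj_surj p.
rewrite mxact_hproj ?mxact_mul //; last exact: quaternion_group_mul.
rewrite -[RHS]/(hopf_induced f (mxact A) (hopf_induced f (mxact B) (hproj f x))).
by rewrite [in RHS]mxact_hproj // mxact_hproj // mxact_neq0.
Qed.

Lemma hopf_induced_mx1 : hopf_induced f (mxact 1%:M) = id.
Proof.
apply/funext => p; rewrite /hopf_induced /mxact !mxE /= !mul1r !mul0r addr0 add0r.
by rewrite -surjective_pairing hreprK.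
Qed.

Lemma mxact_HopfAut (A : 'M[C]_2) : quaternion_group A ->
  HopfAut s (hopf_induced f (mxact A)).
Proof.
move=> gA; have [B gB [AB BA]] := quaternion_group_inv gA; split.
  split; first exact: holomorphic_mxact.
  exists (hopf_induced f (mxact B)); split; first exact: holomorphic_mxact.
    by move=> p; rewrite -[LHS]/((_ \o _) p) -mxact_comp // BA hopf_induced_mx1.
  by move=> p; rewrite -[LHS]/((_ \o _) p) -mxact_comp // AB hopf_induced_mx1.
move=> p; have [x x0 ->] := hproj_surj p.
rewrite quaternionic_structure_hproj // [in RHS]mxact_hproj //.
rewrite quaternionic_structure_hproj ?mxact_neq0 // mxact_hproj ?Jmap_mxact //.
exact/Jmap_neq0/scale_neq0.
Qed.

(** The lift is linear, with columns (p, r) and (q, t), and commutes with the lift of the structure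
    up to powers of alpha that may depend on the point. Three real vectors, (1, 0), (0, 1) and (1,
    1), suffice: the third forces the three powers to be equal, and using the relations twice shows
    that their square is 1. *)
Lemma HopfAut_mxact phi : HopfAut s phi ->
  exists2 A, quaternion_group A & hopf_induced f (mxact A) = phi.
Proof.
move=> [bphi sphi]; have [U1 [U2 [b1 b2 [U0 phiE Uf]]]] := contraction_lift fA bphi.
have ka : 0 < `|alpha| < 1 by rewrite normr_gt0 alpha0.
have [p [q U1E]] : exists p q, forall x, U1 x = p * x.1 + q * x.2.
  by apply: (bipoly_homogeneous1 b1 ka) => x /Uf [].
have [r [t U2E]] : exists r t, forall x, U2 x = r * x.1 + t * x.2.
  by apply: (bipoly_homogeneous1 b2 ka) => x /Uf [].
(* A singular matrix would kill (t, - r) and (q, - p), so all four entries would vanish. *)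
have det0 : p * t - q * r != 0.
  apply/eqP => D.
  have e1 : ((t, - r) : C2) = 0.
    apply/eqP; apply/negPn/negP => /U0; rewrite U1E U2E /= pair_neq0.
    have -> : p * t + q * - r = p * t - q * r by ring.
    by rewrite D eqxx mulrN mulrC addrN eqxx.
  have e2 : ((q, - p) : C2) = 0.
    apply/eqP; apply/negPn/negP => /U0; rewrite U1E U2E /= pair_neq0.
    have -> : r * q + t * - p = - (p * t - q * r) by ring.
    by rewrite D oppr0 eqxx mulrN mulrC addrN eqxx.
  have := U0 (1, 0); rewrite !U1E !U2E /= !pair_neq0 !mulr1 !mulr0 !addr0.
  case: e1 e2 => _ /eqP; rewrite oppr_eq0 => /eqP -> [_ /eqP].
  by rewrite oppr_eq0 => /eqP ->; rewrite !eqxx oner_neq0 => /(_ isT).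
have orb x : x != 0 -> exists k : int,
    Jmap (beta * U1 x, beta * U2 x) =
    (alpha ^ k * U1 (Jmap (beta * x.1, beta * x.2)),
     alpha ^ k * U2 (Jmap (beta * x.1, beta * x.2))).
  move=> x0; have Jx : Jmap (beta * x.1, beta * x.2) != 0 by apply/Jmap_neq0/scale_neq0.
  apply/(hproj_scaling _ (U0 _ Jx)).
    by apply: Jmap_neq0; have := scale_neq0 beta0 beta0 (U0 _ x0).
  have := sphi (hproj f x); rewrite quaternionic_structure_hproj // !phiE //.
  by rewrite (quaternionic_structure_hproj al0 beta0 (U0 _ x0)).
have cb0 : beta^* != 0 by rewrite conjC_eq0.
have rel (z w : C) : ((z, w) : C2) != 0 -> z^* = z -> w^* = w -> exists k : int,
    - (r^* * z + t^* * w) = alpha ^ k * (q * z - p * w) /\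
    p^* * z + q^* * w = alpha ^ k * (t * z - r * w).
  move=> zw0 zR wR; have [k [E1 E2]] := orb _ zw0; exists k.
  move: E1 E2; rewrite !U1E !U2E /Jmap /= !(rmorphD, rmorphM) /= zR wR => E1 E2.
  split; apply: (mulfI cb0).
    transitivity (- (beta^* * (r^* * z + t^* * w))); first by ring.
    by rewrite E1; ring.
  by rewrite E2; ring.
have [k1 []] := rel 1 0 ltac:(by rewrite pair_neq0 oner_neq0) (rmorph1 _) (rmorph0 _).
rewrite !mulr1 !mulr0 !addr0 !subr0 => A1 A2.
have [k2 []] := rel 0 1 ltac:(by rewrite pair_neq0 oner_neq0 orbT) (rmorph0 _) (rmorph1 _).
rewrite !mulr1 !mulr0 !add0r => B1 B2.
have [k3 []] := rel 1 1 ltac:(by rewrite pair_neq0 oner_neq0) (rmorph1 _) (rmorph1 _).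
rewrite !mulr1 => D1 D2.
have c1 := expz_conj k1; have c2 := expz_conj k2.
move: A1 A2 B1 B2 D1 D2 c1 c2 (@expz_sqr1 k1).
move: (alpha ^ k1) (alpha ^ k2) (alpha ^ k3) => x1 x2 x3 A1 A2 B1 B2 D1 D2 c1 c2 sq1.
(* The relation at (1, 1) is compared with the sum of those at (1, 0) and (0, 1). *)
have G1 : (x1 - x3) * q = (x2 - x3) * p.
  have : x1 * q + x2 * - p = x3 * (q - p) by rewrite -A1 -B1 -D1; ring.
  move=> h; apply/eqP; rewrite -subr_eq0; apply/eqP.
  by rewrite -[RHS](subrr (x3 * (q - p))) -{1}h; ring.
have G2 : (x1 - x3) * t = (x2 - x3) * r.
  have : x1 * t + x2 * - r = x3 * (t - r) by rewrite -A2 -B2 -D2; ring.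
  move=> h; apply/eqP; rewrite -subr_eq0; apply/eqP.
  by rewrite -[RHS](subrr (x3 * (t - r))) -{1}h; ring.
have x13 : x1 = x3.
  apply/eqP; rewrite -subr_eq0 -(mulIr_eq0 _ (mulIf det0)).
  have -> : (x1 - x3) * (p * t - q * r) = p * ((x1 - x3) * t) - r * ((x1 - x3) * q) by ring.
  by rewrite G1 G2; apply/eqP; ring.
have x23 : x2 = x3.
  apply/eqP; rewrite -subr_eq0 -(mulIr_eq0 _ (mulIf det0)).
  have -> : (x2 - x3) * (p * t - q * r) = t * ((x2 - x3) * p) - q * ((x2 - x3) * r) by ring.
  by rewrite -G1 -G2; apply/eqP; ring.
(* Conjugation exchanges p with t and r with q, up to sign and the factors x1 and x2; doing it twice
   multiplies p and r, which are not both 0, by x1 x2. *)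
have x12 : x1 * x2 = 1.
  have pr : (p != 0) || (r != 0).
    rewrite -negb_and; apply: contraNN det0 => /andP[/eqP -> /eqP ->].
    by rewrite mul0r mulr0 subr0.
  have e1 : x1 * x2 * p = p.
    apply: (can_inj conjCK); rewrite !rmorphM /= c1 c2 A2 -mulrA; congr (_ * _).
    have : t^* = x2 * p by apply: oppr_inj; rewrite B1 mulrN.
    by move=> /(congr1 (fun y => y^*)); rewrite conjCK rmorphM /= c2 -A2 => <-.
  have e2 : x1 * x2 * r = r.
    apply: (can_inj conjCK); rewrite !rmorphM /= c1 c2 -[RHS]opprK A1 -mulrA -mulrN.
    congr (_ * _); have := B2 => /(congr1 (fun y => y^*)).
    by rewrite conjCK rmorphM rmorphN /= c2 => ->; rewrite mulrN opprK.
  case/orP: pr => h0; apply: (mulIf h0); by rewrite mul1r.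
have x1E : x1 = 1 by apply: sq1; rewrite {2}x13 -x23.
rewrite x1E !mul1r in A1 A2.
exists (quaternion_mx p r).
  exists p, r; split=> //; rewrite pair_neq0 -negb_and.
  apply: contraNN det0 => /andP[/eqP -> /eqP ->].
  by rewrite mul0r mulr0 subr0.
apply/funext => P; rewrite /hopf_induced quaternion_mxact -[in RHS](hreprK P).
by rewrite phiE ?hrepr_neq0 // U1E U2E -A1 A2.
Qed.

Lemma HopfAut_quaternionic :
  HopfAut s = [set hopf_induced f (mxact A) | A in @quaternion_group R].
Proof.
apply/seteqP; split=> [phi /HopfAut_mxact [A gA <-]|_ [A gA <-]]; first by exists A.
exact: mxact_HopfAut.
Qed.

(** A matrix of the group is determined by its first column, the image of (1, 0); the scalar alpha^k
    is real, so it passes to the conjugated entries. *)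
Lemma hopf_induced_mxact_eq (A B : 'M[C]_2) : quaternion_group A -> quaternion_group B ->
  hopf_induced f (mxact A) = hopf_induced f (mxact B) <->
  exists k : int, A = alpha ^ k *: B.
Proof.
move=> gA gB; split=> [E|[k AE]].
  have e0 : ((1, 0) : C2) != 0 by rewrite pair_neq0 oner_neq0.
  have := congr1 (fun g => g (hproj f (1, 0))) E; rewrite !mxact_hproj //.
  move=> /(hproj_scaling (mxact_neq0 gA e0) (mxact_neq0 gB e0)) [k].
  have [a [b [_ ->]]] := gA; have [a' [b' [_ ->]]] := gB.
  rewrite !quaternion_mxact /= !mulr1 !mulr0 !addr0 => -[-> ->]; exists k.
  apply/matrixP => i j; rewrite !mxE !rmorphM /= expz_conj -mulrN.
  by case: i j => [[|[|i]] hi] [[|[|j]] hj].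
apply/funext => p; have [x x0 ->] := hproj_surj p; rewrite !mxact_hproj //.
apply/(hproj_scaling (mxact_neq0 gA x0) (mxact_neq0 gB x0)); exists k.
by rewrite AE mxact_scale.
Qed.
End IV.
End Quaternionic.

(** The quotient by the group generated by alpha I is expressed through the map from matrices to
    self-maps of H_f: its image, its multiplicativity, and its fibres, the orbits of scaling by
    powers of alpha. *)
Theorem theorem4p3 (R : realType) (f : hopf_contraction R) (hf : admissible f) :
  [/\ real_coeffs f -> positive_diag f ->
        HopfAut (odd_structure f) = HopfAut (even_structure f),
      in_IIc' f -> forall beta : Cplx R, beta ^+ 2 = (diag_coeffs f)`_0 ->
        HopfAut (odd_structure_IIc' f beta) = HopfAut (even_structure f)
    & forall alpha beta : Cplx R, f = IV alpha -> alpha < 0 ->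
        beta ^+ 2 = alpha ->
        [/\ HopfAut (quaternionic_structure f beta) =
              [set hopf_induced (cmap f) (mxact A) | A in @quaternion_group R],
            forall A B : 'M[Cplx R]_2,
              quaternion_group A -> quaternion_group B ->
              quaternion_group (A *m B) /\
              hopf_induced (cmap f) (mxact (A *m B)) =
                hopf_induced (cmap f) (mxact A) \o hopf_induced (cmap f) (mxact B)
          & forall A B : 'M[Cplx R]_2,
              quaternion_group A -> quaternion_group B ->
              (hopf_induced (cmap f) (mxact A) = hopf_induced (cmap f) (mxact B) <->
               exists k : int, A = alpha ^ k *: B)]].
Proof.
split.
- exact: HopfAut_odd_even.
- by move=> fc beta; exact: HopfAut_odd_even_IIc'.
move=> alpha beta fE al0 bE; subst f; have /andP[_ al1] := hf.
split.
- exact: HopfAut_quaternionic.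
- move=> A B gA gB; split; first exact: quaternion_group_mul.
  exact: mxact_comp.
by move=> A B; exact: hopf_induced_mxact_eq.
Qed.
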